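(* Let $n\in\mathbb N$, $p\in[1,\infty)$, $\Omega=[0,1]^n$, let $Y$ be a complex Banach space, and let $F:\mathbb R^n\to Y$ be such that $\|F(\cdot)\|_Y\in L^p(K)$ for every compact set $K\subseteq\mathbb R^n$ (equivalently, $\mathbf u\mapsto\|F(\mathbf t+\mathbf u)\|_Y$ lies in $L^p(l\Omega)$ for all $\mathbf t\in\mathbb R^n$, $l>0$). Then $F\in e-W^p_{ap,\mathbb R^n}(\mathbb R^n:Y)$ if and only if $F\in e-W^p(\mathbb R^n:Y)$.
   Context: $B(\mathbf t_0,L)$ is the ball of radius $L$ centred at $\mathbf t_0$. $e-W^p_{ap,\mathbb R^n}(\mathbb R^n:Y)$ is the set of all $G:\mathbb R^n\to Y$ such that for every $\epsilon>0$ there exist $l>0$ and $L>0$ such that for each $\mathbf t_0\in\mathbb R^n$ there exists $\tau\in B(\mathbf t_0,L)$ with $\sup_{\mathbf t\in\mathbb R^n}l^{-n/p}\|G(\tau+\cdot)-G(\cdot)\|_{L^p(\mathbf t+l\Omega:Y)}<\epsilon$. A trigonometric polynomial $P:\mathbb R^n\to Y$ is a finite sum $\sum_j e^{i\langle\lambda_j,\mathbf t\rangle}c_j$ with $\lambda_j\in\mathbb R^n$, $c_j\in Y$. $e-W^p(\mathbb R^n:Y)$ is the set of all such $F$ such that for every $\epsilon>0$ there exist $l_0>0$ and a trigonometric polynomial $P$ with $\sup_{\mathbf t\in\mathbb R^n}l^{-n/p}\|P(\mathbf t+\cdot)-F(\mathbf t+\cdot)\|_{L^p(l\Omega:Y)}<\epsilon$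 for all $l\ge l_0$.
   Formalization: F is additionally assumed strongly (Bochner–Lebesgue) measurable; without this the claim fails, e.g. for a 1-periodic non-measurable function with values ±1, whose norm is locally in L^p. *)

(* Defs.v *)
From HB Require Import structures.
From mathcomp Require Import all_boot all_order all_algebra.
From mathcomp Require Import all_classical all_reals all_analysis.
From mathcomp.real_closed Require Import complex.
Set Implicit Arguments. Unset Strict Implicit. Unset Printing Implicit Defensive.
Import Order.TTheory GRing.Theory Num.Theory.
Import numFieldNormedType.Exports.
Local Open Scope classical_set_scope.
Local Open Scope ring_scope.

Section Defs.
Variable R : realType.

Definition hobox n (a b : 'rV[R]_n) : set 'rV[R]_n :=
  [set x | forall i, a 0 i <= x 0 i < b 0 i].

(* the "all subsets" sigma-algebra, used only as the covering family for
   the Lebesgue outer measure below *)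
Definition RnAll n := g_sigma_algebraType [set: set 'rV[R]_n].

(* elementary volume: product of side lengths on (nonempty-type) boxes,
   0 on the empty set, +oo on other sets (so that only box covers count) *)
Definition boxvol n (A : set (RnAll n)) : \bar R :=
  if pselect (A = set0) then 0%E
  else ereal_inf [set (\prod_(i < n) (ab.2 0 i - ab.1 0 i))%:E |
         ab in [set ab : 'rV[R]_n * 'rV[R]_n |
            (forall i, ab.1 0 i <= ab.2 0 i) /\ A = hobox ab.1 ab.2]].

Lemma boxvol0 n : boxvol (set0 : set (RnAll n)) = 0%E.
Proof. by rewrite /boxvol; destruct pselect. Qed.

Lemma boxvol_ge0 n (A : set (RnAll n)) : (0 <= boxvol A)%E.
Proof.
rewrite /boxvol; destruct pselect => //.
apply: le_ereal_inf_tmp => y [ab [hab _]] <-.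
by rewrite lee_fin; apply: prodr_ge0 => i _; rewrite subr_ge0.
Qed.


Section Lebesgue_n.
Variable n : nat.

Definition lebn_outer : set (RnAll n) -> \bar R := mu_ext (@boxvol n).

HB.instance Definition _ := isOuterMeasure.Build R (RnAll n) lebn_outer
  (@mu_ext0 _ (RnAll n) R (@boxvol n) (@boxvol0 n) (@boxvol_ge0 n))
  (mu_ext_ge0 (@boxvol_ge0 n))
  (le_mu_ext (@boxvol n))
  (mu_ext_sigma_subadditive (@boxvol_ge0 n)).

Definition Rn : measurableType _ := caratheodory_type lebn_outer.

Definition lebn : set Rn -> \bar R := lebn_outer.

HB.instance Definition _ := isMeasure.Build _ _ _ lebn
  (@caratheodory_measure0 R (RnAll n) lebn_outer)
  (@caratheodory_measure_ge0 R (RnAll n) lebn_outer)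
  (@caratheodory_measure_sigma_additive R (RnAll n) lebn_outer).

End Lebesgue_n.
End Defs.

Section Spaces.
Variables (R : realType) (n : nat) (p : R) (Y : completeNormedModType R[i]).
Local Open Scope complex_scope.

Definition toRV (u : Rn R n) : 'rV[R]_n := u.

(* the (real) norm of Y: the norm of a normedModType over R[i] takes values
   in R[i] (with zero imaginary part); we take its real part *)
Definition nrmY (y : Y) : R := complex.Re `|y|.

Definition tcube (t : 'rV[R]_n) (l : R) : set (Rn R n) :=
  [set u | forall i, t 0 i <= toRV u 0 i <= t 0 i + l].

Definition eball (t0 : 'rV[R]_n) (L : R) : set 'rV[R]_n :=
  [set tau | Num.sqrt (\sum_(i < n) (tau 0 i - t0 0 i) ^+ 2) < L].

Definition LpNorm (D : set (Rn R n)) (g : Rn R n -> Y) : \bar R :=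
  poweR (\int[@lebn R n]_(u in D) ((nrmY (g u)) `^ p)%:E) p^-1.

Definition expi (theta : R) : R[i] := (cos theta +i* sin theta).

Definition trigpol (m : nat) (lam : 'I_m -> 'rV[R]_n) (c : 'I_m -> Y)
  : 'rV[R]_n -> Y :=
  fun t => \sum_(j < m) expi (\sum_(i < n) lam j 0 i * t 0 i) *: c j.

Definition is_trigpol (P : 'rV[R]_n -> Y) : Prop :=
  exists m lam c, P = @trigpol m lam c.

Definition eWap (G : 'rV[R]_n -> Y) : Prop :=
  forall eps : R, 0 < eps ->
  exists l : R, 0 < l /\ exists L : R, 0 < L /\
  forall t0 : 'rV[R]_n, exists tau : 'rV[R]_n, eball t0 L tau /\
    (ereal_sup [set mule (l `^ (- (n%:R / p)))%:E
                      (LpNorm (tcube t l) (fun u => G (tau + toRV u) - G (toRV u)))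
                | t in [set: 'rV[R]_n]] < eps%:E)%O.

Definition eW (F : 'rV[R]_n -> Y) : Prop :=
  forall eps : R, 0 < eps ->
  exists l0 : R, 0 < l0 /\ exists P : 'rV[R]_n -> Y, is_trigpol P /\
  forall l : R, l0 <= l ->
    (ereal_sup [set mule (l `^ (- (n%:R / p)))%:E
                      (LpNorm (tcube 0 l) (fun u => P (t + toRV u) - F (t + toRV u)))
                | t in [set: 'rV[R]_n]] < eps%:E)%O.

Definition lebn_simple (s : Rn R n -> Y) : Prop :=
  finite_set (range s) /\ forall y : Y, measurable (s @^-1` [set y]).

Definition strongly_measurable (F : 'rV[R]_n -> Y) : Prop :=
  exists s : nat -> Rn R n -> Y, (forall k, lebn_simple (s k)) /\
    {ae @lebn R n, forall t : Rn R n, (fun k => s k t) @ \oo --> F (toRV t)}.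

Definition locLp (F : 'rV[R]_n -> Y) : Prop :=
  forall K : set 'rV[R]_n, compact K ->
    measurable_fun (K : set (Rn R n)) (fun u : Rn R n => nrmY (F (toRV u))) /\
    (\int[@lebn R n]_(u in (K : set (Rn R n))) ((nrmY (F (toRV u))) `^ p)%:E
       < +oo)%E.

End Spaces.

(* Main.v *)
(* A function in e-W^p is a limit of trigonometric polynomials, and finitely many
   characters have common almost periods in every large ball, by the pigeonhole
   principle.

   Conversely, let F be in e-W^p_ap with tolerance e. On bounded regions F is
   L^p-close to a uniformly continuous function, so small vectors are almost
   periods (up to constant multiples of e), and F is close to a bounded function
   G which is constant on the cells of a grid of step h. Finitely many translates
   of the set of almost periods cover a lattice on each coordinate axis;
   Bogolyubov's lemma therefore yields a Bohr set consisting of almost periods.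
   Products of functions (1 + cos <lam, v>) / 2 give trigonometric polynomials
   phi_i >= 0 with sum close to 1, phi_i being concentrated on the translate by
   s_i of this Bohr set. The polynomial

     P(t) = average over the grid points x of a cube of side l of
            sum_i phi_i(t - x) G(x + s_i)

   approximates G: by Jensen's inequality |G(t) - P(t)|^p is bounded by the same
   average of sum_i phi_i(t - x) |G(t) - G(x + s_i)|^p, and after averaging in t
   only means of |G(x + v) - G(x + s_i)|^p over x occur, where v - s_i is an almost
   period unless phi_i(v) is negligible. *)

Require Import Defs.
From HB Require Import structures.
From mathcomp Require Import all_boot all_order all_algebra.
From mathcomp Require Import all_classical all_reals all_analysis.
From mathcomp Require Import measurable_realfun.
From mathcomp.real_closed Require Import complex.
From mathcomp Require Import zify ring lra.
Import Order.TTheory GRing.Theory Num.Theory.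
Import numFieldNormedType.Exports.
Set Implicit Arguments.
Unset Strict Implicit.
Unset Printing Implicit Defensive.
Local Open Scope classical_set_scope.
Local Open Scope ring_scope.

(** * Trigonometric polynomials and partitions of unity *)

(** A relatively dense set of almost periods need not be recognisable by finitely many characters,
    whereas the kernels used here can be concentrated only on a set defined by such characters.
    Combining four almost periods with signs repairs this: such combinations contain a Bohr set, and
    as their number is fixed, the tolerance grows only by a factor depending on [n] and [p]. The
    hypothesis gives, for each tolerance, a single scale [l], and no mean value over the whole space
    is available. Averages are therefore taken over one cube of side [l], in which [t - x] may miss
    the Bohr set altogether; this is why the kernel is split into pieces [phi i] attached to
    translates that cover the space. The bound on [G] depends on the tolerance, so the leakage of
    the weights outside their Bohr sets has to be chosen after [G]. *)

Section Nets.
Variable R : realType.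

(** Pigeonhole: the values are rounded to a grid of mesh [d], which leaves finitely many classes,
    and one point is kept from each class that occurs. Both vectors and integers will be used for
    [T]. *)
Lemma finite_net (T : Type) (I : finType) (g : I -> T -> R) (M d : R) :
  0 < d -> (forall i v, `|g i v| <= M) ->
  exists (K : nat) (s : 'I_K -> T), forall v, exists k, forall i, `|g i v - g i (s k)| < d.
Proof.
move=> d0 gM.
have [[t0 _]|nT] := pselect (exists t : T, True); last first.
  by exists 0%N, (fun k : 'I_0 => False_rect T (notF (ltn_ord k))) => v; case: nT; exists v.
set N := Num.truncn ((M + M) / d).
pose cell (v : T) : {ffun I -> 'I_N.+1} := [ffun i => inord (Num.truncn ((g i v + M) / d))].
have pos i v : 0 <= (g i v + M) / d.
  rewrite divr_ge0 ?(ltW d0)// -lerBlDr sub0r.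
  by have := gM i v; rewrite ler_norml => /andP[].
have cellE i v : (cell v i : nat) = Num.truncn ((g i v + M) / d).
  rewrite ffunE inordK// ltnS /N.
  rewrite truncn_ge_nat; last first.
    apply: le_trans (pos i v) _; rewrite ler_pM2r ?invr_gt0// lerD2r.
    by have := gM i v; rewrite ler_norml => /andP[].
  apply: le_trans (_ : (g i v + M) / d <= _).
    by rewrite truncn_le.
  rewrite ler_pM2r ?invr_gt0// lerD2r.
  by have := gM i v; rewrite ler_norml => /andP[].
(* Classes that do not occur receive the default point [t0]. *)
have rep (c : {ffun I -> 'I_N.+1}) : exists t : T, (exists v, cell v = c) -> cell t = c.
  have [[v vc]|n] := pselect (exists v, cell v = c); first by exists v.
  by exists t0 => /n.
have [r rP] := choice rep.
exists #|{ffun I -> 'I_N.+1}|, (fun k => r (enum_val k)) => v.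
exists (enum_rank (cell v)) => i; rewrite enum_rankK.
have /rP rv : exists w, cell w = cell v by exists v.
have e : Num.truncn ((g i (r (cell v)) + M) / d) = Num.truncn ((g i v + M) / d).
  by rewrite -!cellE rv.
have /andP[h1 h2] := truncn_itv (pos i v).
have /andP[h3 h4] := truncn_itv (pos i (r (cell v))).
rewrite e in h3 h4.
set a := g i v; set b := g i (r _).
have H : `|(a + M) / d - (b + M) / d| < 1.
  move: h1 h2 h3 h4; rewrite -/a -/b -natr1 ltr_norml => *.
  by apply/andP; split; lra.
have -> : a - b = ((a + M) / d - (b + M) / d) * d by field; rewrite gt_eqF.
by rewrite normrM (gtr0_norm d0) -ltr_pdivlMr// divff ?gt_eqF.
Qed.

Lemma cos_lip (a b : R) : `|cos a - cos b| <= `|a - b|.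
Proof.
wlog ab : a b / b <= a.
  move=> H; have [/H//|/ltW/H] := leP b a.
  by rewrite distrC [leRHS]distrC.
have [c _ ->] := @MVT_segment R cos (-%R \o sin) b a ab
  (fun x _ => is_derive_cos x) (continuous_subspaceT (@continuous_cos R)).
by rewrite normrM /= normrN ler_piMl// sin_max.
Qed.

Lemma sin_lip (a b : R) : `|sin a - sin b| <= `|a - b|.
Proof. by rewrite -!cosBpihalf (le_trans (cos_lip _ _))// opprB addrA subrK. Qed.

(** The cosine of a phase difference is 1 minus half the sum of the squared differences of cosines
    and of sines, so a net for cosines and sines is a net for phases. For linear phases this says
    that finitely many translates of a Bohr set cover the space. *)
Lemma phase_net (T : Type) (I : finType) (th : I -> T -> R) (k : R) : 0 < k ->
  exists (K : nat) (s : 'I_K -> T), forall v, exists j, forall i,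
    1 - k < cos (th i v - th i (s j)).
Proof.
move=> k0; pose d := Num.min 1 k.
have d0 : 0 < d by rewrite lt_min ltr01.
pose g (i : I * bool) v := if i.2 then cos (th i.1 v) else sin (th i.1 v).
have [|K [s sP]] := @finite_net T _ g 1 d d0.
  by move=> i v; rewrite /g; case: ifP => _; [exact: cos_max|exact: sin_max].
exists K, s => v; have [j jP] := sP v; exists j => i.
have := jP (i, true); have := jP (i, false); rewrite /g/= cosB.
set a := cos _; set b := cos _; set c := sin _; set e := sin _ => h1 h2.
have h3 : (a - b) ^+ 2 < k.
  rewrite -real_normK ?num_real//; apply: (@lt_le_trans _ _ (d * 1)).
    by rewrite expr2 ltr_pM// (lt_le_trans h2)// ge_min lexx.
  by rewrite mulr1 ge_min lexx orbT.
have h4 : (c - e) ^+ 2 < k.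
  rewrite -real_normK ?num_real//; apply: (@lt_le_trans _ _ (d * 1)).
    by rewrite expr2 ltr_pM// (lt_le_trans h1)// ge_min lexx.
  by rewrite mulr1 ge_min lexx orbT.
have e1 : a ^+ 2 + c ^+ 2 = 1 by exact: cos2Dsin2.
have e2 : b ^+ 2 + e ^+ 2 = 1 by exact: cos2Dsin2.
nra.
Qed.

End Nets.

Section Tpoly.
Variables (R : realType) (n : nat).
Implicit Types v w : 'rV[R]_n.

Definition dotp v w := \sum_i v 0 i * w 0 i.

Lemma dotpDl v1 v2 w : dotp (v1 + v2) w = dotp v1 w + dotp v2 w.
Proof. by rewrite -big_split; apply: eq_bigr => i _; rewrite mxE mulrDl. Qed.

Lemma dotpBr v w1 w2 : dotp v (w1 - w2) = dotp v w1 - dotp v w2.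
Proof. by rewrite -sumrB; apply: eq_bigr => i _; rewrite !mxE mulrBr. Qed.

Lemma dotp0l v : dotp 0 v = 0.
Proof. by rewrite /dotp big1// => i _; rewrite mxE mul0r. Qed.

Lemma dotpNl v w : dotp (- v) w = - dotp v w.
Proof. by rewrite -sumrN; apply: eq_bigr => i _; rewrite mxE mulNr. Qed.

Lemma expiD (a b : R) : expi (a + b) = expi a * expi b.
Proof. by rewrite /expi cosD sinD; apply/eqP; rewrite eq_complex/= !eqxx/= addrC. Qed.

Lemma expi0 : expi (0 : R) = 1.
Proof. by rewrite /expi cos0 sin0; apply/eqP; rewrite eq_complex/= !eqxx. Qed.

(** With a list of terms, sums become concatenations and products become [allpairs]. The values lie
    in any module, so scalar weights and [Y]-valued polynomials share one theory. *)
Definition tpoly (V : lmodType R[i]) (f : 'rV[R]_n -> V) :=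
  exists s : seq ('rV[R]_n * V), forall v, f v = \sum_(x <- s) expi (dotp x.1 v) *: x.2.

Section Vector_valued.
Variable V : lmodType R[i].
Implicit Types f g : 'rV[R]_n -> V.

Lemma tpoly_ext f g : f =1 g -> tpoly f -> tpoly g.
Proof. by move=> fg [s sP]; exists s => v; rewrite -fg. Qed.

Lemma tpoly_cst (c : V) : tpoly (fun=> c).
Proof. by exists [:: (0, c)] => v; rewrite big_seq1/= dotp0l expi0 scale1r. Qed.

Lemma tpolyD f g : tpoly f -> tpoly g -> tpoly (fun v => f v + g v).
Proof. by move=> [s sP] [t tP]; exists (s ++ t) => v; rewrite big_cat sP tP. Qed.

Lemma tpoly_sum (I : Type) (r : seq I) (F : I -> 'rV[R]_n -> V) :
  (forall i, tpoly (F i)) -> tpoly (fun v => \sum_(i <- r) F i v).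
Proof.
move=> FP; elim: r => [|i r IH].
  by apply: tpoly_ext (tpoly_cst 0) => v; rewrite big_nil.
by apply: tpoly_ext (tpolyD (FP i) IH) => v; rewrite big_cons.
Qed.

Lemma tpolyZ (a : 'rV[R]_n -> (R[i])^o) f : tpoly a -> tpoly f -> tpoly (fun v => a v *: f v).
Proof.
move=> [s sP] [t tP].
exists (allpairs (fun x y => (x.1 + y.1, (x.2 : R[i]) *: y.2)) s t) => v.
rewrite big_allpairs_dep sP tP scaler_suml; apply: eq_bigr => x _.
rewrite scaler_sumr; apply: eq_bigr => y _ /=.
by rewrite dotpDl expiD !scalerA mulrAC.
Qed.

Lemma tpoly_shift f w : tpoly f -> tpoly (fun v => f (v - w)).
Proof.
move=> [s sP]; exists [seq (x.1, expi (- dotp x.1 w) *: x.2) | x <- s] => v.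
rewrite sP big_map; apply: eq_bigr => x _ /=.
by rewrite dotpBr expiD scalerA.
Qed.

End Vector_valued.

Lemma tpoly_is_trigpol (Y : completeNormedModType R[i]) (P : 'rV[R]_n -> Y) :
  tpoly P -> is_trigpol P.
Proof.
move=> [s sP]; exists (size s), (fun j => (nth (0, 0) s j).1), (fun j => (nth (0, 0) s j).2).
apply/funext => v; rewrite sP /trigpol (big_nth (0, 0)) big_mkord.
by apply: eq_bigr.
Qed.

(** The coefficients stay complex; being real is a property of the values. [(R[i])^o] is the field
    seen as a module over itself. *)
Definition rtpoly (f : 'rV[R]_n -> R) := @tpoly (R[i])^o (fun v => (f v)%:C%C).

Lemma rtpoly_ext f g : f =1 g -> rtpoly f -> rtpoly g.
Proof. by move=> fg; apply: tpoly_ext => v; rewrite fg. Qed.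

Lemma rtpoly_cst c : rtpoly (fun=> c). Proof. exact: tpoly_cst. Qed.

Lemma rtpolyD f g : rtpoly f -> rtpoly g -> rtpoly (fun v => f v + g v).
Proof. by move=> h k; apply: tpoly_ext (tpolyD h k) => v; rewrite rmorphD. Qed.

Lemma rtpolyM f g : rtpoly f -> rtpoly g -> rtpoly (fun v => f v * g v).
Proof. by move=> h k; apply: tpoly_ext (tpolyZ h k) => v; rewrite rmorphM. Qed.

Lemma rtpoly_sum (I : Type) (r : seq I) (F : I -> 'rV[R]_n -> R) :
  (forall i, rtpoly (F i)) -> rtpoly (fun v => \sum_(i <- r) F i v).
Proof. by move=> h; apply: tpoly_ext (tpoly_sum r h) => v; rewrite rmorph_sum. Qed.

Lemma rtpoly_prod (I : Type) (r : seq I) (F : I -> 'rV[R]_n -> R) :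
  (forall i, rtpoly (F i)) -> rtpoly (fun v => \prod_(i <- r) F i v).
Proof.
move=> FP; elim: r => [|i r IH].
  by apply: rtpoly_ext (rtpoly_cst 1) => v; rewrite big_nil.
by apply: rtpoly_ext (rtpolyM (FP i) IH) => v; rewrite big_cons.
Qed.

Lemma rtpolyX f k : rtpoly f -> rtpoly (fun v => f v ^+ k).
Proof.
move=> fP; elim: k => [|k IH]; first exact: rtpoly_cst.
by apply: rtpoly_ext (rtpolyM fP IH) => v; rewrite exprS.
Qed.

Lemma rtpoly_shift f w : rtpoly f -> rtpoly (fun v => f (v - w)).
Proof. exact: (@tpoly_shift _ (fun v => (f v)%:C%C)). Qed.

Lemma rtpoly_cos lam : rtpoly (fun v => cos (dotp lam v)).
Proof.
exists [:: (lam, (2^-1)%:C%C); (- lam, (2^-1)%:C%C)] => v.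
rewrite big_cons big_seq1/= dotpNl /expi cosN sinN.
apply/eqP; rewrite eq_complex/=; apply/andP; split; apply/eqP; lra.
Qed.

Lemma small_expr (x e : R) : 0 <= x < 1 -> 0 < e -> exists N : nat, x ^+ N <= e.
Proof.
move=> /andP[x0 x1] e0.
have xn : `|x| < 1 by rewrite ger0_norm.
have /cvgr0Pnorm_le/(_ e e0)[N _ NP] := cvg_expr xn.
exists N; have := NP N (leqnn N) => /=; by rewrite ger0_norm ?exprn_ge0.
Qed.

Lemma bernoulli_expr (x : R) m : 0 <= x <= 1 -> 1 - x *+ m <= (1 - x) ^+ m.
Proof.
move=> /andP[x0 x1]; elim: m => [|m IH]; first by rewrite mulr0n subr0.
rewrite exprS (le_trans _ (ler_wpM2l _ IH)) ?subr_ge0// mulrSr.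
have : 0 <= x *+ m by rewrite mulrn_wge0.
set y := x *+ m; nra.
Qed.

(* [f v := prod_j (1 + cos <lam j, v>)/2] is at least [b] on a small Bohr set,
   whose translates by the [s k] cover the space, and at most [a < b] off the
   given one; [phi k := f(. - s k)^N q], with [q] a truncated Neumann series
   for the inverse of [S := sum_k f(. - s k)^N]. *)
Lemma trig_partition m (lam : 'I_m -> 'rV[R]_n) (k e : R) : 0 < k -> 0 < e ->
  exists (K : nat) (s : 'I_K -> 'rV[R]_n) (phi : 'I_K -> 'rV[R]_n -> R),
  [/\ (forall i, rtpoly (phi i)), (forall i v, 0 <= phi i v) &
   forall v, [/\ 1 - e <= \sum_i phi i v, \sum_i phi i v <= 1 &
    \sum_(i | ~~ [forall j, 1 - k < cos (dotp (lam j) (v - s i))]) phi i v <= e]].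
Proof.
move=> k0 e0.
(* [f] is at least [b] where all cosines exceed [1 - k2], and at most [a] where one of them is at
   most [1 - k]. Dividing by [m + 1] makes Bernoulli's lower bound [1 - m * k2 / 2] for [b] larger
   than [a]; the minimum with 1 keeps [a] nonnegative. *)
pose k1 := Num.min k 1; pose a := 1 - k1 / 2.
have k10 : 0 < k1 by rewrite lt_min k0 ltr01.
have k1k : k1 <= k by rewrite ge_min lexx.
have k11 : k1 <= 1 by rewrite ge_min lexx orbT.
pose k2 := k1 / m.+1%:R; pose b := (1 - k2 / 2) ^+ m.
have k20 : 0 < k2 by rewrite divr_gt0.
have k2k : k2 <= k1 by rewrite ler_pdivrMr// ler_peMr ?(ltW k10)// ler1n.
have ab : a < b.
  apply: lt_le_trans (bernoulli_expr _ _); last by apply/andP; split; lra.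
  rewrite /a ltrD2l ltrN2 -mulrnAl ltr_pM2r// /k2 -mulr_natr mulrAC.
  by rewrite ltr_pdivrMr// ltr_pM2l// ltr_nat.
have a0 : 0 <= a by rewrite /a; lra.
have b0 : 0 < b by apply: le_lt_trans ab.
pose f v := \prod_(j < m) ((1 + cos (dotp (lam j) v)) / 2).
have t01 (x : R) : 0 <= (1 + cos x) / 2 <= 1.
  by have := cos_le1 x; have := cos_geN1 x; move=> *; apply/andP; split; lra.
have f0 v : 0 <= f v by apply: prodr_ge0 => j _; case/andP: (t01 (dotp (lam j) v)).
have f1 v : f v <= 1 by apply: prodr_ile1 => j _.
have fbad v : ~~ [forall j, 1 - k < cos (dotp (lam j) v)] -> f v <= a.
  rewrite negb_forall => /existsP[j]; rewrite -leNgt => cj.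
  rewrite /f (bigD1 j)//= -[leRHS]mulr1; apply: ler_pM.
  - by case/andP: (t01 (dotp (lam j) v)).
  - by apply: prodr_ge0 => i _; case/andP: (t01 (dotp (lam i) v)).
  - by rewrite /a; lra.
  - by apply: prodr_ile1 => i _.
have [K [s sP]] := @phase_net R 'rV[R]_n 'I_m (fun j v => dotp (lam j) v) k2 k20.
have fgood v : exists i, b <= f (v - s i).
  have [i iP] := sP v; exists i; rewrite /b /f -[X in _ ^+ X]card_ord -prodr_const.
  apply: ler_prod => j _; have := iP j; rewrite dotpBr => h.
  by apply/andP; split; lra.
have K0 : (0 < K)%N by case: (fgood 0) => -[i +] _; case: (K).
have KR0 : 0 < K%:R :> R by rewrite ltr0n.
(* The at most [K] bad indices contribute at most [K * a ^ N * q v] at [v], and [q v] will be at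
   most the inverse of [b ^ N]. *)
have [N NP] : exists N : nat, (a / b) ^+ N <= e / K%:R.
  apply: small_expr; last by rewrite divr_gt0.
  by rewrite divr_ge0 ?(ltW b0)//= ltr_pdivrMr// mul1r.
pose S v := \sum_i f (v - s i) ^+ N.
have bN0 : 0 < b ^+ N by exact: exprn_gt0.
have Sb v : b ^+ N <= S v.
  have [i iP] := fgood v; rewrite /S (bigD1 i)//= (le_trans (lerXn2r N _ _ iP)) ?nnegrE ?(ltW b0)//.
  by rewrite lerDl sumr_ge0// => j _; rewrite exprn_ge0.
have SK v : S v <= K%:R.
  rewrite /S (@le_trans _ _ (\sum_(i < K) 1))//; last by rewrite sumr_const card_ord.
  by apply: ler_sum => i _; rewrite exprn_ile1.
have S0 v : 0 < S v by apply: lt_le_trans (Sb v).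
pose y v := 1 - S v / K%:R.
have y0 v : 0 <= y v by rewrite subr_ge0 ler_pdivrMr// mul1r.
have yb v : y v <= 1 - b ^+ N / K%:R.
  by rewrite lerD2l lerN2 ler_pM2r ?invr_gt0.
have [J JP] : exists J : nat, (1 - b ^+ N / K%:R) ^+ J <= e.
  apply: small_expr => //; rewrite (le_trans (y0 0) (yb 0))/= ltrBlDr ltrDl.
  by rewrite divr_gt0// exprn_gt0.
(* [S] lies between [b ^ N] and [K], so [y] stays away from 1 and the Neumann series of [1 / S]
   converges uniformly; its partial sums are trigonometric polynomials. *)
pose q v := K%:R^-1 * \sum_(j < J) y v ^+ j.
have Sq v : S v * q v = 1 - y v ^+ J.
  have := subrX1 (y v) J; rewrite /q => h.
  have -> : 1 - y v ^+ J = - (y v ^+ J - 1) by rewrite opprB.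
  rewrite h -mulNr opprB mulrA; congr (_ * _); rewrite /y; lra.
have q0 v : 0 <= q v by rewrite mulr_ge0 ?invr_ge0 ?(ltW KR0)// sumr_ge0// => j _; rewrite exprn_ge0.
have Sq1 v : S v * q v <= 1 by rewrite Sq lerBlDr lerDl exprn_ge0.
have rf i : rtpoly (fun v => f (v - s i) ^+ N).
  apply: rtpolyX; apply: (@rtpoly_shift f); apply: rtpoly_prod => j.
  by apply: rtpolyM; [apply: rtpolyD; [exact: rtpoly_cst|exact: rtpoly_cos]|exact: rtpoly_cst].
have rS : rtpoly S by apply: rtpoly_sum.
have rq : rtpoly q.
  apply: rtpolyM; first exact: rtpoly_cst.
  apply: rtpoly_sum => j; apply: rtpolyX.
  apply: rtpoly_ext (rtpolyD (rtpoly_cst 1) (rtpolyM (rtpoly_cst (- K%:R^-1)) rS)) => v.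
  by rewrite /y mulNr [_ * S v]mulrC.
exists K, s, (fun i v => f (v - s i) ^+ N * q v); split=> [i|i v|v].
- exact: rtpolyM.
- by rewrite mulr_ge0// exprn_ge0.
- rewrite -mulr_suml -/(S v); split=> //.
    rewrite Sq lerD2l lerN2 (le_trans _ JP)// lerXn2r ?nnegrE//.
    exact: le_trans (yb v).
  have qb : q v <= (b ^+ N)^-1.
    rewrite -[leRHS]mul1r ler_pdivlMr//.
    by apply: le_trans (Sq1 v); rewrite mulrC ler_wpM2r.
  rewrite -mulr_suml (le_trans (ler_wpM2l _ qb))//.
    by rewrite sumr_ge0// => i _; rewrite exprn_ge0.
  rewrite (le_trans (ler_wpM2r _ (_ : _ <= \sum_(i < K) a ^+ N)))//.
  + by rewrite invr_ge0 exprn_ge0 ?(ltW b0).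
  + rewrite big_mkcond/=; apply: ler_sum => i _; case: ifPn => h.
      by rewrite lerXn2r ?nnegrE// fbad.
    by rewrite exprn_ge0.
  rewrite sumr_const card_ord -mulr_natr mulrAC -expr_div_n.
  by rewrite -ler_pdivlMr.
Qed.

End Tpoly.

(** * Bogolyubov's lemma *)

Section Bogolyubov_finite.
Variable R : realType.

Lemma cosD2piz (x : R) (k : int) : cos (x + pi *+ 2 * k%:~R) = cos x.
Proof.
have H (m : nat) y : cos (y + pi *+ 2 * m%:R) = cos y :> R.
  elim: m => [|m IH]; first by rewrite mulr0 addr0.
  by rewrite -natr1 mulrDr mulr1 addrA cosD2pi IH.
case: k => m; first exact: H.
rewrite NegzE mulrNz -[in RHS](subrK (pi *+ 2 * m.+1%:R) x) H; congr cos.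
by rewrite mulrN.
Qed.

Variable M : nat.
Hypothesis M0 : (0 < M)%N.

(** Real part of the character of frequency [xi] on the integers modulo [M]. The sums below run over
    differences of pairs, a symmetric family, so imaginary parts would cancel. *)
Definition chr (xi : 'I_M) (k : int) : R := cos (pi *+ 2 * xi%:R * k%:~R / M%:R).

Lemma chr0 xi : chr xi 0 = 1.
Proof. by rewrite /chr mulr0 mul0r cos0. Qed.

Lemma chr_mod xi (k : int) : chr xi (k %% M)%Z = chr xi k.
Proof.
rewrite [in RHS](divz_eq k M) /chr.
rewrite -(@cosD2piz _ ((xi : nat)%:Z * (k %/ M)%Z)); congr cos.
rewrite !rmorphD !rmorphM/=; field; by rewrite pnatr_eq0 -lt0n.
Qed.

Lemma chr_le1 xi k : `|chr xi k| <= 1. Proof. exact: cos_max. Qed.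

(** Replaces multiplicativity, which real parts do not have. If [a] and [b] are differences of pairs
    from a set A and [c] is [x], changing signs only exchanges the members of a pair, so each
    argument is, up to sign, [x] minus an element of A + A - A - A. *)
Lemma chr_prod xi (a b c : int) : chr xi a * chr xi b * chr xi c =
  (chr xi (a + b + c) + chr xi (a + b - c) + chr xi (a - b + c) + chr xi (a - b - c)) / 4.
Proof.
have P u v : chr xi (u + v) + chr xi (u - v) = 2 * chr xi u * chr xi v.
  rewrite /chr; set w := pi *+ 2 * xi%:R.
  have -> : w * (u + v)%:~R / M%:R = w * u%:~R / M%:R + w * v%:~R / M%:R.
    by rewrite rmorphD/= mulrDr mulrDl.
  have -> : w * (u - v)%:~R / M%:R = w * u%:~R / M%:R - w * v%:~R / M%:R.
    by rewrite rmorphB/= mulrBr mulrBl.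
  by rewrite cosB cosD; ring.
have := P (a + b) c; have := P (a - b) c; have := P a b.
move=> h1 h2 h3; rewrite h3 -addrA h2.
rewrite -[_ * chr xi b]/((chr xi a * chr xi b)).
have -> : chr xi a * chr xi b = (chr xi (a + b) + chr xi (a - b)) / 2 by rewrite h1; field.
by field.
Qed.

(** Orthogonality of characters: once [k] is reduced to [0 < r < M], the sum telescopes when
    multiplied by [2 sin t] with [t = pi r / M], and [sin t] is positive. *)
Lemma sum_chr (k : int) : ~~ (M %| k)%Z -> \sum_(xi < M) chr xi k = 0.
Proof.
move=> Mk; under eq_bigr do rewrite -chr_mod.
set r := (k %% M)%Z.
have r0 : 0 < r by rewrite lt0r modz_ge0 ?andbT -?lt0n//; apply: contra Mk => /eqP/dvdz_mod0P.
have rM : r < M by rewrite ltz_pmod// ltz_nat.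
have MR : 0 < M%:R :> R by rewrite ltr0n.
pose t : R := pi * r%:~R / M%:R.
have st : 0 < sin t.
  apply: sin_gt0_pi; rewrite /t divr_gt0 ?mulr_gt0 ?pi_gt0 ?ltr0z//=.
  by rewrite ltr_pdivrMr// ltr_pM2l ?pi_gt0// -[M%:R]/((Posz M)%:~R) ltr_int.
have tele m : 2 * sin t * (\sum_(xi < m) cos (t *+ 2 * xi%:R)) =
    sin (t *+ 2 * m%:R - t) + sin t.
  elim: m => [|m IH]; first by rewrite big_ord0 !mulr0 sub0r sinN addNr.
  rewrite big_ord_recr/= mulrDr IH.
  have -> : t *+ 2 * m.+1%:R - t = t *+ 2 * m%:R + t by rewrite -natr1; ring.
  by rewrite sinB sinD; ring.
have := tele M.
have -> : t *+ 2 * M%:R - t = - (t + pi *+ 2 * (- r)%:~R).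
  by rewrite /t rmorphN/=; field; rewrite gt_eqF.
rewrite sinN -[sin (_ + _ * _)]opprK -cosDpihalf addrAC cosD2piz cosDpihalf !opprK.
rewrite addNr => /eqP; rewrite !mulf_eq0 pnatr_eq0/= gt_eqF//= => /eqP h.
rewrite -[RHS]h; apply: eq_bigr => xi _; congr cos.
by rewrite /t; field; rewrite gt_eqF.
Qed.

(* [L] is the set of large Fourier coefficients of the indicator of [A]. If [x]
   were not in [A + A - A - A], then [\sum_xi E xi ^+ 2 * chr xi x] would vanish,
   but the trivial character contributes [#|A| ^ 4] to it, more than what
   the characters outside [L] can take away. *)
Lemma bogolyubov_fin (A : {set 'I_M}) (K : nat) : (M <= K * #|A|)%N ->
  exists L : {set 'I_M}, (#|L| <= 2 * K ^ 2)%N /\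
  forall x : int, (forall xi, xi \in L -> 0 <= chr xi x) ->
  exists a b c d : 'I_M, [/\ a \in A, b \in A, c \in A, d \in A &
    (M %| x - ((a : nat)%:Z + (b : nat)%:Z - (c : nat)%:Z - (d : nat)%:Z))%Z].
Proof.
move=> MK.
have K0 : (0 < K)%N by move: MK M0; case: (K) => //; rewrite mul0n leqn0 => /eqP ->.
have A0 : (0 < #|A|)%N by rewrite lt0n; apply/eqP => h; move: MK M0; rewrite h muln0 leqn0 => /eqP ->.
set N := #|A| in MK A0.
pose AA := finset.setX A A.
pose df (p : 'I_M * 'I_M) : int := (p.1 : nat)%:Z - (p.2 : nat)%:Z.
(* [E xi] is the squared modulus of the Fourier coefficient at [xi] of the indicator of [A]. *)
pose E xi := \sum_(p in AA) chr xi (df p).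
have E0 xi : 0 <= E xi.
  rewrite /E (_ : \sum_(p in AA) _ = (\sum_(a in A) cos (pi *+ 2 * xi%:R * a%:R / M%:R)) ^+ 2 +
     (\sum_(a in A) sin (pi *+ 2 * xi%:R * a%:R / M%:R)) ^+ 2).
    by rewrite addr_ge0 ?sqr_ge0.
  rewrite (eq_bigl (fun p => (p.1 \in A) && (p.2 \in A))); last by case=> a b; rewrite inE.
  rewrite -(pair_big (mem A) (mem A) (fun a b => chr xi (df (a, b))))/=.
  rewrite !expr2 !mulr_suml -big_split; apply: eq_bigr => a _ /=.
  rewrite !mulr_sumr -big_split; apply: eq_bigr => b _ /=.
  by rewrite /chr /df/= rmorphB/= mulrBr mulrBl cosB.
have EN : E (Ordinal M0) = N%:R ^+ 2.
  rewrite /E (eq_bigr (fun=> 1)); last by move=> p _; rewrite /chr/= mulr0 !mul0r cos0.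
  by rewrite sumr_const cardsX natrM expr2.
(* Parseval's identity. *)
have SE : \sum_xi E xi = M%:R * N%:R.
  rewrite /E exchange_big/= (eq_bigr (fun p => if p.1 == p.2 then M%:R else 0)); last first.
    move=> [a b] _ /=; case: eqP => [->|/eqP ab].
      by rewrite /df/= subrr (eq_bigr (fun=> 1)) ?sumr_const ?card_ord// => xi _; exact: chr0.
    apply: sum_chr; apply: contra ab; rewrite /df/= -eqz_mod_dvd.
    by rewrite !modz_nat eqz_nat !modn_small// => /eqP h; apply/eqP/val_inj.
  rewrite (eq_bigl (fun p => (p.1 \in A) && (p.2 \in A))); last by case=> a b; rewrite inE.
  rewrite -(pair_big (mem A) (mem A) (fun a b => if a == b then M%:R else 0))/=.
  rewrite (eq_bigr (fun=> M%:R)) ?sumr_const ?mulr_natr// => a aA.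
  rewrite (bigD1 a)//= eqxx big1 ?addr0// => b /andP[_ ba].
  by rewrite eq_sym (negbTE ba).
have KR : 0 < K%:R :> R by rewrite ltr0n.
have NR : 0 < N%:R :> R by rewrite ltr0n.
have MKR : M%:R <= K%:R * N%:R :> R by rewrite -natrM ler_nat.
(* The threshold is [N^2 / (2 K)]; by Parseval at most [2 K M / N <= 2 K^2] frequencies reach it. *)
exists (finset (fun xi : 'I_M => N%:R ^+ 2 <= 2 * K%:R * E xi)); split.
  rewrite -(ler_nat R) -(ler_pM2r (exprn_gt0 2 NR)) mulr_natl -sumr_const.
  apply: (@le_trans _ _ (\sum_(xi : 'I_M) 2 * K%:R * E xi)).
    rewrite [leRHS](bigID (mem (finset (fun xi : 'I_M => N%:R ^+ 2 <= 2 * K%:R * E xi))))/=.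
    rewrite -[leLHS]addr0 lerD//.
      by apply: ler_sum => xi; rewrite inE.
    by apply: sumr_ge0 => xi _; rewrite !mulr_ge0.
  rewrite -mulr_sumr SE natrM natrX.
  have -> : 2%:R * K%:R ^+ 2 * N%:R ^+ 2 = 2 * K%:R * (K%:R * N%:R * N%:R) :> R by ring.
  by rewrite ler_pM2l ?mulr_gt0// ler_pM2r.
move=> x xL; apply: contrapT => nx.
have nd a b c d : a \in A -> b \in A -> c \in A -> d \in A ->
    ~~ (M %| x - ((a : nat)%:Z + (b : nat)%:Z - (c : nat)%:Z - (d : nat)%:Z))%Z.
  by move=> *; apply/negP => h; apply: nx; exists a, b, c, d.
have : \sum_xi E xi ^+ 2 * chr xi x = 0.
  have -> : \sum_xi E xi ^+ 2 * chr xi x =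
     \sum_(p in AA) \sum_(q in AA) \sum_xi chr xi (df p) * chr xi (df q) * chr xi x.
    under [RHS]eq_bigr do rewrite exchange_big/=.
    rewrite exchange_big/=; apply: eq_bigr => xi _.
    rewrite expr2 /E -mulrA mulr_suml; apply: eq_bigr => p _.
    by rewrite mulr_suml mulr_sumr; apply: eq_bigr => q _; ring.
  apply: big1 => -[a b]; rewrite inE/= => /andP[aA bA].
  apply: big1 => -[c d]; rewrite inE/= => /andP[cA dA].
  under eq_bigr do rewrite chr_prod.
  rewrite -mulr_suml !big_split/= !sum_chr ?addr0 ?mul0r// /df/=.
  - by rewrite -rpredN; have := nd _ _ _ _ aA dA bA cA; congr (~~ (_ %| _)%Z); ring.
  - by have := nd _ _ _ _ bA cA aA dA; congr (~~ (_ %| _)%Z); ring.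
  - by rewrite -rpredN; have := nd _ _ _ _ aA cA bA dA; congr (~~ (_ %| _)%Z); ring.
  - by have := nd _ _ _ _ bA dA aA cA; congr (~~ (_ %| _)%Z); ring.
apply/eqP; rewrite gt_eqF//.
(* Frequencies in the large set contribute nonnegatively; elsewhere a term is at least
   [- E xi * N^2 / (2 K)]. By Parseval these losses add up to at most half of [N^4]. *)
apply: (@lt_le_trans _ _ (\sum_xi ((xi == Ordinal M0)%:R * N%:R ^+ 4 - E xi * (N%:R ^+ 2 / (2 * K%:R))))).
  rewrite sumrB -!mulr_suml SE.
  have -> : \sum_(xi < M) (xi == Ordinal M0)%:R = 1 :> R.
    by rewrite (bigD1 (Ordinal M0))// eqxx big1 => [|i /negbTE ->//]; exact: addr0.
  rewrite mul1r subr_gt0 mulrA ltr_pdivrMr ?mulr_gt0//.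
  have : 0 < N%:R ^+ 3 :> R by rewrite exprn_gt0.
  have : 0 < N%:R ^+ 4 :> R by rewrite exprn_gt0.
  set n : R := N%:R in MKR NR *.
  nra.
apply: ler_sum => xi _.
have [->|xi0] := eqVneq xi (Ordinal M0).
  rewrite EN mul1r /chr/= mulr0 !mul0r cos0 mulr1 -exprM lerBlDr lerDl.
  by rewrite mulr_ge0 ?divr_ge0 ?sqr_ge0// mulr_ge0// ltW.
rewrite mul0r sub0r.
have [xiL|] := boolP (xi \in (finset (fun xi : 'I_M => N%:R ^+ 2 <= 2 * K%:R * E xi))).
  apply: (@le_trans _ _ 0); last by rewrite mulr_ge0 ?sqr_ge0 ?xL.
  by rewrite oppr_le0 !mulr_ge0 ?E0 ?sqr_ge0 ?invr_ge0// mulr_ge0// ltW.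
rewrite inE -ltNge => h.
have h1 : E xi <= N%:R ^+ 2 / (2 * K%:R).
  by rewrite ler_pdivlMr ?mulr_gt0// mulrC ltW.
have := chr_le1 xi x; rewrite ler_norml => /andP[h2 _].
have h3 := E0 xi.
have h4 : E xi ^+ 2 <= E xi * (N%:R ^+ 2 / (2 * K%:R)) by rewrite expr2 ler_wpM2l.
have : E xi ^+ 2 * -1 <= E xi ^+ 2 * chr xi x by rewrite ler_wpM2l ?sqr_ge0.
lra.
Qed.

End Bogolyubov_finite.

Section Bogolyubov.
Variable R : realType.

Lemma ultra_segment_limit (T : Type) (U : set_system T) (f : T -> R) :
  UltraFilter U -> (forall x, 0 <= f x <= 1) -> exists l : R, 0 <= l <= 1 /\ f @ U --> l.
Proof.
move=> UU f01; have PU : ProperFilter U by exact: ultra_proper.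
have [|l [l01 cl]] := @segment_compact R 0 1 (f @ U) (fmap_proper_filter f PU).
  by apply: (@filterE _ U _ (f @^-1` _)) => x; have : f x \in `[0, 1]%R by rewrite in_itv/=.
exists l; split; first by have : l \in `[0, 1]%R by []; rewrite in_itv.
move=> B Bl; have [//|nB] := in_ultra_setVsetC (f @^-1` B) UU.
by have [y [h1 h2]] := cl (~` B) B nB Bl.
Qed.

(** Every integer of [[0, N)] lies in some translate, so one of the [m] translates contains at least
    [N / m] of them. They are counted inside ['I_M] because the cyclic group has to be longer than
    the interval to avoid wrap-around. *)
Lemma dense_translate (A : int -> Prop) m (s : 'I_m -> int) (N M : nat) :
  (N <= M)%N -> (forall x, exists k, A (x - s k)) ->
  exists k, (N <= m * #|finset (fun a : 'I_M => ((a : nat) < N)%N && `[< A ((a : nat)%:Z - s k)%R >])|)%N.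
Proof.
move=> NM cov.
pose B k : {set 'I_M} := finset (fun a : 'I_M => ((a : nat) < N)%N && `[< A ((a : nat)%:Z - s k) >]).
change (exists k, (N <= m * #|B k|)%N).
have SB : (N <= \sum_k #|B k|)%N.
  rewrite -[leqLHS]card_ord -sum1_card.
  apply: (@leq_trans (\sum_(i < N) \sum_k (widen_ord NM i \in B k))%N).
    apply: leq_sum => i _; have [k kP] := cov (i : nat)%:Z.
    rewrite (bigD1 k)//= inE/= ltn_ord/=.
    by have -> : `[< A ((i : nat)%:Z - s k) >] by apply/asboolP.
  rewrite exchange_big/=; apply: leq_sum => k _.
  have -> : (\sum_(i < N) (widen_ord NM i \in B k) = #|finset (fun i => widen_ord NM i \in B k)|)%N.
    by rewrite -sum1dep_card [RHS]big_mkcond; apply: eq_bigr => i _; case: (_ \in _).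
  rewrite -(card_imset _ (_ : injective (widen_ord NM))); last by move=> x y /(congr1 val)/= /val_inj.
  by rewrite subset_leq_card//; apply/fintype.subsetP => _ /imsetP[i + ->]; rewrite inE.
apply: contrapT => /forallNP H.
have m0 : (0 < m)%N by have [k _] := cov 0; case: k; case: (m).
have : (\sum_k (m * #|B k|) <= \sum_(k < m) N.-1)%N.
  by apply: leq_sum => k _; have /negP := H k; rewrite -ltnNge => h; rewrite -ltnS (leq_trans h)// leqSpred.
have /negP := H (Ordinal m0); rewrite -ltnNge => N0.
rewrite -big_distrr/= sum_nat_const card_ord leq_pmul2l// => /(leq_trans SB).
by rewrite -ltnS prednK ?ltnn// (leq_ltn_trans _ N0).
Qed.

(* Bogolyubov's lemma on the integers, in the limit of the groups [Z/4N]: the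
   frequencies found there are at most [2 (4m)^2] points of [0, 1], so they
   converge along an ultrafilter. *)
Lemma bogolyubov (A : int -> Prop) m (s : 'I_m -> int) :
  (forall x, exists k, A (x - s k)) ->
  exists q (th : 'I_q -> R), (forall j, 0 <= th j <= 1) /\
  forall x : int, (forall j, 0 < cos (pi *+ 2 * th j * x%:~R)) ->
  exists a b c d : int, [/\ A a, A b, A c, A d & x = a + b - c - d].
Proof.
move=> cov; pose q := (2 * (4 * m) ^ 2)%N.
have fin (N : nat) : exists th : 'I_q -> R, (forall j, 0 <= th j <= 1) /\
  forall x : int, (`|x| <= N)%N -> (forall j, 0 < cos (pi *+ 2 * th j * x%:~R)) ->
  exists a b c d : int, [/\ A a, A b, A c, A d & x = a + b - c - d].
  (* For four elements of [[0, N]] and [|x| <= N], the number tested for divisibility is at most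
     [3 N] in absolute value, so a congruence modulo [4 (N + 1)] is an equality. *)
  pose M := (4 * N.+1)%N.
  have NM : (N.+1 <= M)%N by rewrite /M; lia.
  have [k kP] := dense_translate NM cov.
  set B := finset _ in kP.
  have M0 : (0 < M)%N by [].
  have MB : (M <= 4 * m * #|B|)%N by rewrite /M -mulnA leq_mul2l.
  have [L [Lq LP]] := bogolyubov_fin R M0 MB.
  pose sq := [seq (nat_of_ord xi)%:R / M%:R : R | xi <- enum L].
  (* Past the end of the list [nth] returns the frequency 0. This pads all lists to the same length
     [q], which makes limits in [N] meaningful. *)
  exists (fun j => nth 0 sq j); split.
    move=> j; have [js|js] := ltnP j (size sq); last by rewrite nth_default// lexx ler01.
    have /mapP[xi _ ->] := mem_nth 0 js.
    rewrite divr_ge0//= ler_pdivrMr ?ltr0n// mul1r ler_nat; exact: ltnW.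
  move=> x xN H.
  have [xi xiL|a [b [c [d [aB bB cB dB]]]]] := LP x.
    have js : (index xi (enum L) < q)%N.
      by apply: leq_trans Lq; rewrite cardE index_mem mem_enum.
    have := H (Ordinal js); rewrite /sq/= (nth_map xi) ?index_mem ?mem_enum//.
    rewrite nth_index ?mem_enum// => /ltW; rewrite /chr; congr (_ <= cos _); ring.
  move: aB bB cB dB; rewrite !inE => /andP[a1 /asboolP a2] /andP[b1 /asboolP b2] /andP[c1 /asboolP c2] /andP[d1 /asboolP d2].
  move=> /dvdzP[z zP].
  exists ((a : nat)%:Z - s k), ((b : nat)%:Z - s k), ((c : nat)%:Z - s k), ((d : nat)%:Z - s k); split=> //.
  have z0 : z = 0.
    have {}zP : x - ((a : nat)%:Z + (b : nat)%:Z - (c : nat)%:Z - (d : nat)%:Z) = z * (4 * N.+1%:Z).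
      by rewrite zP /M PoszM.
    have x1 : x <= N%:Z by lia.
    have x2 : - N%:Z <= x by lia.
    have [z1|z1|//] := ltgtP z 0.
      have : z * (4 * N.+1%:Z) <= -1 * (4 * N.+1%:Z) by rewrite ler_pM2r//; lia.
      lia.
    have : 1 * (4 * N.+1%:Z) <= z * (4 * N.+1%:Z) by rewrite ler_pM2r//; lia.
    lia.
  move: zP; rewrite z0 mul0r; lia.
have [th thP] := choice fin.
have [U [UU oU]] := ultraFilterLemma eventually_filter.
have lim j : exists l : R, 0 <= l <= 1 /\ (fun N => th N j) @ U --> l.
  by apply: ultra_segment_limit => N; case: (thP N).
have [t tP] := choice lim.
exists q, t; split; first by move=> j; case: (tP j).
move=> x xP.
(* The strict inequality [0 < cos] passes from the limit frequencies to those of [U]-almost all [N],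
   and one such [N >= |x|] gives the decomposition. *)
have H : \forall N \near U, (forall j, 0 < cos (pi *+ 2 * th N j * x%:~R)) /\ (`|x| <= N)%N.
  apply: filterI; last by apply: oU; exists `|x|%N.
  apply: filter_forall => j.
  have cv : (fun N => cos (pi *+ 2 * th N j * x%:~R)) @ U --> cos (pi *+ 2 * t j * x%:~R).
    apply: continuous_cvg; first exact: continuous_cos.
    by apply: cvgMl; apply: cvgMr; case: (tP j).
  exact: (cvgr_gt _ cv).
have [N [N1 N2]] := filter_ex H.
exact: (thP N).2.
Qed.

End Bogolyubov.

(** * Lebesgue measure and integrals *)

Section Lebesgue.
Variables (R : realType) (n : nat).
Local Notation E := (Rn R n).
Local Notation V := 'rV[R]_n.
Implicit Types (a b t : V) (A B : set E).

Definition upd a i (c : R) : V := \row_j if j == i then c else a 0 j.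

Lemma boxvol_hobox a b : (forall i, a 0 i <= b 0 i) ->
  (boxvol (hobox a b) <= (\prod_(i < n) (b 0 i - a 0 i))%:E)%E.
Proof.
move=> ab; rewrite /boxvol; case: pselect => ? /=.
  by rewrite lee_fin prodr_ge0// => i _; rewrite subr_ge0.
by apply: ereal_inf_lbound; exists (a, b).
Qed.

(** A coordinate hyperplane cuts a box into two boxes whose volumes add up. For a nonempty set that
    is not a box the right-hand side is the infimum of the empty set, hence infinite. *)
Lemma boxvol_split (A : set (RnAll R n)) i c :
  (boxvol (A `&` [set u : V | (u 0 i < c)%R]) + boxvol (A `&` ~` [set u : V | (u 0 i < c)%R])
   <= boxvol A)%E.
Proof.
have [->|A0] := eqVneq A set0; first by rewrite !set0I boxvol0 adde0.
rewrite [leRHS]/boxvol; case: pselect => ? /=; first by move: A0; rewrite (_ : A = set0) ?eqxx.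
apply: le_ereal_inf_tmp => y [[a b] /= [ab AE] <-{y}].
(* [c] is clamped to the side of the box, so that both pieces have ordered corners even if the
   hyperplane misses the box. *)
set b' := Num.max (a 0 i) (Num.min (b 0 i) c).
set a' := Num.min (b 0 i) (Num.max (a 0 i) c).
have E1 : A `&` [set u : V | u 0 i < c] = hobox a (upd b i b').
  rewrite AE; apply/seteqP; split => u.
    move=> [/= abu uc] j; have := abu j; rewrite mxE; case: eqP => [->|//] /andP[-> /= ub].
    by rewrite /b' lt_max lt_min ub uc orbT.
  move=> /= H; have uc : (a 0 i <= u 0 i) && (u 0 i < b') by have := H i; rewrite mxE eqxx.
  have uc' : u 0 i < b 0 i /\ u 0 i < c.
    move: uc; rewrite /b' lt_max lt_min => /andP[h /orP[|/andP[]//]].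
    by rewrite ltNge h.
  split=> [j|]; last by case: uc'.
  have := H j; rewrite mxE; case: eqP => [->|//] /andP[-> _]; by case: uc' => ->.
have E2 : A `&` ~` [set u : V | u 0 i < c] = hobox (upd a i a') b.
  rewrite AE; apply/seteqP; split => u.
    move=> [/= abu /negP]; rewrite -leNgt => uc j; have := abu j; rewrite mxE; case: eqP => [->|//] /andP[au ub].
    by rewrite ub andbT /a' ge_min ge_max au uc orbT.
  move=> /= H; have uc : (a' <= u 0 i) && (u 0 i < b 0 i) by have := H i; rewrite mxE eqxx.
  have uc' : a 0 i <= u 0 i /\ c <= u 0 i.
    move: uc; rewrite /a' ge_min ge_max => /andP[/orP[h1 h2|/andP[]//]].
    by move: h2; rewrite ltNge h1.
  split=> [j|]; last by apply/negP; rewrite -leNgt; case: uc'.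
  have := H j; rewrite mxE; case: eqP => [->|//] /andP[_ ->]; by case: uc' => ->.
rewrite E1 E2.
have H1 := @boxvol_hobox a (upd b i b').
have H2 := @boxvol_hobox (upd a i a') b.
apply: le_trans (leeD (H1 _) (H2 _)) _.
- by move=> j; rewrite mxE; case: eqP => [->|//]; rewrite /b' le_max lexx.
- by move=> j; rewrite mxE; case: eqP => [->|//]; rewrite /a' ge_min lexx.
rewrite -EFinD lee_fin.
rewrite (bigD1 i)//= [X in _ + X](bigD1 i)//= [leRHS](bigD1 i)//= !mxE eqxx.
rewrite (eq_bigr (fun j => b 0 j - a 0 j)); last by move=> j /negbTE ji; rewrite mxE ji.
rewrite [X in _ + _ * X](eq_bigr (fun j => b 0 j - a 0 j)); last by move=> j /negbTE ji; rewrite mxE ji.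
rewrite -mulrDl ler_wpM2r//.
  by apply: prodr_ge0 => j _; rewrite subr_ge0.
rewrite /a' /b'; have := ab i; set x := a 0 i; set y := b 0 i => xy.
have [h1|h1] := leP y c.
  rewrite (max_idPr xy); have [h2|h2] := leP x c; first by rewrite (min_idPl h1); lra.
  lra.
have [h2|h2] := leP x c.
  by rewrite (min_idPr (ltW h1)); lra.
by rewrite (min_idPr xy); lra.
Qed.

(** The Caratheodory condition is checked cover by cover, splitting every box of the cover.
    Measurability of coordinates, boxes and cubes is derived from this case. *)
Lemma measurable_halfspace i c : measurable ([set u : V | u 0 i < c] : set E).
Proof.
rewrite /measurable/=; apply: le_caratheodory_measurable => X /=.
rewrite [leRHS]/lebn_outer/mu_ext; apply: le_ereal_inf_tmp => y [B [mB XB] <-{y}].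
set H := [set u : V | u 0 i < c].
have h (K : set V) : (lebn_outer (X `&` K) <= \sum_(k <oo) boxvol ((B k : set V) `&` K))%E.
  apply: ereal_inf_lbound; exists (fun k => (B k : set V) `&` K) => //; split.
    by move=> k; exact: sub_sigma_algebra.
  by rewrite -setI_bigcupl; exact: setSI.
apply: le_trans (leeD (h H) (h (~` H))) _.
rewrite -nneseriesD; [|by move=> k _ _; exact: boxvol_ge0..].
apply: lee_nneseries => [k _ _|k _]; first by rewrite adde_ge0 ?boxvol_ge0.
exact: boxvol_split.
Qed.

Lemma measurable_coord i : measurable_fun [set: E] (fun u : E => toRV u 0 i).
Proof.
apply: (measurability _ (@measurable_realfun.RGenInftyO.measurableE R)) => // _ [_ [x ->] <-].
rewrite setTI (_ : _ @^-1` _ = [set u : V | u 0 i < x]); first exact: measurable_halfspace.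
by apply/seteqP; split=> u /=; rewrite in_itv.
Qed.

Lemma measurable_coords (J : 'I_n -> set R) : (forall i, measurable (J i)) ->
  measurable ([set u | forall i, J i (u 0 i)] : set E).
Proof.
move=> mJ; rewrite [X in measurable X](_ : _ = \bigcap_(i in [set: 'I_n]) ((fun u : E => toRV u 0 i) @^-1` J i)).
  apply: fin_bigcap_measurable; first exact: finite_finset.
  by move=> i _; rewrite -[X in measurable X]setTI; exact: measurable_coord.
by apply/seteqP; split=> [u H i _|u H i]; [exact: H|exact: (H i I)].
Qed.

Lemma measurable_hobox a b : measurable (hobox a b : set E).
Proof.
rewrite (_ : hobox a b = [set u | forall i, `[a 0 i, b 0 i[%classic (u 0 i)]).
  by apply: (@measurable_coords (fun i => `[a 0 i, b 0 i[%classic)) => i; exact: measurable_itv.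
by apply/seteqP; split=> u /= H i; have := H i; rewrite /= in_itv.
Qed.

Lemma measurable_tcube t l : measurable (tcube t l : set E).
Proof.
rewrite (_ : tcube t l = [set u | forall i, `[t 0 i, t 0 i + l]%classic (u 0 i)]).
  by apply: (@measurable_coords (fun i => `[t 0 i, t 0 i + l]%classic)) => i; exact: measurable_itv.
by apply/seteqP; split=> u /= H i; have := H i; rewrite /= in_itv.
Qed.

Lemma lebn_le_boxvol (B : set E) : (lebn B <= boxvol (B : set (RnAll R n)))%E.
Proof.
apply: ereal_inf_lbound; exists (fun k : nat => if k == 0%N then (B : set (RnAll R n)) else set0).
  split=> [k|u ?]; first exact: sub_sigma_algebra.
  by exists 0%N.
rewrite (nneseries_split 0 1); last by move=> k _ ; exact: boxvol_ge0.
rewrite big_mkord big_ord1 eseries0 ?adde0// => -[|k]// _ _; exact: boxvol0.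
Qed.

Lemma lebn_hobox_le a b : (forall i, a 0 i <= b 0 i) ->
  (lebn (hobox a b : set E) <= (\prod_(i < n) (b 0 i - a 0 i))%:E)%E.
Proof. by move=> ab; exact: le_trans (lebn_le_boxvol _) (boxvol_hobox ab). Qed.

(** The closed cube lies in half-open boxes of side [l + e], and [e] tends to 0 by continuity of the
    power. *)
Lemma lebn_tcube_le t l : 0 <= l -> (lebn (tcube t l : set E) <= (l ^+ n)%:E)%E.
Proof.
move=> l0.
have H e : 0 < e -> (lebn (tcube t l : set E) <= ((l + e) ^+ n)%:E)%E.
  move=> e0; pose b : V := \row_j (t 0 j + l + e).
  apply: (@le_trans _ _ (lebn (hobox t b : set E))).
    apply: le_measure; rewrite ?inE; [exact: measurable_tcube|exact: measurable_hobox|].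
    move=> u /= H i; rewrite mxE; have /andP[-> h] := H i.
    by rewrite (le_lt_trans h)// ltrDl.
  apply: le_trans (lebn_hobox_le _) _.
    by move=> i; rewrite mxE -addrA lerDl addr_ge0// ltW.
  rewrite lee_fin (eq_bigr (fun=> l + e)) ?prodr_const ?card_ord//.
  by move=> i _; rewrite mxE; lra.
have := H 1 ltr01; have : (0 <= lebn (tcube t l : set E))%E by exact: measure_ge0.
case: (lebn _) H => [r|//|//] H _ _; rewrite lee_fin leNgt; apply/negP => lr.
have : \forall y \near l, y ^+ n < r by exact: (@cvgr_lt R _ _ _ _ _ (@exprn_continuous R n l) _ lr).
move=> /nbhs_ballP[e /= e0 eP].
have := H (e / 2); rewrite divr_gt0// lee_fin => /(_ isT); rewrite leNgt => /negP; apply.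
apply: eP; rewrite /ball/= opprD addNKr normrN gtr0_norm ?divr_gt0//.
by rewrite ltr_pdivrMr// mulr2n; lra.
Qed.

Definition trans a (u : E) : E := a + toRV u.

Lemma boxvol_trans a (B : set V) : (boxvol (trans a @^-1` B : set (RnAll R n)) <= boxvol B)%E.
Proof.
have [->|B0] := eqVneq B set0; first by rewrite preimage_set0 boxvol0.
rewrite [leRHS]/boxvol; case: pselect => ? /=; first by move: B0; rewrite (_ : B = set0) ?eqxx.
apply: le_ereal_inf_tmp => y [[x z] /= [xz ->] <-{y}].
rewrite (_ : _ @^-1` _ = hobox (x - a) (z - a)); last first.
  apply/seteqP; split=> u /= H i; have := H i; rewrite /trans /toRV !mxE.
    by rewrite lerBlDl ltrBrDl.
  by rewrite lerBlDl ltrBrDl.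
apply: le_trans (boxvol_hobox _) _; first by move=> i; rewrite !mxE lerD2r.
by rewrite lee_fin ler_prod// => i _; rewrite !mxE opprB addrA subrK lexx subr_ge0 xz.
Qed.

Lemma lebn_trans_le a A : (lebn (trans a @^-1` A) <= lebn A)%E.
Proof.
rewrite [leRHS]/lebn/lebn_outer/mu_ext; apply: le_ereal_inf_tmp => y [B [mB AB] <-{y}].
apply: (@le_trans _ _ (\sum_(k <oo) boxvol (trans a @^-1` (B k) : set (RnAll R n)))%E).
  apply: ereal_inf_lbound; exists (fun k => trans a @^-1` (B k)) => //; split.
    by move=> k; exact: sub_sigma_algebra.
  by move=> u /AB[k _ Bk]; exists k.
apply: lee_nneseries => [k _ _|k _]; first exact: boxvol_ge0.
exact: boxvol_trans.
Qed.

Lemma transNK a : cancel (trans a) (trans (- a)).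
Proof. by move=> u; rewrite /trans /toRV addKr. Qed.

Lemma transK a : cancel (trans (- a)) (trans a).
Proof. by move=> u; rewrite /trans /toRV addrA subrr add0r. Qed.

Lemma lebn_trans a A : lebn (trans a @^-1` A) = lebn A.
Proof.
apply/eqP; rewrite eq_le lebn_trans_le/=.
rewrite [in leLHS](_ : A = trans (- a) @^-1` (trans a @^-1` A)) ?lebn_trans_le//.
by apply/seteqP; split=> u /=; rewrite transK.
Qed.

Lemma measurable_preimage_trans a A : measurable A -> measurable (trans a @^-1` A).
Proof.
move=> mA; apply: le_caratheodory_measurable => X /=.
have h (K : set E) : lebn_outer (X `&` trans a @^-1` K) = lebn_outer ((trans (- a) @^-1` X) `&` K).
  rewrite -[RHS](lebn_trans a); congr lebn_outer.
  by apply/seteqP; split=> u /=; rewrite transNK.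
rewrite preimage_setC !h -[leRHS](lebn_trans (- a)).
by rewrite [leRHS](mA (trans (- a) @^-1` X)).
Qed.

Lemma measurable_trans a : measurable_fun [set: E] (trans a).
Proof. by move=> _ B mB; rewrite setTI; exact: measurable_preimage_trans. Qed.

Lemma integral_trans a (D : set E) (f : E -> \bar R) : measurable D ->
  measurable_fun D f -> (forall u, D u -> (0 <= f u)%E) ->
  (\int[@lebn R n]_(u in D) f u = \int[@lebn R n]_(u in trans a @^-1` D) f (trans a u))%E.
Proof.
move=> mD mf f0.
rewrite -(ge0_integral_pushforward (measurable_trans a) _ mD mf); last first.
  by move=> u; rewrite inE; exact: f0.
apply: eq_measure_integral => [|m A mA _]; first exact: measurable_trans.
by symmetry; exact: (lebn_trans a A).
Qed.

End Lebesgue.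

Section Real_integrals.
Context d (T : measurableType d) (R : realType) (mu : {measure set T -> \bar R}).
Implicit Types (D : set T) (f g h : T -> R).
Local Notation I D f := (\int[mu]_(u in D) (f u)%:E)%E.

Lemma measurable_distr f g : measurable_fun [set: T] f -> measurable_fun [set: T] g ->
  measurable_fun [set: T] (fun u => `|f u - g u|).
Proof. by move=> mf mg; apply: measurableT_comp => //; exact: measurable_funB. Qed.

Lemma nnint_le D f g : measurable D -> measurable_fun [set: T] f -> measurable_fun [set: T] g ->
  (forall u, 0 <= f u) -> (forall u, D u -> f u <= g u) -> (I D f <= I D g)%E.
Proof.
move=> mD mf mg f0 fg; apply: ge0_le_integral => //.
- by move=> u _; rewrite lee_fin.
- exact/measurable_EFinP/measurable_funTS.
- exact/measurable_EFinP/measurable_funTS.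
Qed.

Lemma nnint_subset D D' f : measurable D -> measurable D' -> measurable_fun [set: T] f ->
  (forall u, 0 <= f u) -> D `<=` D' -> (I D f <= I D' f)%E.
Proof.
move=> mD mD' mf f0 DD; apply: ge0_subset_integral => //.
  exact/measurable_EFinP/measurable_funTS.
by move=> u _; rewrite lee_fin.
Qed.

Lemma nnint_sum (S : Type) (s : seq S) D (g : S -> T -> R) : measurable D ->
  (forall i, measurable_fun [set: T] (g i)) -> (forall i u, 0 <= g i u) ->
  (I D (fun u => (\sum_(i <- s) g i u)%R) = \sum_(i <- s) I D (g i))%E.
Proof.
move=> mD mg g0; rewrite -ge0_integral_sum//.
- by apply: eq_integral => u _; rewrite sumEFin.
- by move=> i; exact/measurable_EFinP/measurable_funTS.
- by move=> i u _; rewrite lee_fin.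
Qed.

Lemma nnint_scale D f c : measurable D -> measurable_fun [set: T] f ->
  (forall u, 0 <= f u) -> 0 <= c -> (I D (fun u => (c * f u)%R) = c%:E * I D f)%E.
Proof.
move=> mD mf f0 c0; under eq_integral do rewrite EFinM.
rewrite ge0_integralZl//.
- exact/measurable_EFinP/measurable_funTS.
- by move=> u _; rewrite lee_fin.
Qed.

Lemma nnintD D f g : measurable D -> measurable_fun [set: T] f -> measurable_fun [set: T] g ->
  (forall u, 0 <= f u) -> (forall u, 0 <= g u) ->
  (I D (fun u => (f u + g u)%R) = I D f + I D g)%E.
Proof.
move=> mD mf mg f0 g0; under eq_integral do rewrite EFinD.
rewrite ge0_integralD//.
- by move=> u _; rewrite lee_fin.
- exact/measurable_EFinP/measurable_funTS.
- by move=> u _; rewrite lee_fin.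
- exact/measurable_EFinP/measurable_funTS.
Qed.

Lemma nnint_le_cst D f c : measurable D -> measurable_fun [set: T] f ->
  (forall u, 0 <= f u) -> (forall u, D u -> f u <= c) -> (I D f <= c%:E * mu D)%E.
Proof.
move=> mD mf f0 fc; rewrite -integral_cst//; apply: ge0_le_integral => //.
- by move=> u _; rewrite lee_fin.
- exact/measurable_EFinP/measurable_funTS.
Qed.

Lemma nnint_le_comb D f g h c a b : measurable D -> measurable_fun [set: T] f ->
  measurable_fun [set: T] g -> measurable_fun [set: T] h -> (forall u, 0 <= f u) ->
  (forall u, 0 <= g u) -> (forall u, 0 <= h u) -> 0 <= c ->
  (forall u, D u -> f u <= c * (g u + h u)) ->
  (I D g <= a%:E -> I D h <= b%:E -> I D f <= (c * (a + b))%:E)%E.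
Proof.
move=> mD mf mg mh f0 g0 h0 c0 fgh ga hb.
have mgh : measurable_fun [set: T] (fun u => g u + h u) by exact: measurable_funD.
apply: (@le_trans _ _ (I D (fun u => (c * (g u + h u))%R))).
  apply: nnint_le => //; exact: measurable_funM.
rewrite nnint_scale//; last by move=> u; rewrite addr_ge0.
by rewrite nnintD// EFinM EFinD lee_wpmul2l// leeD.
Qed.

Lemma nnint_setU_le D D' f : measurable D -> measurable D' ->
  measurable_fun [set: T] f -> (forall u, 0 <= f u) ->
  (I (D `|` D') f <= I D f + I D' f)%E.
Proof.
move=> mD mD' mf f0.
have -> : D `|` D' = D `|` (D' `\` D) by rewrite setDE setUIr setUCr setIT.
rewrite ge0_integral_setU//; last 4 first.
- exact: measurableD.
- exact/measurable_EFinP/measurable_funTS.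
- by move=> u _; rewrite lee_fin.
- by rewrite disj_set2E; apply/eqP; rewrite setDE setICA setICr setI0.
apply: leeD => //; apply: nnint_subset => //; exact: measurableD.
Qed.

Lemma nnint_cover (S : Type) (s : seq S) (A : S -> set T) D f :
  (forall i, measurable (A i)) -> measurable D ->
  measurable_fun [set: T] f -> (forall u, 0 <= f u) ->
  (D `<=` \big[setU/set0]_(i <- s) A i) ->
  (I D f <= \sum_(i <- s) I (A i) f)%E.
Proof.
move=> mA mD mf f0 DA.
have mU r : measurable (\big[setU/set0]_(i <- r) A i) by apply: bigsetU_measurable.
apply: le_trans (nnint_subset mD (mU s) mf f0 DA) _.
elim: s {DA} => [|i s IH]; first by rewrite !big_nil integral_set0.
rewrite !big_cons; apply: le_trans (nnint_setU_le (mA i) (mU s) mf f0) _.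
exact: leeD.
Qed.

End Real_integrals.

Section Measure_approximation.
Context d (T : measurableType d) (R : realType) (mu : {measure set T -> \bar R}).
Implicit Types (D A B X : set T) (f g h : T -> R).
Local Notation I D f := (\int[mu]_(u in D) (f u)%:E)%E.

Lemma ecvg0_le (u : nat -> \bar R) (e : R) : u @ \oo --> 0%E -> 0 < e -> exists k, (u k <= e%:E)%E.
Proof.
move=> /fine_cvgP[h1 /cvgrPdist_lt h2] e0.
have [k [k1 k2]] := filter_ex (filterI h1 (h2 _ e0)).
exists k; rewrite -(fineK k1) lee_fin ltW//.
by move: k2; rewrite /= sub0r normrN => /(le_lt_trans (ler_norm _)).
Qed.

Lemma nnint_dct D (f_ : nat -> T -> R) g : measurable D ->
  (forall k, measurable_fun [set: T] (f_ k)) -> measurable_fun D g ->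
  (forall k u, 0 <= f_ k u) -> (forall k u, D u -> f_ k u <= g u) ->
  (I D g < +oo)%E -> {ae mu, forall u, D u -> (fun k => f_ k u) @ \oo --> (0 : R)} ->
  forall e : R, 0 < e -> exists k, (I D (f_ k) <= e%:E)%E.
Proof.
move=> mD mf mg f0 fg Ig cf e e0.
have [|||||_ _] := @dominated_convergence _ T R mu D mD (fun k u => (f_ k u)%:E) (cst 0%E) (fun u => (g u)%:E).
- by move=> k; exact/measurable_EFinP/measurable_funTS.
- exact: measurable_cst.
- by apply: filterS cf => u cu Du; apply/fine_cvgP; split; [exact: nearW|exact: cu].
- apply/integrableP; split; first exact/measurable_EFinP.
  rewrite (eq_integral (fun u => (g u)%:E))// => u; rewrite inE => Du.
  by rewrite gee0_abs// lee_fin (le_trans (f0 0%N u))// fg.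
- by apply: aeW => u k Du; rewrite gee0_abs lee_fin ?fg.
rewrite integral_cst// mul0e => /ecvg0_le; exact.
Qed.

(** The tail of the convergent series bounds what a finite part of the cover misses of [X], and
    near-optimality of the whole cover bounds the excess outside [X]. *)
Lemma cover_approx X (B : nat -> set T) (e : R) : 0 < e -> measurable X ->
  (forall k, measurable (B k)) -> X `<=` \bigcup_k B k -> (mu X < +oo)%E ->
  (\sum_(k <oo) mu (B k) <= mu X + e%:E)%E ->
  exists K, (mu (X `\` \big[setU/set0]_(k < K) B k) <= e%:E)%E /\
    (mu (\big[setU/set0]_(k < K) B k `\` X) <= e%:E)%E.
Proof.
move=> e0 mX mB XB Xoo Be.
have Soo : (\sum_(k <oo) mu (B k) < +oo)%E by rewrite (le_lt_trans Be)// lte_add_pinfty ?ltry.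
have [K KP] := ecvg0_le (nneseries_tail_cvg Soo (fun k _ => measure_ge0 mu (B k))) e0.
have mU k : measurable (\big[setU/set0]_(j < k) B j) by apply: bigsetU_measurable.
have mUU : measurable (\bigcup_k B k) by exact: bigcupT_measurable.
exists K; split.
  apply: le_trans KP; apply: measure_sigma_subadditive_tail => //; first exact: measurableD.
  move=> u [/XB[k _ Bk] nU]; exists k => //= kK; apply: nU.
  exact: (@bigsetU_sup _ k K B kK u Bk).
apply: (@le_trans _ _ (mu (\bigcup_k B k `\` X))).
  apply: le_measure; rewrite ?inE; try exact: measurableD.
  by apply: setSD; rewrite -bigcup_mkord => u [k _ Bk]; exists k.
have Ue : (mu (\bigcup_k B k) <= mu X + e%:E)%E.
  by apply: le_trans Be; exact: measure_sigma_subadditive.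
rewrite measureD//; last by rewrite (le_lt_trans Ue)// lte_add_pinfty ?ltry.
rewrite [X in (_ - mu X)%E](_ : _ = X); last exact/setIidPr.
have Xf : mu X \is a fin_num by rewrite ge0_fin_numE.
by rewrite leeBlDl.
Qed.

Lemma nnint_indic_diff D A B (a : R) : measurable D -> measurable A -> measurable B ->
  (mu (D `&` A `\` B) <= a%:E)%E -> (mu (D `&` B `\` A) <= a%:E)%E ->
  (I D (fun u => `|\1_A u - \1_B u|%R) <= (2 * a)%:E)%E.
Proof.
move=> mD mA mB hA hB.
have m1 : measurable (A `\` B) by exact: measurableD.
have m2 : measurable (B `\` A) by exact: measurableD.
apply: (@le_trans _ _ (I D (fun u => (\1_(A `\` B) u + \1_(B `\` A) u)%R))).
  apply: nnint_le => //.
  - by apply: measurableT_comp => //; apply: measurable_funB; exact: measurable_indic.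
  - by apply: measurable_funD; exact: measurable_indic.
  - move=> u _; rewrite !indicE !in_setD.
    by case: (u \in A); case: (u \in B); rewrite /= ?subrr ?subr0 ?sub0r ?normrN ?normr0 ?normr1 ?addr0 ?add0r.
rewrite nnintD//; [|exact: measurable_indic..].
rewrite !integral_indic// mulr2n mulrDl !mul1r EFinD leeD//.
- by rewrite setIC setIDA.
- by rewrite setIC setIDA.
Qed.

End Measure_approximation.

(** * Strongly measurable functions *)

Section Norm.
Variables (R : realType) (Y : completeNormedModType R[i]).
Implicit Types x y z : Y.

Lemma nrmYE y : `|y| = (nrmY y)%:C%C.
Proof.
have : 0 <= `|y| := normr_ge0 y.
rewrite lecE /nrmY => /andP[/eqP/= h _].
by apply/eqP; rewrite eq_complex/= h !eqxx.
Qed.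

Lemma nrmY_ge0 y : 0 <= nrmY y.
Proof. by rewrite -lecR -nrmYE; exact: normr_ge0. Qed.

Lemma nrmYD x y : nrmY (x + y) <= nrmY x + nrmY y.
Proof. by rewrite -lecR rmorphD/= -!nrmYE; exact: ler_normD. Qed.

Lemma nrmYN y : nrmY (- y) = nrmY y. Proof. by rewrite /nrmY normrN. Qed.

Lemma nrmYC x y : nrmY (x - y) = nrmY (y - x). Proof. by rewrite -nrmYN opprB. Qed.

Lemma nrmYB x y : nrmY (x - y) <= nrmY x + nrmY y.
Proof. by rewrite -(nrmYN y) nrmYD. Qed.

Lemma nrmY_tri y x z : nrmY (x - z) <= nrmY (x - y) + nrmY (y - z).
Proof. by rewrite (le_trans _ (nrmYD _ _))// addrA subrK. Qed.

Lemma nrmY0 : nrmY (0 : Y) = 0. Proof. by rewrite /nrmY normr0. Qed.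

Lemma nrmY_eq0 y : nrmY y = 0 -> y = 0.
Proof. by move=> h; apply/normr0_eq0; rewrite nrmYE h. Qed.

Lemma nrmYZ (a : R[i]) y : nrmY (a *: y) = complex.Re `|a| * nrmY y.
Proof.
by rewrite /nrmY normrZ nrmYE; case: `|a| => u v /=; rewrite mulr0 subr0.
Qed.

Lemma nrmYZr (a : R) y : nrmY (a%:C%C *: y) = `|a| * nrmY y.
Proof. by rewrite nrmYZ normc_def/= expr0n/= addr0 sqrtr_sqr. Qed.

Lemma nrmY_sum I (r : seq I) (P : pred I) (F : I -> Y) :
  nrmY (\sum_(i <- r | P i) F i) <= \sum_(i <- r | P i) nrmY (F i).
Proof.
elim/big_ind2 : _ => //; first by rewrite nrmY0.
by move=> x a y b xa yb; rewrite (le_trans (nrmYD _ _))// lerD.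
Qed.

Lemma nrmY_dist x y : `|nrmY x - nrmY y| <= nrmY (x - y).
Proof.
rewrite ler_norml; apply/andP; split.
  by rewrite lerNl opprB lerBlDr nrmYC (le_trans _ (nrmYD _ _))// subrK.
by rewrite lerBlDr (le_trans _ (nrmYD _ _))// subrK.
Qed.

Lemma cvgYP (s : nat -> Y) y :
  s @ \oo --> y <-> forall e : R, 0 < e -> \forall k \near \oo, nrmY (y - s k) < e.
Proof.
split=> [/cvgrPdist_lt h e e0|h].
  have := h e%:C%C; rewrite ltcR => /(_ e0); apply: filterS => k.
  by rewrite nrmYE ltcR.
apply/cvgrPdist_lt => e; rewrite ltcE => /andP[/eqP /= ie re].
have := h _ re; apply: filterS => k hk.
by rewrite nrmYE ltcE/= ie eqxx.
Qed.

Lemma cvg_nrmY (s : nat -> Y) y : s @ \oo --> y -> (fun k => nrmY (s k)) @ \oo --> nrmY y.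
Proof.
move=> /cvgYP h; apply/cvgrPdist_lt => e e0; have := h e e0; apply: filterS => k.
exact/le_lt_trans/nrmY_dist.
Qed.

End Norm.

Section Strong_measurability.
Variables (R : realType) (n : nat) (Y : completeNormedModType R[i]).
Local Notation E := (Rn R n).
Local Notation V := 'rV[R]_n.
Implicit Types (f g F G : V -> Y) (s r : E -> Y).

Lemma lebn_complete : measure_is_complete (@lebn R n).
Proof. exact: measure_is_complete_caratheodory. Qed.

Lemma simple_op (h : Y -> Y -> Y) s r : lebn_simple s -> lebn_simple r ->
  lebn_simple (fun u => h (s u) (r u)).
Proof.
move=> [fs ms] [fr mr].
have fsr : finite_set (range s `*` range r) by exact: finite_setX.
split.
  apply: (@sub_finite_set _ _ ((fun x => h x.1 x.2) @` (range s `*` range r))).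
    move=> _ [u _ <-]; exists (s u, r u) => //; split=> /=; by exists u.
  exact: finite_image.
move=> y; rewrite (_ : _ @^-1` _ = \bigcup_(x in (range s `*` range r) `&` [set x | h x.1 x.2 = y])
    (s @^-1` [set x.1] `&` r @^-1` [set x.2])).
  apply: fin_bigcup_measurable; first exact: finite_setIl.
  by move=> x _; apply: measurableI.
apply/seteqP; split=> u /=.
  by move=> hy; exists (s u, r u) => //; split=> //; split; exists u.
by move=> [x [_ /= <-]] [/= -> ->].
Qed.

Lemma simple_trans a s : lebn_simple s -> lebn_simple (fun u => s (trans a u)).
Proof.
move=> [fs ms]; split.
  by apply: sub_finite_set fs => _ [u _ <-]; exists (trans a u).
by move=> y; exact: measurable_preimage_trans (ms y).
Qed.

Lemma measurable_nrmY_simple s : lebn_simple s -> measurable_fun [set: E] (fun u => nrmY (s u)).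
Proof.
move=> [fs ms] _ B mB; rewrite setTI.
rewrite (_ : _ @^-1` _ = \bigcup_(y in range s `&` [set y | B (nrmY y)]) s @^-1` [set y]).
  by apply: fin_bigcup_measurable; first exact: finite_setIl.
apply/seteqP; split=> u /=; first by move=> Bu; exists (s u) => //; split => //; exists u.
by move=> [y [_ /= By] ->].
Qed.

Lemma smeas_ae_cvg (s : nat -> E -> Y) F : (forall k, lebn_simple (s k)) ->
  (forall u, (fun k => s k u) @ \oo --> F (toRV u)) -> strongly_measurable F.
Proof. by move=> ss sF; exists s; split=> //; exists set0; split=> // u /=; case. Qed.

Lemma smeasB F G : strongly_measurable F -> strongly_measurable G ->
  strongly_measurable (fun u => F u - G u).
Proof.
move=> [s [ss sF]] [r [sr rG]]; exists (fun k u => s k u - r k u); split.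
  by move=> k; apply: (simple_op (fun x y => x - y)).
apply: filterS2 sF rG => u; exact: cvgB.
Qed.

Lemma smeas_trans a F : strongly_measurable F -> strongly_measurable (fun u => F (a + u)).
Proof.
move=> [s [ss [N [mN N0 NF]]]]; exists (fun k u => s k (trans a u)); split.
  by move=> k; exact: simple_trans.
exists (trans a @^-1` N); split; first exact: measurable_preimage_trans.
  by rewrite -N0; exact: lebn_trans.
by move=> u /= h; apply: NF => /= h'; apply: h.
Qed.

(** Off a null set the norm is a limit of measurable functions; inside it, completeness of the
    Caratheodory measure makes every subset measurable. *)
Lemma smeas_nrmY F : strongly_measurable F ->
  measurable_fun [set: E] (fun u : E => nrmY (F (toRV u))).
Proof.
move=> [s [ss [N [mN N0 NF]]]].
have m1 : measurable_fun (~` N) (fun u : E => nrmY (F (toRV u))).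
  apply: (@measurable_fun_cvg _ _ _ _ (fun k u => nrmY (s k u))).
    by move=> k; apply: measurable_funS (measurable_nrmY_simple (ss k)).
  move=> u Nu; apply: cvg_nrmY; apply: contrapT => h; apply: Nu; exact: NF.
move=> _ B mB; rewrite setTI.
set A := _ @^-1` B.
have -> : A = (~` N `&` A) `|` (N `&` A) by rewrite -setIUl setUC setUCr setTI.
apply: measurableU; first by apply: m1 => //; exact: measurableC.
by apply: lebn_complete; exists N; split => //; exact: subIsetl.
Qed.

End Strong_measurability.

(** * Rounding to a grid and functions constant on its cells *)

Section Grid.
Variables (R : realType) (n : nat) (Y : completeNormedModType R[i]).
Local Notation E := (Rn R n).
Local Notation V := 'rV[R]_n.
Implicit Types (f g F G : V -> Y) (s r : E -> Y) (h : R) (u v w : V).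

Definition flr h u : V := \row_i (h * (Num.floor (u 0 i / h))%:~R).

Definition cell h u : set V := hobox u (\row_i (u 0 i + h)).

Lemma flr_cell h u : 0 < h -> cell h (flr h u) u.
Proof.
move=> h0 i; rewrite !mxE; set x := u 0 i / h.
have -> : u 0 i = h * x by rewrite mulrC divfK// gt_eqF.
have /andP[h1 h2] := floor_itv x.
by rewrite ler_pM2l// h1 -[X in _ + X]mulr1 -mulrDr ltr_pM2l// -[1]/(1%:~R) -rmorphD.
Qed.

Lemma cell_flr h (z : 'I_n -> int) u : 0 < h ->
  cell h (\row_i (h * (z i)%:~R)) u -> flr h u = \row_i (h * (z i)%:~R).
Proof.
move=> h0 cu; apply/rowP => i; rewrite !mxE; congr (_ * _%:~R).
have := cu i; rewrite !mxE => /andP[h1 h2]; apply: floor_def.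
apply/andP; split; first by rewrite ler_pdivlMr// mulrC.
by rewrite ltr_pdivrMr// rmorphD/= mulrDl mul1r [_ * h]mulrC.
Qed.

Lemma flrE h u : flr h u = \row_i (h * (Num.floor (u 0 i / h))%:~R). Proof. by []. Qed.

Lemma flr_dist h u i : 0 < h -> `|u 0 i - flr h u 0 i| <= h.
Proof.
move=> h0; have := flr_cell u h0 i; rewrite !mxE => /andP[h1 h2].
by rewrite ger0_norm ?subr_ge0// lerBlDl ltW.
Qed.

Lemma flrD h u (z : 'I_n -> int) : 0 < h ->
  flr h (u + \row_i (h * (z i)%:~R)) = flr h u + \row_i (h * (z i)%:~R).
Proof.
move=> h0; apply/rowP => i; rewrite !mxE -mulrDr -rmorphD/=; congr (_ * _%:~R).
by rewrite mulrDl mulrAC divff ?gt_eqF// mul1r floorDrz ?intr_int// intrKfloor.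
Qed.

Lemma flr_flr h u : 0 < h -> flr h (flr h u) = flr h u.
Proof.
move=> h0; apply/rowP => i; rewrite !mxE mulrAC divff ?gt_eqF// mul1r.
by rewrite intrKfloor.
Qed.

Definition inbox h (m : nat) u := forall i, - (h * m%:R) <= u 0 i < h * m%:R.

Lemma measurable_cst_set (P : Prop) : measurable ([set _ | P] : set E).
Proof.
have [p|np] := pselect P; first by rewrite (_ : [set _ | P] = setT)//; apply/seteqP; split.
by rewrite (_ : [set _ | P] = set0)//; apply/seteqP; split.
Qed.

(** The half-open box [inbox h m] is a union of [(2 m)^n] cells, so the truncated function takes
    finitely many values, on sets built from finitely many cells. *)
Lemma simple_grid h m f : 0 < h ->
  lebn_simple (fun u : E => if `[< inbox h m (toRV u) >] then f (flr h (toRV u)) else 0).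
Proof.
move=> h0.
pose pt (z : {ffun 'I_n -> 'I_(m + m)}) : V := \row_i (h * ((z i : nat)%:Z - m%:Z)%:~R).
have inP u : inbox h m u -> exists z, flr h u = pt z.
  move=> H; pose k i := Num.floor (u 0 i / h) + m%:Z.
  have hk i : 0 <= k i < (m + m)%N%:Z.
    have /andP[h1 h2] := H i; rewrite /k; apply/andP; split.
      by rewrite -lerBlDr sub0r floor_ge_int rmorphN/= ler_pdivlMr// mulNr mulrC.
    have : Num.floor (u 0 i / h) < m%:Z.
      by rewrite -(ltr_int R) (le_lt_trans (floor_le _))// ltr_pdivrMr// mulrC.
    by rewrite PoszD ltrD2r.
  have hk' i : (`|k i| < m + m)%N.
    by have /andP[h1 h2] := hk i; rewrite -ltz_nat gez0_abs.
  exists [ffun i => Ordinal (hk' i)]; apply/rowP => i; rewrite !mxE ffunE/=.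
  by have /andP[h1 _] := hk i; rewrite gez0_abs// /k addrK.
have inC z u : cell h (pt z) u -> inbox h m u.
  move=> cu i; have := cu i; rewrite !mxE rmorphB/= mulrBr => /andP[h1 h2].
  have z0 : 0 <= h * (z i)%:R by rewrite mulr_ge0// ltW.
  have z1 : h * ((z i)%:R + 1) <= h * (m + m)%:R by rewrite ler_pM2l// natr1 ler_nat ltn_ord.
  move: h1 h2 z1; rewrite natrD !mulrDr mulr1 -!pmulrn => *; apply/andP; split; lra.
have ptE z u : cell h (pt z) u -> flr h u = pt z by exact: cell_flr.
split.
  apply: (@sub_finite_set _ _ ([set 0] `|` (fun z => f (pt z)) @` [set: {ffun 'I_n -> 'I_(m + m)}])).
    move=> _ [u _ <-] /=; case: asboolP => [/inP[z ->]|_]; last by left.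
    by right; exists z.
  rewrite finite_setU; split; first exact: finite_set1.
  by apply: finite_image; exact: finite_finset.
move=> y; set B := \bigcup_(z in [set: {ffun 'I_n -> 'I_(m + m)}]) cell h (pt z).
have mcell z : measurable (cell h (pt z) : set E) by exact: measurable_hobox.
have BE u : inbox h m u <-> B u.
  split=> [ib|[z _]]; last exact: inC.
  by have [z zE] := inP _ ib; exists z => //; rewrite -zE; exact: flr_cell.
rewrite [X in measurable X](_ : _ = ([set _ | 0 = y] `&` ~` B) `|`
   \bigcup_(z in [set z | f (pt z) = y]) cell h (pt z)).
  apply: measurableU.
    apply: measurableI; first exact: (measurable_cst_set (0 = y)).
    by apply: measurableC; apply: fin_bigcup_measurable => //; exact: finite_finset.
  by apply: fin_bigcup_measurable => //; exact: finite_finset.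
apply/seteqP; split=> u /=.
  case: asboolP => [ib fy|ib fy].
    by right; have [z zE] := inP _ ib; exists z; rewrite /= -?zE//; exact: flr_cell.
  by left; split=> // /BE.
move=> [[<- nB]|[z /= <- cz]].
  by case: asboolP => // /BE.
by case: asboolP => [_|]; [rewrite (ptE z)|case; exact: inC cz].
Qed.

Lemma inbox_mono h m k u : 0 < h -> (m <= k)%N -> inbox h m u -> inbox h k u.
Proof.
move=> h0 mk H i; have /andP[h1 h2] := H i.
have mk' : h * m%:R <= h * k%:R by rewrite ler_pM2l// ler_nat.
by apply/andP; split; lra.
Qed.

Lemma inbox_ex h u : 0 < h -> exists m, inbox h m u.
Proof.
move=> h0; exists (\max_i (Num.truncn (`|u 0%R i| / h)).+1)%N => i.
set m := (\max_i _)%N.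
have : `|u 0 i| < h * m%:R.
  rewrite mulrC -ltr_pdivrMr//; apply: lt_le_trans (truncnS_gt _) _.
  by rewrite ler_nat; apply: (leq_bigmax i).
by rewrite ltr_norml => /andP[/ltW -> ->].
Qed.

(** One criterion for two uses: step functions, with a constant mesh, and continuous functions, with
    a mesh tending to 0. *)
Lemma smeas_cvg_grid (h : nat -> R) (m : nat -> nat) (f : nat -> V -> Y) F :
  (forall k, 0 < h k) ->
  (forall u, \forall k \near \oo, inbox (h k) (m k) u) ->
  (forall u, (fun k => f k (flr (h k) u)) @ \oo --> F u) ->
  strongly_measurable F.
Proof.
move=> h0 im fF.
apply: (@smeas_ae_cvg _ _ _ (fun k u => if `[< inbox (h k) (m k) (toRV u) >] then f k (flr (h k) (toRV u)) else 0)).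
  by move=> k; exact: simple_grid.
move=> u; apply: cvg_trans (fF u); apply: near_eq_cvg.
have := im u; apply: filterS => k ik.
by case: asboolP.
Qed.

Lemma smeas_grid h F : 0 < h -> (forall u, F (flr h u) = F u) -> strongly_measurable F.
Proof.
move=> h0 FE; apply: (@smeas_cvg_grid (fun=> h) id (fun=> F)) => // u.
  have [m mu] := inbox_ex u h0; exists m => // k /= mk; exact: inbox_mono mu.
by rewrite FE; exact: cvg_cst.
Qed.

Lemma smeas_ucont F :
  (forall u (e : R), 0 < e -> exists d, 0 < d /\
     forall v, (forall i, `|u 0 i - v 0 i| < d) -> nrmY (F u - F v) < e) ->
  strongly_measurable F.
Proof.
move=> FC; pose h k : R := k.+1%:R^-1.
have h0 k : 0 < h k by rewrite invr_gt0.
(* With [(k + 1)^2] cells of mesh [1 / (k + 1)] on each half-axis, the truncation box has half-side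
   [k + 1] and exhausts the space. *)
apply: (@smeas_cvg_grid h (fun k => k.+1 * k.+1)%N (fun=> F)) => // u.
  have [m mu] := inbox_ex u ltr01; exists m => // k /= mk i.
  have /andP[h1 h2] := mu i; rewrite !mul1r in h1 h2.
  have -> : h k * (k.+1 * k.+1)%:R = k.+1%:R by rewrite natrM mulrA mulVf ?mul1r// pnatr_eq0.
  have : m%:R <= k.+1%:R :> R by rewrite ler_nat leqW.
  by move=> *; apply/andP; split; lra.
apply/cvgYP => e e0; have [d [d0 dP]] := FC u e e0.
exists (Num.truncn d^-1) => // k /= dk; apply: dP => i.
apply: le_lt_trans (flr_dist u i (h0 k)) _.
rewrite /h -[ltRHS]invrK ltf_pV2 ?posrE ?invr_gt0//.
by apply: lt_le_trans (truncnS_gt _) _; rewrite ler_nat ltnS.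
Qed.

End Grid.

(** * Integrals of p-th powers *)

Section Lpint.
Variables (R : realType) (n : nat) (p : R) (Y : completeNormedModType R[i]).
Hypothesis p1 : 1 <= p.
Local Notation E := (Rn R n).
Local Notation V := 'rV[R]_n.
Implicit Types (f g F G : V -> Y) (D : set E) (t u v : V).

Let p0 : 0 < p. Proof. exact: lt_le_trans p1. Qed.

Definition npow (y : Y) : R := nrmY y `^ p.

Lemma npow_ge0 y : 0 <= npow y. Proof. exact: powR_ge0. Qed.

Lemma npowC x y : npow (x - y) = npow (y - x). Proof. by rewrite /npow nrmYC. Qed.

Lemma npow0 : npow 0 = 0. Proof. by rewrite /npow nrmY0 powR0// gt_eqF. Qed.

(* The constant of the quasi-triangle inequality for the [p]-th power of the
   norm, which is used everywhere in place of Minkowski's inequality. *)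
Definition cp : R := 2 `^ p.

Lemma cp_gt0 : 0 < cp. Proof. exact: powR_gt0. Qed.

Lemma cp_ge1 : 1 <= cp.
Proof. by rewrite -(powRr0 (2 : R)) ler_powR ?ler1n// ltW. Qed.

(** A sum of two norms is at most twice their maximum, and the power of the maximum is one of the
    two powers. *)
Lemma npow_tri y x z : npow (x - z) <= cp * (npow (x - y) + npow (y - z)).
Proof.
rewrite /npow /cp; set a := nrmY (x - y); set b := nrmY (y - z).
have a0 : 0 <= a := nrmY_ge0 _; have b0 : 0 <= b := nrmY_ge0 _.
have hxz : nrmY (x - z) <= 2 * Num.max a b.
  rewrite (le_trans (nrmY_tri y _ _))// -/a -/b.
  by rewrite mulr2n mulrDl !mul1r lerD// le_max lexx ?orbT.
have m0 : 0 <= Num.max a b by rewrite le_max a0.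
rewrite (@le_trans _ _ ((2 * Num.max a b) `^ p))//.
  by rewrite ge0_ler_powR ?nnegrE ?(ltW p0) ?nrmY_ge0// mulr_ge0.
rewrite powRM// ler_wpM2l ?powR_ge0//.
by case: (leP a b) => _; rewrite ?lerDl ?lerDr ?powR_ge0.
Qed.

Definition Lpint D f : \bar R := (\int[@lebn R n]_(u in D) (npow (f (toRV u)))%:E)%E.

Lemma npow_le y M : nrmY y <= M -> npow y <= M `^ p.
Proof.
move=> yM; have y0 := nrmY_ge0 y.
by rewrite /npow ge0_ler_powR ?nnegrE ?(ltW p0)// (le_trans y0).
Qed.

Lemma measurable_npow F : strongly_measurable F ->
  measurable_fun [set: E] (fun u : E => npow (F (toRV u))).
Proof. by move=> sF; exact: measurableT_comp (measurable_powR p) (smeas_nrmY sF). Qed.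

Lemma Lpint_ge0 D f : (0 <= Lpint D f)%E.
Proof. by apply: integral_ge0 => u _; rewrite lee_fin npow_ge0. Qed.

Lemma Lpint_subset D D' F : strongly_measurable F -> measurable D -> measurable D' ->
  D `<=` D' -> (Lpint D F <= Lpint D' F)%E.
Proof.
move=> sF mD mD'.
exact: (@nnint_subset _ (Rn R n) R (@lebn R n) D D' _ mD mD' (measurable_npow sF) (fun u => npow_ge0 _)).
Qed.

Lemma Lpint_tri D F G H a b : strongly_measurable F -> strongly_measurable G ->
  strongly_measurable H -> measurable D ->
  (Lpint D (fun u => F u - G u)%R <= a%:E)%E -> (Lpint D (fun u => G u - H u)%R <= b%:E)%E ->
  (Lpint D (fun u => F u - H u)%R <= (cp * (a + b))%:E)%E.
Proof.
move=> sF sG sH mD.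
exact: (@nnint_le_comb _ (Rn R n) R (@lebn R n) D _ _ _ cp a b mD (measurable_npow (smeasB sF sH))
  (measurable_npow (smeasB sF sG)) (measurable_npow (smeasB sG sH))
  (fun u => npow_ge0 _) (fun u => npow_ge0 _) (fun u => npow_ge0 _) (ltW cp_gt0)
  (fun u _ => npow_tri _ _ _)).
Qed.

Lemma Lpint_ext D f g : (forall u, D u -> f u = g u) -> Lpint D f = Lpint D g.
Proof. by move=> fg; apply: eq_integral => u; rewrite inE => Du; rewrite /toRV fg. Qed.

Lemma Lpint_congr D f g x : (forall u, f u = g u) -> (Lpint D f <= x)%E -> (Lpint D g <= x)%E.
Proof. by move=> /funext ->. Qed.

Lemma Lpint_sym D f g : Lpint D (fun u => f u - g u) = Lpint D (fun u => g u - f u).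
Proof. by apply: eq_integral => u _; rewrite npowC. Qed.

Lemma Lpint_trans a D F : strongly_measurable F -> measurable D ->
  Lpint (trans a @^-1` D) (fun u => F (a + u)) = Lpint D F.
Proof.
move=> sF mD; symmetry; apply: (@integral_trans R n a D (fun u => (npow (F (toRV u)))%:E)) => //.
  by apply/measurable_EFinP/measurable_funTS; exact: measurable_npow.
by move=> u _; rewrite lee_fin npow_ge0.
Qed.

Lemma tcube_trans a t l : (trans a @^-1` (tcube (a + t) l) : set E) = tcube t l.
Proof. by apply/seteqP; split=> u /= H i; have := H i; rewrite /trans /toRV !mxE -addrA !lerD2l. Qed.

Lemma hobox_trans a s t : (trans a @^-1` (hobox (a + s) (a + t)) : set E) = hobox s t.
Proof. by apply/seteqP; split=> u /= H i; have := H i; rewrite /trans /toRV !mxE lerD2l ltrD2l. Qed.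

Lemma Lpint_tcube a t l F : strongly_measurable F ->
  Lpint (tcube t l) (fun u => F (a + u)) = Lpint (tcube (a + t) l) F.
Proof. by move=> sF; rewrite -(tcube_trans a t) Lpint_trans//; exact: measurable_tcube. Qed.

Lemma Lpint_le_cst D F M : strongly_measurable F -> measurable D ->
  (forall u, D u -> npow (F u) <= M) -> (Lpint D F <= M%:E * lebn D)%E.
Proof.
move=> sF mD.
exact: (@nnint_le_cst _ (Rn R n) R (@lebn R n) D _ M mD (measurable_npow sF) (fun u => npow_ge0 _)).
Qed.

Lemma Lpint_tcube_le t l F M : strongly_measurable F -> 0 <= l -> 0 <= M ->
  (forall u, tcube t l u -> npow (F u) <= M) -> (Lpint (tcube t l) F <= (M * l ^+ n)%:E)%E.
Proof.
move=> sF l0 M0 FM; apply: le_trans (Lpint_le_cst sF _ FM) _; first exact: measurable_tcube.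
by rewrite EFinM lee_wpmul2l// lebn_tcube_le.
Qed.

End Lpint.

Section Reformulation.
Variables (R : realType) (n : nat) (p : R) (Y : completeNormedModType R[i]).
Hypothesis p1 : 1 <= p.
Local Notation E := (Rn R n).
Local Notation V := 'rV[R]_n.
Implicit Types (F P : V -> Y) (t : V).
Local Notation J := (@Lpint R n p Y).

Let p0 : 0 < p. Proof. exact: lt_le_trans p1. Qed.

(** Raising to the power [p] turns the normalising factor into the volume [l^n] of the cube; both
    sides are false when [x] is infinite. *)
Lemma normalized_le (x : \bar R) (l e : R) : (0 <= x)%E -> 0 < l -> 0 <= e ->
  (mule (l `^ (- (n%:R / p)))%:E (poweR x p^-1) <= e%:E)%E = (x <= (e `^ p * l ^+ n)%:E)%E.
Proof.
move=> x0 l0 e0; set c := l `^ (n%:R / p).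
have c0 : 0 < c by apply: powR_gt0.
have pn0 : p != 0 by rewrite gt_eqF.
have cE : e `^ p * l ^+ n = (e * c) `^ p.
  by rewrite powRM// ?(ltW c0)// /c -powRrM divfK// powR_mulrn// ltW.
rewrite powRN cE -/c; case: x x0 => [r r0|_|//].
  rewrite /= -EFinM !lee_fin mulrC ler_pdivrMr//.
  have r0' : 0 <= r by [].
  have ec0 : 0 <= e * c by rewrite mulr_ge0// ltW.
  apply/idP/idP => h.
    have := @ge0_ler_powR _ p (ltW p0) (r `^ p^-1) (e * c); rewrite !nnegrE powR_ge0 ec0 => /(_ isT isT h).
    by rewrite -powRrM mulVf// powRr1.
  have p'0 : 0 <= p^-1 by rewrite invr_ge0 ltW.
  have := @ge0_ler_powR _ p^-1 p'0 r ((e * c) `^ p); rewrite !nnegrE powR_ge0 r0' => /(_ isT isT h).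
  by rewrite -powRrM mulfV// powRr1.
by rewrite /= invr_eq0 (negbTE pn0) gt0_muley ?lte_fin ?invr_gt0// !leye_eq.
Qed.

Lemma sup_le (l e : R) (D : V -> set E) (g : V -> V -> Y) : 0 < l -> 0 <= e ->
  (ereal_sup [set mule (l `^ (- (n%:R / p)))%:E (LpNorm p (D t) (fun u => g t (toRV u)))
     | t in [set: V]] <= e%:E)%E <->
  forall t, (J (D t) (g t) <= (e `^ p * l ^+ n)%:E)%E.
Proof.
move=> l0 e0; split=> H.
  move=> t; rewrite -normalized_le ?Lpint_ge0//; apply: le_trans H.
  by apply: ereal_sup_ubound; exists t.
apply: ge_ereal_sup => _ [t _ <-]; by rewrite normalized_le ?Lpint_ge0//; exact: H.
Qed.

(** A supremum of terms below [e] may equal [e], so strictness is bought with the bound for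
    [e / 2]. *)
Lemma sup_lt (l e : R) (D : V -> set E) (g : V -> V -> Y) : 0 < l -> 0 < e ->
  (forall t, (J (D t) (g t) <= ((e / 2) `^ p * l ^+ n)%:E)%E) ->
  (ereal_sup [set mule (l `^ (- (n%:R / p)))%:E (LpNorm p (D t) (fun u => g t (toRV u)))
     | t in [set: V]] < e%:E)%E.
Proof.
move=> l0 e0 H; apply: (@le_lt_trans _ _ (e / 2)%:E).
  by apply/sup_le => //; rewrite divr_ge0// ltW.
by rewrite lte_fin ltr_pdivrMr// mulr2n mulrDr mulr1 ltrDl.
Qed.

(** As the tolerance ranges over all positive numbers, it may be replaced by its [p]-th power; this
    removes roots and suprema. *)
Lemma eWapP F : eWap p F <->
  forall e : R, 0 < e -> exists l : R, 0 < l /\ exists L : R, 0 < L /\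
  forall t0, exists tau : V, eball t0 L tau /\
    forall t, (J (tcube t l) (fun u => F (tau + u) - F u)%R <= (e * l ^+ n)%:E)%E.
Proof.
split=> H e e0.
  have [|l [l0 [L [L0 HL]]]] := H (e `^ p^-1); first exact: powR_gt0.
  exists l; split => //; exists L; split => // t0; have [tau [tb /ltW tP]] := HL t0.
  exists tau; split => // t; have -> : e = (e `^ p^-1) `^ p.
    by rewrite -powRrM mulVf ?gt_eqF// powRr1// ltW.
  exact: (iffLR (@sup_le l _ (fun t => tcube t l) (fun _ u => F (tau + u) - F u) l0 (powR_ge0 _ _)) tP t).
have [|l [l0 [L [L0 HL]]]] := H ((e / 2) `^ p); first by rewrite powR_gt0// divr_gt0.
exists l; split => //; exists L; split => // t0; have [tau [tb tP]] := HL t0.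
exists tau; split => //.
exact: (@sup_lt l e (fun t => tcube t l) (fun _ u => F (tau + u) - F u)).
Qed.

Lemma eWP F : eW p F <->
  forall e : R, 0 < e -> exists l0 : R, 0 < l0 /\ exists P : V -> Y, is_trigpol P /\
  forall l, l0 <= l -> forall t,
    (J (tcube 0 l) (fun u => P (t + u) - F (t + u))%R <= (e * l ^+ n)%:E)%E.
Proof.
split=> H e e0.
  have [|l [l0 [P [tP HP]]]] := H (e `^ p^-1); first exact: powR_gt0.
  exists l; split => //; exists P; split => // m lm t; have /ltW mP := HP m lm.
  have -> : e = (e `^ p^-1) `^ p by rewrite -powRrM mulVf ?gt_eqF// powRr1// ltW.
  exact: (iffLR (@sup_le m _ (fun=> tcube 0 m) (fun t u => P (t + u) - F (t + u)) (lt_le_trans l0 lm) (powR_ge0 _ _)) mP t).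
have [|l [l0 [P [tP HP]]]] := H ((e / 2) `^ p); first by rewrite powR_gt0// divr_gt0.
exists l; split => //; exists P; split => // m lm.
apply: (@sup_lt m e (fun=> tcube 0 m) (fun t u => P (t + u) - F (t + u))) => //.
  exact: lt_le_trans lm.
exact: HP.
Qed.

End Reformulation.

(** * Almost periods of trigonometric polynomials *)

Section Trigonometric_polynomials.
Variables (R : realType) (n : nat) (p : R) (Y : completeNormedModType R[i]).
Hypothesis p1 : 1 <= p.
Local Notation E := (Rn R n).
Local Notation V := 'rV[R]_n.
Implicit Types (F P : V -> Y) (t : V).
Local Notation J := (@Lpint R n p Y).

Let p0 : 0 < p. Proof. exact: lt_le_trans p1. Qed.

Lemma Re_norm_le (z : R[i]) (d : R) : 0 <= d ->
  complex.Re z ^+ 2 + complex.Im z ^+ 2 <= d ^+ 2 -> complex.Re `|z| <= d.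
Proof. by move=> d0 zd; rewrite normc_def/= -[leRHS](ger0_norm d0) -sqrtr_sqr ler_wsqrtr. Qed.

Lemma expi_lip (a b : R) : complex.Re `|expi a - expi b| <= 2 * `|a - b|.
Proof.
apply: Re_norm_le; first by rewrite mulr_ge0.
rewrite /= exprMn -[X in X + _]real_normK ?num_real// -[X in _ + X]real_normK ?num_real//.
have h1 : `|cos a - cos b| ^+ 2 <= `|a - b| ^+ 2 by rewrite lerXn2r ?nnegrE// cos_lip.
have h2 : `|sin a - sin b| ^+ 2 <= `|a - b| ^+ 2 by rewrite lerXn2r ?nnegrE// sin_lip.
have : 0 <= `|a - b| ^+ 2 by apply: sqr_ge0.
lra.
Qed.

(** The squared modulus of [expi th - 1] is [2 - 2 cos th]. *)
Lemma expi_near1 (th d : R) : 0 <= d -> 1 - d ^+ 2 / 2 < cos th -> complex.Re `|expi th - 1| <= d.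
Proof.
move=> d0 h; apply: Re_norm_le => //=.
have := cos2Dsin2 th; rewrite subr0; set c := cos th in h *; set s := sin th; nra.
Qed.

Lemma trigpol_ucont P : is_trigpol P -> exists C : R, 0 <= C /\
  forall (u v : V) (d : R), (forall i, `|u 0 i - v 0 i| <= d) -> nrmY (P u - P v) <= C * d.
Proof.
move=> [m [lam [c ->]]].
exists (\sum_(j < m) 2 * (\sum_i `|lam j 0 i|) * nrmY (c j)); split.
  by apply: sumr_ge0 => j _; rewrite mulr_ge0 ?nrmY_ge0// mulr_ge0// sumr_ge0.
move=> u v d uvd; rewrite /trigpol -sumrB (le_trans (nrmY_sum _ _ _))// mulr_suml.
apply: ler_sum => j _; rewrite -scalerBl nrmYZ mulrAC ler_wpM2r ?nrmY_ge0//.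
rewrite (le_trans (expi_lip _ _))// -mulrA ler_wpM2l//.
rewrite -sumrB (le_trans (ler_norm_sum _ _ _))// mulr_suml; apply: ler_sum => i _.
by rewrite -mulrBr normrM ler_wpM2l.
Qed.

Lemma smeas_trigpol P : is_trigpol P -> strongly_measurable P.
Proof.
move=> /trigpol_ucont[C [C0 CP]]; apply: smeas_ucont => u e e0.
have C1 : 0 < C + 1 by rewrite ltr_wpDl.
exists (e / (C + 1)); split; first by rewrite divr_gt0.
move=> v uv; apply: le_lt_trans (CP u v (e / (C + 1)) _) _; first by move=> i; exact: ltW.
by rewrite mulrCA gtr_pMr// ltr_pdivrMr// mul1r ltrDl.
Qed.

(** The phases of [t0] are close to those of some net point [s k], so [t0 - s k] is a common almost
    period at distance [|s k|] from [t0]. The sum of these norms bounds each of them, and the added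
    1 makes the inequality of the ball strict. *)
Lemma relatively_dense_phases m (lam : 'I_m -> V) (k : R) : 0 < k ->
  exists L : R, 0 < L /\ forall t0, exists tau : V, eball t0 L tau /\
    forall j, 1 - k < cos (dotp (lam j) tau).
Proof.
move=> k0; have [K [s sP]] := @phase_net R V 'I_m (fun j v => dotp (lam j) v) k k0.
pose N (v : V) := Num.sqrt (\sum_i v 0 i ^+ 2).
exists (\sum_k N (s k) + 1); split.
  by rewrite ltr_wpDl// sumr_ge0// => i _; exact: sqrtr_ge0.
move=> t0; have [i iP] := sP t0; exists (t0 - s i); split.
  rewrite /eball/= (eq_bigr (fun j => s i 0 j ^+ 2)); last first.
    by move=> j _; rewrite !mxE addrAC subrr add0r sqrrN.
  apply: (@le_lt_trans _ _ (\sum_k N (s k))); last by rewrite ltrDl.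
  by rewrite (bigD1 i)//= lerDl sumr_ge0// => j _; exact: sqrtr_ge0.
by move=> j; rewrite dotpBr.
Qed.

Lemma trigpol_periods P (e : R) : is_trigpol P -> 0 < e ->
  exists L : R, 0 < L /\ forall t0, exists tau : V, eball t0 L tau /\
    forall u, npow p (P (tau + u) - P u) <= e.
Proof.
move=> [m [lam [c ->]]] e0.
(* [d] will be the error allowed for each character, chosen so that the weighted total is at most
   the [p]-th root of [e]; the 1 in [C] excludes a division by 0. *)
pose C := \sum_(j < m) nrmY (c j) + 1.
have C0 : 0 < C by rewrite ltr_wpDl// sumr_ge0// => j _; exact: nrmY_ge0.
pose d := e `^ p^-1 / C; have d0 : 0 < d by rewrite divr_gt0// powR_gt0.
have [|L [L0 LP]] := @relatively_dense_phases m lam (d ^+ 2 / 2).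
  by rewrite divr_gt0// exprn_gt0.
exists L; split => // t0; have [tau [tb tP]] := LP t0; exists tau; split => // u.
have -> : e = (e `^ p^-1) `^ p by rewrite -powRrM mulVf ?gt_eqF// powRr1// ltW.
apply: npow_le => //; rewrite /trigpol -sumrB (le_trans (nrmY_sum _ _ _))//.
apply: (@le_trans _ _ (\sum_(j < m) d * nrmY (c j))); last first.
  by rewrite -mulr_sumr /d mulrAC ler_pdivrMr// ler_pM2l ?powR_gt0// /C lerDl.
apply: ler_sum => j _.
have -> : \sum_(i < n) lam j 0 i * (tau + u) 0 i = dotp (lam j) tau + dotp (lam j) u.
  by rewrite /dotp -big_split; apply: eq_bigr => i _; rewrite mxE mulrDr.
rewrite -/(dotp (lam j) u) -scalerBl expiD -[X in _ - X]mul1r -mulrBl -scalerA nrmYZ.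
rewrite ler_pM ?nrmY_ge0//.
- by have := normr_ge0 (expi (dotp (lam j) tau) - 1); rewrite lecE => /andP[_].
- exact: expi_near1 (ltW d0) (tP j).
- by rewrite nrmYZ /expi normc_def/= cos2Dsin2 sqrtr1 mul1r.
Qed.

Lemma eW_eWap F : strongly_measurable F -> eW p F -> eWap p F.
Proof.
move=> sF /(eWP p1) H; apply/(eWapP p1) => e e0.
have c0 : 0 < cp p by exact: cp_gt0.
have c1 : 1 <= cp p by exact: cp_ge1.
(* Passing from [F (tau + u)] through [P (tau + u)] and [P u] to [F u] costs
   [c * (x + c * (x + x)) <= 3 c^2 x], where [c] is [cp p]. *)
pose e1 := e / (3 * cp p ^+ 2).
have e10 : 0 < e1 by rewrite divr_gt0// mulr_gt0// exprn_gt0.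
have [l [l0 [P [tP HP]]]] := H e1 e10.
have [L [L0 LP]] := trigpol_periods tP e10.
exists l; split => //; exists L; split => // t0.
have [tau [tb tauP]] := LP t0; exists tau; split => // t.
have sP := smeas_trigpol tP.
have sPF := smeasB sP sF.
have PF x : (J (tcube x l) (fun u => P u - F u)%R <= (e1 * l ^+ n)%:E)%E.
  have := HP l (lexx _) x.
  by rewrite (@Lpint_tcube R n p Y x 0 l (fun u => P u - F u))// addr0.
have mt : measurable (tcube t l : set E) by exact: measurable_tcube.
have s1 := smeas_trans tau sF; have s2 := smeas_trans tau sP.
have j1 : (J (tcube t l) (fun u => F (tau + u) - P (tau + u))%R <= (e1 * l ^+ n)%:E)%E.
  rewrite (@Lpint_tcube R n p Y tau t l (fun u => F u - P u))//; last exact: smeasB.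
  by rewrite Lpint_sym; exact: PF.
have j2 : (J (tcube t l) (fun u => P (tau + u) - P u)%R <= (e1 * l ^+ n)%:E)%E.
  by apply: Lpint_tcube_le => //; [exact: smeasB|exact: ltW|exact: ltW].
have j3 := Lpint_tri p1 s2 sP sF mt j2 (PF t).
apply: le_trans (Lpint_tri p1 s1 s2 sF mt j1 j3) _.
rewrite lee_fin.
have -> : e = e1 * (3 * cp p ^+ 2) by rewrite /e1 divfK// gt_eqF// mulr_gt0// exprn_gt0.
set x := e1 * l ^+ n; have x0 : 0 <= x by rewrite mulr_ge0 ?exprn_ge0 ?ltW.
have -> : e1 * (3 * cp p ^+ 2) * l ^+ n = 3 * (cp p ^+ 2 * x) by rewrite /x; ring.
have -> : cp p * (x + cp p * (x + x)) = cp p * x + 2 * (cp p ^+ 2 * x) by ring.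
have : cp p * x <= cp p ^+ 2 * x by rewrite ler_wpM2r// expr2 ler_peMr// ltW.
lra.
Qed.

End Trigonometric_polynomials.

(** * Density of uniformly continuous functions *)

Section Tents.
Variables (R : realType) (n : nat).
Local Notation E := (Rn R n).
Local Notation V := 'rV[R]_n.
Implicit Types (f g : V -> R) (u v : V) (A B : set V).

Definition ucont01 f := [/\ measurable_fun [set: E] (fun u : E => f (toRV u)),
  forall u, 0 <= f u <= 1 &
  forall e : R, 0 < e -> exists d : R, 0 < d /\ forall u v, (forall i, `|u 0 i - v 0 i| < d) ->
    `|f u - f v| < e].

Lemma ucont01_1 : ucont01 (fun=> 1).
Proof.
split=> [|u|e e0]; [exact: measurable_cst|by rewrite ler01 lexx|].
by exists 1; split => // u v _; rewrite subrr normr0.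
Qed.

Lemma ucont01M f g : ucont01 f -> ucont01 g -> ucont01 (fun u => f u * g u).
Proof.
move=> [mf f01 cf] [mg g01 cg]; split.
- exact: measurable_funM.
- move=> u; have /andP[f0 f1] := f01 u; have /andP[g0 g1] := g01 u.
  by rewrite mulr_ge0//= mulr_ile1.
- move=> e e0; have e20 : 0 < e / 2 by rewrite divr_gt0.
  have [d [d0 dP]] := cf _ e20; have [d' [d'0 d'P]] := cg _ e20.
  exists (Num.min d d'); split; first by rewrite lt_min d0.
  move=> u v uv.
  have h1 : `|f u - f v| < e / 2 by apply: dP => i; have := uv i; rewrite lt_min => /andP[].
  have h2 : `|g u - g v| < e / 2 by apply: d'P => i; have := uv i; rewrite lt_min => /andP[].
  have -> : f u * g u - f v * g v = (f u - f v) * g u + f v * (g u - g v) by ring.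
  apply: le_lt_trans (ler_normD _ _) _; rewrite !normrM [ltRHS]splitr.
  have /andP[f0 f1] := f01 v; have /andP[g0 g1] := g01 u.
  rewrite (ger0_norm g0) (ger0_norm f0).
  rewrite ltr_leD//; first by apply: le_lt_trans h1; rewrite ler_piMr.
  by apply: le_trans (ltW h2); rewrite ler_piMl.
Qed.

Lemma ucont01_compl f : ucont01 f -> ucont01 (fun u => 1 - f u).
Proof.
move=> [mf f01 cf]; split.
- by apply: measurable_funB => //; exact: measurable_cst.
- by move=> u; have /andP[f0 f1] := f01 u; rewrite subr_ge0 f1 lerBlDr lerDl f0.
- move=> e e0; have [d [d0 dP]] := cf _ e0; exists d; split => // u v uv.
  by rewrite opprB addrC addrA subrK distrC dP.
Qed.

Lemma ucont01_prod (I : Type) (s : seq I) (F : I -> V -> R) :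
  (forall i, ucont01 (F i)) -> ucont01 (fun u => \prod_(i <- s) F i u).
Proof.
move=> FP; elim: s => [|i s IH].
  by rewrite (_ : (fun _ => _) = fun=> 1); [exact: ucont01_1|apply/funext => u; rewrite big_nil].
rewrite (_ : (fun _ => _) = fun u => F i u * \prod_(j <- s) F j u); last first.
  by apply/funext => u; rewrite big_cons.
exact: ucont01M.
Qed.

Definition clamp (x : R) : R := Num.max 0 (Num.min 1 x).

Lemma clamp01 x : 0 <= clamp x <= 1.
Proof. by rewrite /clamp le_max lexx/= ge_max ler01 ge_min lexx. Qed.

Lemma clamp_le0 x : x <= 0 -> clamp x = 0.
Proof. by move=> x0; rewrite /clamp; apply/max_idPl; rewrite ge_min x0 orbT. Qed.

Lemma clamp_ge1 x : 1 <= x -> clamp x = 1.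
Proof. by move=> x1; rewrite /clamp (min_idPl x1); apply/max_idPr. Qed.

Lemma clamp_id x : 0 <= x <= 1 -> clamp x = x.
Proof. by move=> /andP[x0 x1]; rewrite /clamp (min_idPr x1); apply/max_idPr. Qed.

Lemma clamp_lip x y : `|clamp x - clamp y| <= `|x - y|.
Proof.
wlog xy : x y / y <= x.
  by move=> H; case/orP: (le_total y x) => h; [exact: (H _ _ h)|rewrite distrC [leRHS]distrC; exact: (H _ _ h)].
rewrite (ger0_norm (_ : 0 <= x - y)) ?subr_ge0//.
have [y0|y0] := leP y 0.
  rewrite (clamp_le0 y0) subr0; have /andP[h1 h2] := clamp01 x; rewrite ger0_norm//.
  have [x0|x0] := leP x 0; first by rewrite clamp_le0// subr_ge0.
  have [x1|x1] := leP 1 x; first by rewrite clamp_ge1//; lra.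
  by rewrite clamp_id ?(ltW x0) ?(ltW x1)//; lra.
have [x1|x1] := leP 1 x.
  rewrite (clamp_ge1 x1); have /andP[h1 h2] := clamp01 y; rewrite ger0_norm ?subr_ge0//.
  have [y1|y1] := leP 1 y; first by rewrite clamp_ge1// subrr subr_ge0.
  by rewrite clamp_id ?(ltW y0) ?(ltW y1)//; lra.
rewrite !clamp_id ?(ltW (lt_le_trans y0 xy)) ?(ltW x1) ?(ltW y0) ?(ltW (le_lt_trans xy x1))//.
by rewrite ger0_norm// subr_ge0.
Qed.

Lemma ucont01_clamp (a b : R) i : ucont01 (fun u => clamp (a * u 0 i + b)).
Proof.
split.
- apply: measurable_maxr; first exact: measurable_cst.
  apply: measurable_minr; first exact: measurable_cst.
  apply: measurable_funD; last exact: measurable_cst.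
  by apply: measurable_funM; [exact: measurable_cst|exact: measurable_coord].
- by move=> u; exact: clamp01.
- move=> e e0; have a1 : 0 < `|a| + 1 by rewrite ltr_wpDl.
  exists (e / (`|a| + 1)); split; first by rewrite divr_gt0.
  move=> u v uv; apply: le_lt_trans (clamp_lip _ _) _.
  have -> : a * u 0 i + b - (a * v 0 i + b) = a * (u 0 i - v 0 i) by ring.
  rewrite normrM; have := uv i; rewrite ltr_pdivlMr// => h; apply: le_lt_trans h.
  by rewrite mulrDr mulr1 [leLHS]mulrC lerDl.
Qed.

(** Eventual equality at each point, which is stronger than convergence, is immediately inherited by
    finite unions. *)
Definition tentable A := exists psi : nat -> V -> R, (forall m, ucont01 (psi m)) /\
  forall u, \forall m \near \oo, psi m u = \1_A u.

(** In each coordinate one ramp of slope [m] reaches 1 exactly at [a i], and another one falls to 0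
    exactly at [b i]; this matches the half-open side at both endpoints. *)
Lemma tentable_hobox a b : tentable (hobox a b).
Proof.
exists (fun m u => \prod_i (clamp (m%:R * u 0 i + (1 - m%:R * a 0 i)) *
                            clamp (- m%:R * u 0 i + m%:R * b 0 i))); split.
  by move=> m; apply: ucont01_prod => i; apply: ucont01M; exact: ucont01_clamp.
move=> u.
have [N NP] : exists N : nat, forall i m, (N <= m)%N ->
  clamp (m%:R * u 0 i + (1 - m%:R * a 0 i)) = (a 0 i <= u 0 i)%R%:R /\
  clamp (- m%:R * u 0 i + m%:R * b 0 i) = (u 0 i < b 0 i)%R%:R.
  have H i : exists N : nat, forall m, (N <= m)%N ->
      clamp (m%:R * u 0 i + (1 - m%:R * a 0 i)) = (a 0 i <= u 0 i)%R%:R /\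
      clamp (- m%:R * u 0 i + m%:R * b 0 i) = (u 0 i < b 0 i)%R%:R.
    have big (x : R) : 0 < x -> exists N : nat, forall m, (N <= m)%N -> 1 <= m%:R * x.
      move=> x0; exists (Num.truncn x^-1).+1 => m Nm.
      rewrite -ler_pdivrMr// div1r; apply: ltW; apply: lt_le_trans (truncnS_gt _) _.
      by rewrite ler_nat.
    have [N1 H1] : exists N : nat, forall m, (N <= m)%N ->
        clamp (m%:R * u 0 i + (1 - m%:R * a 0 i)) = (a 0 i <= u 0 i)%R%:R.
      have [au|ua] := leP (a 0 i) (u 0 i).
        exists 0%N => m _; rewrite clamp_ge1// addrCA lerDl -mulrBr.
        by rewrite mulr_ge0// subr_ge0.
      have [|N NP] := big (a 0 i - u 0 i); first by rewrite subr_gt0.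
      by exists N => m /NP; rewrite mulrBr => h; rewrite clamp_le0//; lra.
    have [N2 H2] : exists N : nat, forall m, (N <= m)%N ->
        clamp (- m%:R * u 0 i + m%:R * b 0 i) = (u 0 i < b 0 i)%R%:R.
      have [ub|bu] := ltP (u 0 i) (b 0 i).
        have [|N NP] := big (b 0 i - u 0 i); first by rewrite subr_gt0.
        by exists N => m /NP; rewrite mulrBr => h; rewrite clamp_ge1//; lra.
      exists 0%N => m _; rewrite clamp_le0// mulNr addrC -mulrBr.
      by rewrite mulr_ge0_le0// subr_le0.
    exists (maxn N1 N2) => m; rewrite geq_max => /andP[m1 m2].
    by split; [exact: H1|exact: H2].
  have [N NP] := choice H.
  exists (\max_i N i)%N => i m Nm; apply: NP; apply: leq_trans Nm.
  exact: (leq_bigmax i).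
exists N => // m /= Nm.
have [ab|nab] := pselect (hobox a b u).
  rewrite indicE mem_set//; apply: big1 => i _.
  have [-> ->] := NP i m Nm; by have /andP[-> ->] := ab i; rewrite mulr1.
rewrite indicE memNset//; have [i ni] : exists i, ~ (a 0 i <= u 0 i < b 0 i).
  by apply/existsNP.
rewrite (bigD1 i)//=; have [-> ->] := NP i m Nm.
have -> : (a 0 i <= u 0 i)%R%:R * (u 0 i < b 0 i)%R%:R = 0 :> R.
  by move/negP: ni; rewrite negb_and => /orP[]/negbTE ->; rewrite ?mulr0 ?mul0r.
by rewrite mul0r.
Qed.

Lemma tentable0 : tentable set0.
Proof.
exists (fun _ _ => 0); split; last by move=> u; apply: nearW => m; rewrite indicE in_set0.
move=> m; have := ucont01_compl ucont01_1; rewrite (_ : (fun _ => _) = fun=> 0)//.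
by apply/funext => u; rewrite subrr.
Qed.

Lemma tentableU A B : tentable A -> tentable B -> tentable (A `|` B).
Proof.
move=> [f [fP fA]] [g [gP gB]].
exists (fun m u => 1 - (1 - f m u) * (1 - g m u)); split.
  by move=> m; apply: ucont01_compl; apply: ucont01M; exact: ucont01_compl.
move=> u; have := gB u; have := fA u; apply: filterS2 => m -> ->.
rewrite !indicE in_setU; case: (u \in A); case: (u \in B); rewrite /=; ring.
Qed.

Lemma tentable_bigsetU (I : Type) (s : seq I) (F : I -> set V) :
  (forall i, tentable (F i)) -> tentable (\big[setU/set0]_(i <- s) F i).
Proof.
move=> FP; elim: s => [|i s IH]; first by rewrite big_nil; exact: tentable0.
by rewrite big_cons; exact: tentableU.
Qed.

Lemma boxvol_fin (B : set (RnAll R n)) : (boxvol B < +oo)%E ->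
  B = set0 \/ exists a b, B = hobox a b.
Proof.
rewrite /boxvol; case: pselect => ? /=; first by left.
move=> /ereal_inf_lt[_ [[a b] /= [_ ->] _] _]; by right; exists a, b.
Qed.

(** Finitely many boxes of an almost optimal cover nearly fill the part of [A] in [D]; tents for
    their union converge by dominated convergence, [D] having finite measure. *)
Lemma indic_approx (A D : set E) (e : R) : measurable A -> measurable D -> (lebn D < +oo)%E ->
  0 < e -> exists f : V -> R, ucont01 f /\
  (\int[@lebn R n]_(u in D) (`|\1_A u - f (toRV u)|)%:E <= e%:E)%E.
Proof.
(* One [e1] for each half of the symmetric difference of [A] and [U] inside [D], and two for the
   tents. *)
move=> mA mD Doo e0; pose e1 := e / 4.
have e10 : 0 < e1 by rewrite divr_gt0.
have mX : measurable (D `&` A) by exact: measurableI.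
have Xoo : (lebn (D `&` A) < +oo)%E.
  by apply: le_lt_trans Doo; apply: le_measure; rewrite ?inE//; exact: subIsetl.
have Xf : lebn (D `&` A) \is a fin_num by rewrite ge0_fin_numE// measure_ge0.
have [_ [B [_ XB] <-] Be] := lb_ereal_inf_adherent e10 Xf.
(* A cover of finite total volume consists of boxes and empty sets, since [boxvol] is infinite on
   all other sets. *)
have Boo k : (boxvol (B k) < +oo)%E.
  rewrite ltey; apply/eqP => h.
  move: Be; rewrite (eseries_pinfty _ _ h)//; first by rewrite ltNge leey.
  by move=> m _; rewrite -ltNye (lt_le_trans _ (boxvol_ge0 _)).
have mB k : measurable (B k : set E).
  by have [->|[a [b ->]]] := boxvol_fin (Boo k); [exact: measurable0|exact: measurable_hobox].
have tB k : tentable (B k).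
  by have [->|[a [b ->]]] := boxvol_fin (Boo k); [exact: tentable0|exact: tentable_hobox].
have [|K [K1 K2]] := @cover_approx _ (Rn R n) R (@lebn R n) (D `&` A) B e1 e10 mX mB XB Xoo.
  apply: le_trans (ltW Be); apply: lee_nneseries => k _; first by move=> _; exact: measure_ge0.
  exact: lebn_le_boxvol.
pose U : set E := \big[setU/set0]_(k < K) B k.
have mU : measurable U by apply: bigsetU_measurable.
have [psi [psi01 psiU]] : tentable U.
  by rewrite /U; apply: (tentable_bigsetU _ (F := fun k : 'I_K => B k)).
have mpsi m : measurable_fun [set: E] (fun u : E => psi m (toRV u)) by case: (psi01 m).
have AU : (\int[@lebn R n]_(u in D) (`|\1_A u - \1_U u|)%:E <= (2 * e1)%:E)%E.
  apply: (@nnint_indic_diff _ (Rn R n) R (@lebn R n) D A U e1 mD mA mU) => //.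
  apply: le_trans K2; apply: le_measure; rewrite ?inE.
  - by apply: measurableD => //; exact: measurableI.
  - by apply: measurableD => //; exact: measurableI.
  - by move=> u [[Du Uu] nA]; split => // -[_].
have mUpsi k : measurable_fun [set: E] (fun u : E => `|\1_U u - psi k (toRV u)|).
  exact: (@measurable_distr _ (Rn R n) R _ _ (@measurable_indic _ (Rn R n) R setT U mU) (mpsi k)).
have Upsi1 k u : D u -> `|\1_U u - psi k (toRV u)| <= 1.
  have [_ /(_ (toRV u))/andP[h1 h2] _] := psi01 k.
  rewrite indicE => _; move: h1 h2; set x := psi k _ => h1 h2.
  by rewrite ler_norml; case: (u \in U); apply/andP; split; rewrite /=; lra.
have D1 : (\int[@lebn R n]_(u in D) (1 : R)%:E < +oo)%E.
  by rewrite (@integral_cst _ (Rn R n) R (@lebn R n) D mD 1%E) mul1e.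
have e20 : 0 < 2 * e1 by rewrite mulr_gt0.
have cv : {ae @lebn R n, forall u, D u -> (fun k => `|\1_U u - psi k (toRV u)|) @ \oo --> (0 : R)}.
  apply: aeW => u _; apply: cvg_near_cst.
  by have := psiU (toRV u); apply: filterS => k ->; rewrite subrr normr0.
have [m mP] := @nnint_dct _ (Rn R n) R (@lebn R n) D (fun m u => `|\1_U u - psi m (toRV u)|)
  (fun=> 1) mD mUpsi (@measurable_cst _ _ (Rn R n) R D 1) (fun k u => normr_ge0 _) Upsi1 D1 cv _ e20.
exists (psi m); split => //.
have -> : e = 1 * (2 * e1 + 2 * e1) by rewrite /e1; field.
have mAU : measurable_fun [set: E] (fun u : E => `|\1_A u - \1_U u| : R).
  exact: (@measurable_distr _ (Rn R n) R _ _ (@measurable_indic _ (Rn R n) R setT A mA) (@measurable_indic _ (Rn R n) R setT U mU)).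
have mApsi : measurable_fun [set: E] (fun u : E => `|\1_A u - psi m (toRV u)|).
  exact: (@measurable_distr _ (Rn R n) R _ _ (@measurable_indic _ (Rn R n) R setT A mA) (mpsi m)).
refine (@nnint_le_comb _ (Rn R n) R (@lebn R n) D _ (fun u => `|\1_A u - \1_U u|) (fun u => `|\1_U u - psi m (toRV u)|)
  1 (2 * e1) (2 * e1) mD mApsi mAU (mUpsi m) (fun u => normr_ge0 _) (fun u => normr_ge0 _) (fun u => normr_ge0 _) ler01 _ AU mP).
by move=> u _; rewrite mul1r ler_distD.
Qed.

End Tents.

Section Density.
Variables (R : realType) (n : nat) (p : R) (Y : completeNormedModType R[i]).
Hypothesis p1 : 1 <= p.
Local Notation E := (Rn R n).
Local Notation V := 'rV[R]_n.
Implicit Types (F G : V -> Y) (u v : V) (D : set E).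
Local Notation J := (@Lpint R n p Y).

Let p0 : 0 < p. Proof. exact: lt_le_trans p1. Qed.

Definition bucont F := (exists M : R, forall u, nrmY (F u) <= M) /\
  forall e : R, 0 < e -> exists d : R, 0 < d /\
    forall u v, (forall i, `|u 0 i - v 0 i| < d) -> nrmY (F u - F v) < e.

Lemma smeas_bucont F : bucont F -> strongly_measurable F.
Proof.
move=> [_ FC]; apply: smeas_ucont => u e e0; have [d [d0 dP]] := FC e e0.
by exists d; split => // v; exact: dP.
Qed.

Lemma bucont0 : bucont (fun=> 0).
Proof.
split; first by exists 0 => u; rewrite nrmY0.
by move=> e e0; exists 1; split => // u v _; rewrite subrr nrmY0.
Qed.

Lemma bucontD F G : bucont F -> bucont G -> bucont (fun u => F u + G u).
Proof.
move=> [[M FM] FC] [[N GN] GC]; split.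
  by exists (M + N) => u; rewrite (le_trans (nrmYD _ _))// lerD.
move=> e e0; have e20 : 0 < e / 2 by rewrite divr_gt0.
have [d [d0 dP]] := FC _ e20; have [d' [d'0 d'P]] := GC _ e20.
exists (Num.min d d'); split; first by rewrite lt_min d0.
move=> u v uv; rewrite opprD addrACA [ltRHS]splitr (le_lt_trans (nrmYD _ _))// ltrD//.
  by apply: dP => i; have := uv i; rewrite lt_min => /andP[].
by apply: d'P => i; have := uv i; rewrite lt_min => /andP[].
Qed.

Lemma bucontZ (f : V -> R) (y : Y) : ucont01 f -> bucont (fun u => (f u)%:C%C *: y).
Proof.
move=> [_ f01 fC]; split.
  exists (nrmY y) => u; have /andP[h0 h1] := f01 u.
  by rewrite nrmYZr ger0_norm// ler_piMl// nrmY_ge0.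
move=> e e0; have y1 : 0 < nrmY y + 1 by rewrite ltr_wpDl// nrmY_ge0.
have [|d [d0 dP]] := fC (e / (nrmY y + 1)); first by rewrite divr_gt0.
exists d; split => // u v /dP; rewrite ltr_pdivlMr// => h.
rewrite -scalerBl -rmorphB nrmYZr; apply: le_lt_trans h.
by rewrite mulrDr mulr1 lerDl.
Qed.

Definition approximable D F := forall e : R, 0 < e -> exists G, bucont G /\
  (J D (fun u => F u - G u)%R <= e%:E)%E.

Lemma smeasD F G : strongly_measurable F -> strongly_measurable G ->
  strongly_measurable (fun u => F u + G u).
Proof.
move=> sF sG; rewrite (_ : (fun u => _) = fun u => F u - (0 - G u)).
  by apply: smeasB => //; apply: smeasB => //; apply: smeas_bucont; exact: bucont0.
by apply/funext => u; rewrite sub0r opprK.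
Qed.

Lemma approximableD D F G : measurable D -> strongly_measurable F -> strongly_measurable G ->
  approximable D F -> approximable D G -> approximable D (fun u => F u + G u).
Proof.
move=> mD sF sG aF aG e e0; have c0 : 0 < cp p by exact: cp_gt0.
pose e1 := e / (2 * cp p); have e10 : 0 < e1 by rewrite divr_gt0// mulr_gt0.
have [f [bf Jf]] := aF e1 e10; have [g [bg Jg]] := aG e1 e10.
have sf := smeas_bucont bf; have sg := smeas_bucont bg.
exists (fun u => f u + g u); split; first exact: bucontD.
have -> : e = cp p * (e1 + e1) by rewrite /e1; field; rewrite gt_eqF.
apply: (Lpint_tri p1 (smeasD sF sG) (smeasD sf sG) (smeasD sf sg) mD).
  by apply: Lpint_congr Jf => u; rewrite opprD addrACA subrr addr0.
by apply: Lpint_congr Jg => u; rewrite opprD addrACA subrr add0r.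
Qed.

Lemma simple_restrict (A : set E) (s : E -> Y) : measurable A -> lebn_simple s ->
  lebn_simple (fun u : E => (\1_A u : R)%:C%C *: s u).
Proof.
move=> mA [fs ms]; split.
  apply: (@sub_finite_set _ _ (range s `|` [set 0])); last by rewrite finite_setU; split.
  move=> _ [u _ <-] /=; rewrite indicE; case: (u \in A) => /=.
    by left; exists u => //; rewrite scale1r.
  by right; rewrite scale0r.
move=> z; rewrite [X in measurable X](_ : _ = (A `&` s @^-1` [set z]) `|` (~` A `&` [set _ | 0 = z])).
  apply: measurableU; first exact: measurableI.
  by apply: measurableI; [exact: measurableC|exact: measurable_cst_set].
apply/seteqP; split=> u /=; rewrite indicE.
  have [uA|uA] := pselect (A u).
    by rewrite mem_set// scale1r => uz; left.
  by rewrite memNset// scale0r => uz; right.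
move=> [[Au <-]|[nA <-]]; first by rewrite mem_set// scale1r.
by rewrite memNset// scale0r.
Qed.

Lemma simple_indic (A : set E) (y : Y) : measurable A ->
  lebn_simple (fun u : E => (\1_A u : R)%:C%C *: y).
Proof.
move=> mA; apply: (simple_restrict (s := fun=> y)) => //; split.
  apply: (@sub_finite_set _ _ [set y]) => [|]; last exact: finite_set1.
  by move=> _ [u _ <-].
move=> z; exact: measurable_cst_set.
Qed.

Lemma smeas_simple (s : E -> Y) : lebn_simple s -> strongly_measurable (s : V -> Y).
Proof. by move=> ss; apply: (@smeas_ae_cvg _ _ _ (fun=> s)) => // u; exact: cvg_cst. Qed.

(** The difference of [\1_A] and [f] is at most 1 in absolute value, so its [p]-th power is at most
    itself and approximation in L^1 is enough. *)
Lemma approximable_indic D (A : set E) (y : Y) : measurable D -> (lebn D < +oo)%E -> measurable A ->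
  approximable D (fun u => (\1_A (u : E) : R)%:C%C *: y).
Proof.
move=> mD Doo mA e e0; pose c := npow p y + 1.
have c0 : 0 < c by rewrite ltr_wpDl// npow_ge0.
have [f [f01 fe]] := indic_approx mA mD Doo (divr_gt0 e0 c0).
exists (fun u => (f u)%:C%C *: y); split; first exact: bucontZ.
have mf : measurable_fun [set: E] (fun u : E => f (toRV u)) by case: f01.
have mAf : measurable_fun [set: E] (fun u : E => `|\1_A u - f (toRV u)|).
  exact: (@measurable_distr _ (Rn R n) R _ _ (@measurable_indic _ (Rn R n) R setT A mA) mf).
have sI := smeas_simple (simple_indic y mA).
have sf := smeas_bucont (bucontZ y f01).
apply: (@le_trans _ _ (\int[@lebn R n]_(u in D) (c * `|\1_A u - f (toRV u)|)%:E)%E).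
  have mc : measurable_fun [set: E] (fun u : E => c * `|\1_A u - f (toRV u)|).
    exact: (@measurable_funM _ (Rn R n) R setT (fun=> c) _ (@measurable_cst _ _ (Rn R n) R setT c) mAf).
  have le (u : E) : D u -> npow p ((\1_A u : R)%:C%C *: y - (f (toRV u))%:C%C *: y) <= c * `|\1_A u - f (toRV u)|.
    move=> _; rewrite -scalerBl -rmorphB /npow nrmYZr powRM ?nrmY_ge0// mulrC.
    rewrite ler_pM ?powR_ge0//.
      by rewrite /c /npow lerDl.
    have h1 : `|\1_A u - f (toRV u)| <= 1.
      have [_ /(_ (toRV u))/andP[h1 h2] _] := f01; move: h1 h2; rewrite indicE.
      set x := f _ => h1 h2; by rewrite ler_norml; case: (u \in A); apply/andP; split; rewrite /=; lra.
    have [->|x0] := eqVneq (`|\1_A u - f (toRV u)|) 0; first by rewrite powR0// gt_eqF.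
    by rewrite -[leRHS]powRr1// ger_powR// lt0r x0 normr_ge0.
  exact: (@nnint_le _ (Rn R n) R (@lebn R n) D _ (fun u => c * `|\1_A u - f (toRV u)|) mD
    (measurable_npow p (smeasB sI sf)) mc (fun u => npow_ge0 _ _) le).
rewrite (@nnint_scale _ (Rn R n) R (@lebn R n) D _ c mD mAf (fun u => normr_ge0 _) (ltW c0)).
apply: le_trans (lee_wpmul2l _ fe) _; first by rewrite lee_fin ltW.
by rewrite -EFinM lee_fin mulrC divfK// gt_eqF.
Qed.

Lemma approximable_simple D (s : E -> Y) : measurable D -> (lebn D < +oo)%E ->
  lebn_simple s -> approximable D s.
Proof.
move=> mD Doo [fs ms]; have [r rE] := (finite_seqP _).1 fs.
(* [undup] lets each value of [s] occur only once in the sum. *)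
have sE : s = fun u => \sum_(y <- undup r) (\1_(s @^-1` [set y]) u : R)%:C%C *: y.
  apply/funext => u; rewrite (bigD1_seq (s u)) ?undup_uniq//=; last first.
    by rewrite mem_undup; have : [set` r] (s u) by rewrite -rE; exists u.
  rewrite indicE mem_set// scale1r big1 ?addr0// => y ys.
  by rewrite indicE memNset ?scale0r// => /= /eqP; rewrite eq_sym (negbTE ys).
have all t : approximable D (fun u => \sum_(y <- t) (\1_(s @^-1` [set y]) (u : E) : R)%:C%C *: y) /\
    strongly_measurable (fun u : V => \sum_(y <- t) (\1_(s @^-1` [set y]) (u : E) : R)%:C%C *: y).
  elim: t => [|y t [IH1 IH2]].
    rewrite (_ : (fun _ => _) = fun=> 0); last by apply/funext => u; rewrite big_nil.
    split; last by apply: smeas_bucont; exact: bucont0.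
    move=> e e0; exists (fun=> 0); split; first exact: bucont0.
    rewrite /Lpint (_ : (fun _ => _) = fun=> 0%E); first by rewrite integral0 lee_fin ltW.
    by apply/funext => u; rewrite subrr npow0.
  rewrite (_ : (fun _ => _) = fun u : V => (\1_(s @^-1` [set y]) (u : E) : R)%:C%C *: y +
     \sum_(y <- t) (\1_(s @^-1` [set y]) (u : E) : R)%:C%C *: y); last first.
    by apply/funext => u; rewrite big_cons.
  have sI := smeas_simple (simple_indic y (ms y)).
  split; last exact: smeasD.
  exact: (approximableD mD sI IH2 (approximable_indic y mD Doo (ms y)) IH1).
by rewrite sE; exact: (all (undup r)).1.
Qed.

Lemma tcube_compact (t : V) (l : R) : compact (tcube t l : set V).
Proof.
rewrite (_ : (tcube t l : set V) = [set v | forall i, `[t 0 i, t 0 i + l]%classic (v 0 i)]).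
  exact: (@rV_compact R n (fun i => `[t 0 i, t 0 i + l]%classic) (fun i => @segment_compact R _ _)).
by apply/seteqP; split=> u /= H i; have := H i; rewrite /= in_itv.
Qed.

Lemma lebn_tcube_fin (t : V) (l : R) : 0 <= l -> (lebn (tcube t l : set E) < +oo)%E.
Proof. by move=> l0; rewrite (le_lt_trans (lebn_tcube_le _ l0))// ltry. Qed.

(** The simple functions [s k] come without control of their size. Replacing them by 0 where they
    exceed twice the norm of [F] makes the error dominated by [3 ^ p] times the [p]-th power of that
    norm. *)
Lemma approximable_locLp F (t : V) (l : R) : 0 <= l -> strongly_measurable F -> locLp p F ->
  approximable (tcube t l) F.
Proof.
move=> l0 sF lF e e0; set D : set E := tcube t l.
have mD : measurable D by exact: measurable_tcube.
have [s [ss sc]] := sF.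
pose A k : set E := [set: E] `&` [set u : E | nrmY (s k u) <= 2 * nrmY (F (toRV u))].
have mA k : measurable (A k).
  exact: (@measurable_fun_le _ (Rn R n) R setT _ (fun u => 2 * nrmY (F (toRV u)))
    (@measurableT _ (Rn R n)) (measurable_nrmY_simple (ss k))
    (@measurable_funM _ (Rn R n) R setT (fun=> 2) _ (@measurable_cst _ _ (Rn R n) R setT 2) (smeas_nrmY sF))).
pose t_ k (u : E) : Y := (\1_(A k) u : R)%:C%C *: s k u.
have st k : lebn_simple (t_ k) by exact: simple_restrict.
have c0 : 0 < cp p by exact: cp_gt0.
pose e1 := e / (2 * cp p); have e10 : 0 < e1 by rewrite divr_gt0// mulr_gt0.
have [k kP] : exists k, (J D (fun u => F u - t_ k u)%R <= e1%:E)%E.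
  have [_ Foo] := lF _ (@tcube_compact t l).
  have m1 k := measurable_npow p (smeasB sF (smeas_simple (st k))).
  have c30 : 0 <= (3 : R) `^ p by exact: powR_ge0.
  have mF := measurable_npow p sF.
  have mg : measurable_fun [set: E] (fun u : E => (3 : R) `^ p * npow p (F (toRV u))).
    exact: (@measurable_funM _ (Rn R n) R setT (fun=> 3 `^ p) _ (@measurable_cst _ _ (Rn R n) R setT (3 `^ p)) mF).
  have mgD : measurable_fun D (fun u : E => (3 : R) `^ p * npow p (F (toRV u))).
    exact: (measurable_funTS mg).
  have dom k u : D u -> npow p (F (toRV u) - t_ k u) <= 3 `^ p * npow p (F (toRV u)).
    move=> _; rewrite /npow -powRM ?nrmY_ge0//.
    have F0 := nrmY_ge0 (F (toRV u)).
    rewrite ge0_ler_powR ?nnegrE ?(ltW p0) ?nrmY_ge0 ?mulr_ge0//.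
    rewrite (le_trans (nrmYB _ _))// /t_ indicE.
    have [uA|uA] := pselect (A k u); last by rewrite memNset// scale0r nrmY0; lra.
    by rewrite mem_set// scale1r; have [_ /=] := uA; lra.
  have Ig : (\int[@lebn R n]_(u in D) (3 `^ p * npow p (F (toRV u)))%:E < +oo)%E.
    rewrite (@nnint_scale _ (Rn R n) R (@lebn R n) D _ (3 `^ p) mD mF (fun u => npow_ge0 _ _) c30).
    by rewrite lte_mul_pinfty// ?lee_fin.
  have cv : {ae @lebn R n, forall u, D u -> (fun k => npow p (F (toRV u) - t_ k u)) @ \oo --> (0 : R)}.
    apply: filterS sc => u /cvgYP su _; apply/cvgrPdist_lt => d d0.
    have d'0 : 0 < d `^ p^-1 by exact: powR_gt0.
    (* Where [F] vanishes, the truncation makes all [t_ k] vanish too. Elsewhere [s k] is eventually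
       closer to [F] than the norm of [F], which puts the point in [A k]. *)
    have [F0|F0] := eqVneq (nrmY (F (toRV u))) 0.
      apply: nearW => k; rewrite sub0r normrN (nrmY_eq0 F0) sub0r.
      have -> : t_ k u = 0.
        rewrite /t_ indicE; have [uA|uA] := pselect (A k u); last by rewrite memNset// scale0r.
        rewrite mem_set// scale1r; apply: nrmY_eq0; apply/eqP; rewrite eq_le nrmY_ge0 andbT.
        by have [_ /=] := uA; rewrite F0 mulr0.
      by rewrite oppr0 npow0// normr0.
    have Fp : 0 < nrmY (F (toRV u)) by rewrite lt0r F0 nrmY_ge0.
    have := su _ d'0; have := su _ Fp; apply: filterS2 => k k1 k2.
    have -> : t_ k u = s k u.
      rewrite /t_ indicE mem_set ?scale1r//; split => //=.
      have := nrmY_tri (F (toRV u)) (s k u) 0; rewrite !subr0 nrmYC; lra.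
    rewrite sub0r normrN ger0_norm ?npow_ge0// /npow.
    have -> : d = (d `^ p^-1) `^ p by rewrite -powRrM mulVf ?gt_eqF// powRr1// ltW.
    by rewrite gt0_ltr_powR// nnegrE ?nrmY_ge0// ltW.
  exact: (@nnint_dct _ (Rn R n) R (@lebn R n) D _ _ mD m1 mgD (fun k u => npow_ge0 _ _) dom Ig cv e1 e10).
have [G [bG GP]] := approximable_simple mD (lebn_tcube_fin t l0) (st k) e10.
exists G; split => //.
have -> : e = cp p * (e1 + e1) by rewrite /e1; field; rewrite gt_eqF.
exact: (Lpint_tri p1 sF (smeas_simple (st k)) (smeas_bucont bG) mD kP GP).
Qed.

End Density.

(** * Almost periods and Bohr sets *)

Section Covering.
Variables (R : realType) (n : nat).
Local Notation E := (Rn R n).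
Local Notation V := 'rV[R]_n.

(** Along each axis a cube of side [T] is covered by at most [T / h + 2] cells, which is at most
    [3 T / h] as [h <= T]. Bounds on cells thus give bounds at every scale above the mesh. *)
Lemma grid_cover (h T : R) (t : V) (f : E -> R) (B : R) : 0 < h -> h <= T ->
  measurable_fun [set: E] f -> (forall u, 0 <= f u) -> 0 <= B ->
  (forall a : V, flr h a = a -> (\int[@lebn R n]_(u in (cell h a : set E)) (f u)%:E <= B%:E)%E) ->
  (\int[@lebn R n]_(u in tcube t T) (f u)%:E <= (B * (3 * T / h) ^+ n)%:E)%E.
Proof.
move=> h0 hT mf f0 B0 fB.
pose N := (Num.truncn (T / h)).+2.
pose pt (k : {ffun 'I_n -> 'I_N}) : V := \row_i (h * (Num.floor (t 0 i / h) + (k i : nat)%:Z)%:~R).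
have ptE k : flr h (pt k) = pt k.
  by apply: cell_flr => // i; rewrite !mxE lexx ltrDl.
have Th0 : 0 <= T / h by rewrite divr_ge0// ltW// (lt_le_trans h0).
have cov : tcube t T `<=` \big[setU/set0]_(k <- enum {ffun 'I_n -> 'I_N}) (cell h (pt k) : set E).
  move=> u tu.
  have kP i : exists k : 'I_N, Num.floor (u 0 i / h) = Num.floor (t 0 i / h) + (k : nat)%:Z.
    have /andP[h1 h2] := tu i; rewrite /toRV in h1 h2.
    have le1 : Num.floor (t 0 i / h) <= Num.floor (u 0 i / h).
      by apply: le_floor; rewrite ler_pM2r ?invr_gt0.
    have le2 : Num.floor (u 0 i / h) < Num.floor (t 0 i / h) + N%:Z.
      rewrite -(ltr_int R) (le_lt_trans (floor_le _))//.
      apply: (@le_lt_trans _ _ (t 0 i / h + T / h)); first by rewrite -mulrDl ler_pM2r ?invr_gt0.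
      have h3 : t 0 i / h < (Num.floor (t 0 i / h))%:~R + 1 by rewrite -[1]/(1%:~R) -rmorphD floorD1_gt.
      have h4 : T / h < (Num.truncn (T / h)).+1%:R by exact: truncnS_gt.
      rewrite rmorphD/= /N -pmulrn -[_.+2]addn1 natrD; lra.
    move: le1 le2; set x := Num.floor (u 0 i / h); set y := Num.floor (t 0 i / h) => le1 le2.
    have kN : (`|x - y| < N)%N by lia.
    by exists (Ordinal kN) => /=; lia.
  have [k kE] := choice kP.
  have : cell h (pt (finfun k)) u.
    have -> : pt (finfun k) = flr h u; last exact: flr_cell.
    by apply/rowP => i; rewrite !mxE ffunE kE.
  by move=> cu; rewrite -bigcup_seq; exists (finfun k) => //=; rewrite mem_enum.
have mcell k : measurable (cell h (pt k) : set E) by exact: measurable_hobox.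
apply: le_trans (@nnint_cover _ (Rn R n) R (@lebn R n) _ _ (fun k => cell h (pt k) : set E) (tcube t T) f
   mcell (measurable_tcube _ _) mf f0 cov) _.
apply: (@le_trans _ _ (\sum_(k <- enum {ffun 'I_n -> 'I_N}) B%:E)%E).
  by apply: lee_sum => k _; exact: fB.
rewrite sumEFin lee_fin big_const_seq count_predT -cardE card_ffun !card_ord iter_addr_0.
rewrite -[leLHS]mulr_natr ler_wpM2l// natrX lerXn2r ?nnegrE//.
  by rewrite divr_ge0 ?mulr_ge0 ?(ltW h0)// ltW// (lt_le_trans h0).
have h1 : 1 <= T / h by rewrite ler_pdivlMr// mul1r.
have := truncn_le (T / h); rewrite Th0 => h2.
rewrite /N -addn2 natrD -mulrA; lra.
Qed.

End Covering.

Section Almost_periods.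
Variables (R : realType) (n : nat) (p : R) (Y : completeNormedModType R[i]).
Hypothesis p1 : 1 <= p.
Local Notation E := (Rn R n).
Local Notation V := 'rV[R]_n.
Local Notation J := (@Lpint R n p Y).
Variable F : V -> Y.
Hypothesis sF : strongly_measurable F.

Let c := cp p.
Let c0 : 0 < c. Proof. exact: cp_gt0. Qed.
Let c1 : 1 <= c. Proof. exact: cp_ge1. Qed.

Definition aperiod (l e : R) (h : V) := forall t : V,
  (J (tcube t l) (fun u => F (h + u) - F u)%R <= (e * l ^+ n)%:E)%E.

Lemma Lpint_tri_scaled (D : set E) (f g k : V -> Y) (a b L : R) :
  strongly_measurable f -> strongly_measurable g -> strongly_measurable k -> measurable D ->
  (J D (fun u => f u - g u)%R <= (a * L)%:E)%E ->
  (J D (fun u => g u - k u)%R <= (b * L)%:E)%E ->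
  (J D (fun u => f u - k u)%R <= (c * (a + b) * L)%:E)%E.
Proof.
move=> sf sg sk mD h1 h2; rewrite -mulrA mulrDl; exact: (Lpint_tri p1 sf sg sk mD h1 h2).
Qed.

Lemma aperiod0 l a : 0 < l -> 0 <= a -> aperiod l a 0.
Proof.
move=> l0 a0 t; rewrite /Lpint (_ : (fun _ => _) = fun=> 0%E).
  by rewrite integral0 lee_fin mulr_ge0// exprn_ge0// ltW.
by apply/funext => u; rewrite add0r subrr npow0.
Qed.

(** The bound for [h] holds on every cube, in particular on the one shifted by [k]. *)
Lemma aperiodD l a b h k : aperiod l a h -> aperiod l b k -> aperiod l (c * (a + b)) (h + k).
Proof.
move=> ga gb t; have mt : measurable (tcube t l : set E) by exact: measurable_tcube.
apply: (@Lpint_tri_scaled _ (fun u => F (h + k + u)) (fun u => F (k + u)) F a b _ _ _ _ mt) => //.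
- exact: smeas_trans.
- exact: smeas_trans.
have := ga (k + t); rewrite -(@Lpint_tcube R n p Y k t l (fun u => F (h + u) - F u)).
  by apply: Lpint_congr => u; rewrite addrA.
by apply: smeasB => //; exact: smeas_trans.
Qed.

Lemma aperiodN l a h : aperiod l a h -> aperiod l a (- h).
Proof.
move=> ga t; have := ga (- h + t).
rewrite Lpint_sym -(@Lpint_tcube R n p Y (- h) t l (fun u => F u - F (h + u))).
  by apply: Lpint_congr => u; rewrite addNKr.
by apply: smeasB => //; exact: smeas_trans.
Qed.

Definition dense_aperiods l L e := forall t0 : V, exists tau : V, eball t0 L tau /\ aperiod l e tau.

Lemma eball_coord (t0 tau : V) L i : eball t0 L tau -> `|tau 0 i - t0 0 i| <= L.
Proof.
move=> /ltW; apply: le_trans; rewrite -sqrtr_sqr ler_wsqrtr//.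
by rewrite (bigD1 i)//= lerDl sumr_ge0// => j _; exact: sqr_ge0.
Qed.

Hypothesis lF : locLp p F.

(** Lower corner of one fixed cube containing all cubes of side [l] whose corners have coordinates
    at most [L] in absolute value. *)
Definition around (L : R) : V := \row_i (- L).

Lemma tcube_around (L l : R) (x : V) : (forall i, `|x 0 i| <= L) ->
  tcube x l `<=` (tcube (around L) (2 * L + l) : set E).
Proof.
move=> xL u ux i; have := ux i; have := xL i.
by rewrite /toRV mxE ler_norml => /andP[a b] /andP[d e]; apply/andP; split; lra.
Qed.

(* [C_small], [C_step], [C_net], [C_grid], [C_axis] and [C_bohr] depend only on [n]
   and [p]; their shape records how often the quasi-triangle inequality is used. *)
Definition C_small := c * (1 + c * (3 * c ^+ 2 + 1)).

(* An almost period brings any cube of side [l] near the origin, where [F] is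
   close to a uniformly continuous function. *)
Lemma aperiod_small l L e : 0 < l -> 0 < L -> 0 < e -> dense_aperiods l L e ->
  exists d : R, 0 < d /\ forall h : V, (forall i, `|h 0 i| <= d) -> aperiod l (C_small * e) h.
Proof.
move=> l0 L0 e0 per.
have ln0 : 0 < l ^+ n by exact: exprn_gt0.
have el0 : 0 < e * l ^+ n by rewrite mulr_gt0.
(* The extra 1 leaves room for the shift by [h], whose coordinates will be at most 1. *)
pose D : set E := tcube (around (L + 1)) (2 * (L + 1) + l).
have mD : measurable D by exact: measurable_tcube.
have D0 : 0 <= 2 * (L + 1) + l by rewrite addr_ge0 ?mulr_ge0 ?addr_ge0// ltW.
have [phi [bphi Jphi]] := approximable_locLp p1 (around (L + 1)) D0 sF lF el0.
have sphi := smeas_bucont bphi.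
have [_ /(_ (e `^ p^-1))] := bphi; rewrite powR_gt0// => /(_ isT)[d [d0 dP]].
pose d' := Num.min (d / 2) 1; have d'0 : 0 < d' by rewrite lt_min divr_gt0//=.
have mphi (h u : V) : (forall i, `|h 0 i| <= d') -> npow p (phi (h + u) - phi u) <= e.
  move=> hd; have -> : e = (e `^ p^-1) `^ p.
    by rewrite -powRrM mulVf ?powRr1 ?(ltW e0)// gt_eqF// (lt_le_trans _ p1).
  apply: npow_le => //; apply/ltW/dP => i; rewrite !mxE addrK (le_lt_trans (hd i))//.
  by rewrite gt_min ltr_pdivrMr// mulr2n mulrDr mulr1 ltrDl d0.
exists d'; split => // h hd.
have h1 i : `|h 0 i| <= 1 by rewrite (le_trans (hd i))// ge_min lexx orbT.
have Jsub (x : V) : (forall i, `|x 0 i| <= L + 1) ->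
    (J (tcube x l) (fun u => F u - phi u)%R <= (e * l ^+ n)%:E)%E.
  move=> xL; apply: le_trans Jphi; apply: Lpint_subset => //; [exact: smeasB|exact: measurable_tcube|].
  exact: tcube_around.
have local (x : V) : (forall i, `|x 0 i| <= L) ->
    (J (tcube x l) (fun u => F (h + u) - F u)%R <= (3 * c ^+ 2 * e * l ^+ n)%:E)%E.
  move=> xL; have mx : measurable (tcube x l : set E) by exact: measurable_tcube.
  have j1 : (J (tcube x l) (fun u => F (h + u) - phi (h + u))%R <= (e * l ^+ n)%:E)%E.
    rewrite (@Lpint_tcube R n p Y h x l (fun u => F u - phi u)); last exact: smeasB.
    by apply: Jsub => i; rewrite mxE (le_trans (ler_normD _ _))// addrC lerD.
  have j2 : (J (tcube x l) (fun u => phi (h + u) - phi u)%R <= (e * l ^+ n)%:E)%E.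
    apply: Lpint_tcube_le => //; [|exact: ltW|exact: ltW|by move=> u _; exact: mphi].
    by apply: smeasB => //; exact: smeas_trans.
  have j3 : (J (tcube x l) (fun u => phi u - F u)%R <= (e * l ^+ n)%:E)%E.
    by rewrite Lpint_sym; apply: Jsub => i; rewrite (le_trans (xL i))// lerDl.
  have sFh := smeas_trans h sF; have sph := smeas_trans h sphi.
  have j4 := Lpint_tri_scaled sph sphi sF mx j2 j3.
  apply: le_trans (Lpint_tri_scaled sFh sph sF mx j1 j4) _.
  rewrite lee_fin ler_pM2r//.
  have -> : c * (e + c * (e + e)) = c * e + 2 * c ^+ 2 * e by ring.
  have : c * e <= c ^+ 2 * e by rewrite ler_wpM2r ?(ltW e0)// expr2 ler_peMr// ltW.
  lra.
move=> t; have mt : measurable (tcube t l : set E) by exact: measurable_tcube.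
(* With [tau] near [- t], the cube at [tau + t] lies near the origin and [local] applies. *)
have [tau [tb tg]] := per (- t).
have sh := smeas_trans h sF; have st := smeas_trans tau sF.
have sht := smeas_trans h st.
have j1 : (J (tcube t l) (fun u => F (h + u) - F (tau + (h + u)))%R <= (e * l ^+ n)%:E)%E.
  rewrite (@Lpint_tcube R n p Y h t l (fun u => F u - F (tau + u))); last exact: smeasB.
  by rewrite Lpint_sym; exact: tg.
have j2 : (J (tcube t l) (fun u => F (tau + (h + u)) - F (tau + u))%R <= (3 * c ^+ 2 * e * l ^+ n)%:E)%E.
  have := local (tau + t); rewrite -(@Lpint_tcube R n p Y tau t l (fun u => F (h + u) - F u)); last exact: smeasB.
  move=> H; apply: Lpint_congr (H _); first by move=> u; rewrite addrCA.
  by move=> i; have := eball_coord i tb; rewrite !mxE opprK.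
have j3 := Lpint_tri_scaled sht st sF mt j2 (tg t).
apply: le_trans (Lpint_tri_scaled sh sht sF mt j1 j3) _.
rewrite lee_fin ler_pM2r// /C_small; by rewrite le_eqVlt; apply/orP; left; apply/eqP; ring.
Qed.

End Almost_periods.

Section Step_approximation.
Variables (R : realType) (n : nat) (p : R) (Y : completeNormedModType R[i]).
Hypothesis p1 : 1 <= p.
Local Notation E := (Rn R n).
Local Notation V := 'rV[R]_n.
Local Notation J := (@Lpint R n p Y).
Variable F : V -> Y.
Hypothesis sF : strongly_measurable F.
Hypothesis lF : locLp p F.
Local Notation c := (cp p).

(** As [l] is a multiple of [h], each cell of the coarse grid is a union of cells of the fine
    one. *)
Lemma flr_refine (h l : R) (q : nat) (t : V) : 0 < h -> (0 < q)%N -> l = h * q%:R ->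
  flr l (flr h t) = flr l t.
Proof.
move=> h0 q0 lE; have qR : 0 < q%:R :> R by rewrite ltr0n.
have l0 : 0 < l by rewrite lE mulr_gt0.
apply/rowP => i; rewrite !mxE; congr (_ * _%:~R); apply: floor_def.
have /andP[h1 h2] := floor_itv (t 0 i / l).
have /andP[h3 h4] := floor_itv (t 0 i / h).
apply/andP; split; last first.
  apply: le_lt_trans h2; rewrite ler_pM2r ?invr_gt0//.
  by rewrite mulrC -ler_pdivlMr.
rewrite ler_pdivlMr// lE mulrCA ler_pM2l//.
have -> : q%:R = q%:Z%:~R :> R by [].
rewrite -rmorphM/= ler_int floor_ge_int rmorphM/= ler_pdivlMr// -mulrA [_ * h]mulrC -[h * _]/(h * q%:R) -lE.
by rewrite -ler_pdivlMr.
Qed.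

Lemma cell_flrE (h : R) (a u : V) : 0 < h -> flr h a = a -> cell h a u -> flr h u = a.
Proof. by move=> h0 <-; exact: cell_flr. Qed.

Lemma cell_tcube (h : R) (a : V) : (cell h a : set E) `<=` tcube a h.
Proof. by move=> u H i; have := H i; rewrite mxE => /andP[-> /ltW ->]. Qed.

Definition C_step := c * (c * (1 + C_small p) + c * (1 + 1)).

(* On the cube of the [l]-grid with corner [a], [G] is a translate, by an almost
   period bringing this cube near the origin, of the discretization of one
   uniformly continuous function. *)
Lemma step_approx (l L e d0 : R) : 0 < l -> 0 < L -> 0 < e -> 0 < d0 -> dense_aperiods p F l L e ->
  exists (h : R) (q : nat) (G : V -> Y), [/\ 0 < h <= d0, (0 < q)%N /\ l = h * q%:R,
    (forall u, G (flr h u) = G u), (exists M : R, forall u, nrmY (G u) <= M) &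
    forall a, flr l a = a -> (J (cell l a) (fun u => F u - G u)%R <= (C_step * e * l ^+ n)%:E)%E].
Proof.
move=> l0 L0 e0 d00 per.
have c0 : 0 < c by exact: cp_gt0.
have ln0 : 0 < l ^+ n by exact: exprn_gt0.
have el0 : 0 < e * l ^+ n by rewrite mulr_gt0.
pose D : set E := tcube (around n (L + 1)) (2 * (L + 1) + l).
have mD : measurable D by exact: measurable_tcube.
have D0 : 0 <= 2 * (L + 1) + l by rewrite addr_ge0 ?mulr_ge0 ?addr_ge0// ltW.
have [phi [bphi Jphi]] := approximable_locLp p1 (around n (L + 1)) D0 sF lF el0.
have sphi := smeas_bucont bphi.
have [[M phiM] /(_ (e `^ p^-1))] := bphi; rewrite powR_gt0// => /(_ isT)[d [dgt0 dP]].
have [ds [ds0 dsP]] := aperiod_small p1 sF lF l0 L0 e0 per.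
pose m := Num.min (Num.min d0 ds) (Num.min (d / 2) 1).
have m0 : 0 < m by rewrite !lt_min d00 ds0 ltr01 divr_gt0.
(* Rounding the quotient up makes [h] an exact divisor of [l] that is at most [m]. *)
pose q := (Num.truncn (l / m)).+1; pose h := l / q%:R.
have q0 : 0 < q%:R :> R by rewrite ltr0n.
have h0 : 0 < h by rewrite divr_gt0.
have lE : l = h * q%:R by rewrite /h divfK// gt_eqF.
have hm : h <= m.
  rewrite /h ler_pdivrMr// mulrC -ler_pdivrMr//; apply: ltW; exact: truncnS_gt.
have [hd0 hds hd h1] : [/\ h <= d0, h <= ds, h <= d / 2 & h <= 1].
  by move: hm; rewrite !le_min => /andP[/andP[-> ->] /andP[-> ->]].
have [tau tauP] := choice (fun a : V => per (- a)).
(* Translation by a grid vector maps cells to cells, which makes [G] constant on them; the rounding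
   error is a small vector and hence an almost period. *)
pose tau' a := flr h (tau a).
pose G t := phi (flr h (t + tau' (flr l t))).
have shift u a : flr h (u + flr h a) = flr h u + flr h a by exact: flrD.
have gG u : G (flr h u) = G u.
  by rewrite /G (flr_refine _ h0 _ lE)// !shift flr_flr.
exists h, q, G; split => //; first by rewrite h0.
  by exists M => u; exact: phiM.
move=> a aE; have ma : measurable (tcube a l : set E) by exact: measurable_tcube.
have mca : measurable (cell l a : set E) by exact: measurable_hobox.
pose g u := phi (flr h u); have sg : strongly_measurable g.
  by apply: (smeas_grid h0) => u; rewrite /g flr_flr.
have sG : strongly_measurable G by exact: (smeas_grid h0).
have sgt := smeas_trans (tau' a) sg; have sFt := smeas_trans (tau' a) sF.
have spt := smeas_trans (tau' a) sphi.
have -> : J (cell l a) (fun u => F u - G u)%R = J (cell l a) (fun u => F u - g (tau' a + u))%R.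
  apply: Lpint_ext => u cu; by rewrite /G /g (cell_flrE l0 aE cu) [u + _]addrC.
have sFg : strongly_measurable (fun u => F u - g (tau' a + u)) by exact: smeasB.
apply: le_trans (Lpint_subset p sFg mca ma (@cell_tcube l a)) _.
have [tb tg] := tauP a.
have dist i : `|tau' a 0 i - tau a 0 i| <= h by rewrite distrC flr_dist.
have gt' : aperiod p F l (c * (e + C_small p * e)) (tau' a).
  have -> : tau' a = tau a + (tau' a - tau a) by rewrite addrC subrK.
  by apply: aperiodD => //; apply: dsP => i; rewrite mxE [X in _ + X]mxE (le_trans (dist i)).
have j1 : (J (tcube a l) (fun u => F u - F (tau' a + u))%R <= (c * (e + C_small p * e) * l ^+ n)%:E)%E.
  by rewrite Lpint_sym; exact: gt'.
have j2 : (J (tcube a l) (fun u => F (tau' a + u) - phi (tau' a + u))%R <= (e * l ^+ n)%:E)%E.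
  rewrite (@Lpint_tcube R n p Y (tau' a) a l (fun u => F u - phi u)); last exact: smeasB.
  apply: le_trans Jphi; apply: Lpint_subset => //; [exact: smeasB|exact: measurable_tcube|].
  apply: tcube_around => i; have d1 := dist i.
  have d2 : `|tau a 0 i + a 0 i| <= L by have := eball_coord i tb; rewrite mxE opprK.
  rewrite mxE; set x := tau' a 0 i in d1 *; set y := tau a 0 i in d1 d2.
  have -> : x + a 0 i = (y + a 0 i) + (x - y) by ring.
  by rewrite (le_trans (ler_normD _ _))// lerD// (le_trans d1).
have j3 : (J (tcube a l) (fun u => phi (tau' a + u) - g (tau' a + u))%R <= (e * l ^+ n)%:E)%E.
  apply: Lpint_tcube_le => //; [exact: smeasB|exact: ltW|exact: ltW|].
  move=> u _; have -> : e = (e `^ p^-1) `^ p.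
    by rewrite -powRrM mulVf ?powRr1 ?(ltW e0)// gt_eqF// (lt_le_trans _ p1).
  apply: npow_le => //; apply/ltW/dP => i; rewrite (le_lt_trans (flr_dist _ _ h0))//.
  by rewrite (le_lt_trans hd)// ltr_pdivrMr// mulr2n mulrDr mulr1 ltrDl.
have j4 := Lpint_tri_scaled p1 sFt spt sgt ma j2 j3.
apply: le_trans (Lpint_tri_scaled p1 sF sFt sgt ma j1 j4) _.
by rewrite lee_fin ler_pM2r// /C_step le_eqVlt; apply/orP; left; apply/eqP; ring.
Qed.

Lemma step_approx_cube (l h e T : R) (G : V -> Y) (t : V) : 0 < l -> 0 < h -> 0 < e ->
  l <= T -> (forall u, G (flr h u) = G u) ->
  (forall a, flr l a = a -> (J (cell l a) (fun u => F u - G u)%R <= (C_step * e * l ^+ n)%:E)%E) ->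
  (J (tcube t T) (fun u => F u - G u)%R <= (3 ^+ n * C_step * e * T ^+ n)%:E)%E.
Proof.
move=> l0 h0 e0 lT gG HG.
have sG : strongly_measurable G by exact: (smeas_grid h0).
have c0 : 0 < c by exact: cp_gt0.
have c0' := ltW c0; have cc := sqr_ge0 c.
have C_small_ge0 : 0 <= C_small p by rewrite /C_small mulr_ge0// addr_ge0// mulr_ge0// addr_ge0// mulr_ge0.
have C_step_ge0 : 0 <= C_step by rewrite /C_step mulr_ge0// addr_ge0// mulr_ge0// addr_ge0.
have B0 : 0 <= C_step * e * l ^+ n by apply: mulr_ge0; [apply: mulr_ge0 => //; exact: ltW|apply: exprn_ge0; exact: ltW].
apply: le_trans (grid_cover t l0 lT (measurable_npow p (smeasB sF sG)) (fun u => npow_ge0 _ _) B0 HG) _.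
rewrite lee_fin le_eqVlt; apply/orP; left; apply/eqP.
rewrite !exprMn exprVn; field.
by rewrite expf_neq0// gt_eqF.
Qed.

End Step_approximation.

Section Bohr_set.
Variables (R : realType) (n : nat) (p : R) (Y : completeNormedModType R[i]).
Hypothesis p1 : 1 <= p.
Local Notation V := 'rV[R]_n.
Variable F : V -> Y.
Hypothesis sF : strongly_measurable F.
Hypothesis lF : locLp p F.
Local Notation c := (cp p).

Definition C_net := c * (c * (1 + 1) + C_small p).
Definition C_grid := c * (c * (c * (C_net + C_net) + C_net) + C_net).
Definition C_axis := c * (C_grid + C_small p).

Lemma pi_le4 : pi <= 4 :> R.
Proof. by have [/andP[_ h] _] := pihalf_02_cos_pihalf R; lra. Qed.

(** Let [r] be the distance, with sign, from [w] to a nearest integer. The angle [2 pi |r|] lies in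
    [[0, pi]], where the cosine decreases, and it equals [pi / 8] for [|r| = 1 / 16]. *)
Lemma round_phase (w : R) : cos (pi / 8) < cos (pi *+ 2 * w) ->
  exists (x : int) (r : R), w = x%:~R + r /\ `|r| <= 1 / 16.
Proof.
move=> h; exists (Num.floor (w + 1 / 2)), (w - (Num.floor (w + 1 / 2))%:~R).
split; first by rewrite addrC subrK.
have /andP[h1 h2] := floor_itv (w + 1 / 2).
set x := Num.floor _ in h1 h2 *; set r := w - x%:~R.
have r1 : `|r| <= 1 / 2.
  by move: h2; rewrite rmorphD/= => h2; rewrite ler_norml /r; apply/andP; split; lra.
rewrite leNgt; apply/negP => hr; move: h; apply/negP; rewrite -leNgt.
have -> : cos (pi *+ 2 * w) = cos (pi *+ 2 * `|r|).
  have -> : pi *+ 2 * w = pi *+ 2 * r + pi *+ 2 * x%:~R by rewrite -mulrDr /r subrK.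
  rewrite cosD2piz; have [r0|r0] := leP 0 r; first by rewrite ger0_norm.
  by rewrite ltr0_norm// mulrN cosN.
have p0 := pi_gt0 R.
have q1 : pi * (1 / 16) <= pi * `|r| by rewrite ler_pM2l// ltW.
have q2 : pi * `|r| <= pi * (1 / 2) by rewrite ler_pM2l.
have -> : pi *+ 2 * `|r| = 2 * (pi * `|r|) by ring.
rewrite leNgt ltr_cos -?leNgt; first by lra.
- by rewrite in_itv/=; apply/andP; split; lra.
- by rewrite in_itv/=; apply/andP; split; lra.
Qed.

(* Bogolyubov's lemma is applied to the almost periods in the lattice generated
   by [d e_i]; the additional frequency [None] forces [y] to be close to it. *)
Lemma axis_bohr i (l L e : R) : 0 < l -> 0 < L -> 0 < e -> dense_aperiods p F l L e ->
  exists (I : finType) (om : I -> R), forall y : R, (forall j, cos (pi / 8) < cos (om j * y)) ->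
    aperiod p F l (C_axis * e) (y *: delta_mx 0 i).
Proof.
move=> l0 L0 e0 per.
have [d [d0 dP]] := aperiod_small p1 sF lF l0 L0 e0 per.
pose ei (x : int) : V := (d * x%:~R) *: delta_mx 0 i.
have eiD x z : ei (x + z) = ei x + ei z by rewrite /ei rmorphD/= mulrDr scalerDl.
have eiN x : ei (- x) = - ei x by rewrite /ei rmorphN/= mulrN scaleNr.
have [tau tauP] := choice (fun x : int => per (ei x)).
(* Up to [d] there are only finitely many offsets of [tau x] from the lattice point [ei x], and two
   lattice points with nearly equal offsets differ by an almost period. *)
have [|K [s sP]] := @finite_net R int 'I_n (fun j x => tau x 0 j - ei x 0 j) L d d0.
  by move=> j x; apply: eball_coord; case: (tauP x).
pose A z := aperiod p F l (C_net * e) (ei z).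
have covA x : exists k, A (x - s k).
  have [k kP] := sP x; exists k; rewrite /A eiD eiN.
  have -> : ei x - ei (s k) = (tau x - tau (s k)) + ((ei x - tau x) - (ei (s k) - tau (s k))).
    by apply/rowP => j; rewrite !mxE; ring.
  have -> : C_net * e = c * (c * (e + e) + C_small p * e) by rewrite /C_net; ring.
  apply: (aperiodD p1 sF (aperiodD p1 sF (tauP x).2 (aperiodN sF (tauP (s k)).2))).
  apply: dP => j; have := kP j; rewrite distrC => /ltW; congr (`|_| <= _).
  by rewrite !mxE; ring.
have [q [th [th01 thP]]] := @bogolyubov R A K s covA.
exists (option 'I_q), (fun o => if o is Some j then pi *+ 2 * th j / d else pi *+ 2 / d) => y yP.
have := yP None; rewrite mulrAC => h; rewrite -mulrA in h.
have [x [r [xr r16]]] := round_phase h.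
have p0 := pi_gt0 R; have p4 := pi_le4.
have yE : y = d * x%:~R + d * r by rewrite -mulrDr -xr mulrC divfK// gt_eqF.
have c8 : 1 - pi / 8 <= cos (pi / 8 : R).
  have := cos_lip 0 (pi / 8 : R); rewrite cos0 sub0r normrN [leRHS]ger0_norm ?divr_ge0 ?(ltW p0)//.
  by rewrite ler_norml => /andP[_]; lra.
have [|a [b [a' [b' [Aa Ab Aa' Ab' xE]]]]] := thP x.
  move=> j; have := yP (Some j).
  have /andP[t0 t1] := th01 j.
  have -> : pi *+ 2 * th j / d * y = pi *+ 2 * th j * x%:~R + pi *+ 2 * th j * r.
    by rewrite yE; field; rewrite gt_eqF.
  set u := pi *+ 2 * th j * x%:~R; set v := pi *+ 2 * th j * r => h1.
  have := cos_lip (u + v) u; rewrite addrAC subrr add0r => h2.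
  (* Replacing [y] by [d x] changes each phase by at most [pi / 8]. As [cos (pi / 8) >= 1 - pi / 8],
     the new cosine exceeds [1 - pi / 4 >= 0], as Bogolyubov's lemma requires. *)
  have hv : `|v| <= pi / 8.
    have pth : 0 <= pi *+ 2 * th j by rewrite mulr_ge0// mulr2n addr_ge0// ltW.
    rewrite /v normrM (ger0_norm pth).
    have h5 : th j * `|r| <= 1 * (1 / 16) by apply: ler_pM.
    have h6 : pi * (th j * `|r|) <= pi * (1 * (1 / 16)) by rewrite ler_pM2l.
    have -> : pi *+ 2 * th j * `|r| = 2 * (pi * (th j * `|r|)) by ring.
    lra.
  by move: h2; rewrite ler_norml => /andP[h2 h3]; lra.
have gx : aperiod p F l (C_grid * e) (ei x).
  rewrite xE !eiD !eiN.
  have -> : C_grid * e = c * (c * (c * (C_net * e + C_net * e) + C_net * e) + C_net * e) by rewrite /C_grid; ring.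
  exact: (aperiodD p1 sF (aperiodD p1 sF (aperiodD p1 sF Aa Ab) (aperiodN sF Aa')) (aperiodN sF Ab')).
rewrite yE scalerDl.
have -> : C_axis * e = c * (C_grid * e + C_small p * e) by rewrite /C_axis; ring.
apply: (aperiodD p1 sF gx); apply: dP => j; rewrite !mxE normrM.
have dr : `|d * r| <= d.
  by rewrite normrM gtr0_norm// ler_piMr ?(ltW d0)// (le_trans r16)//; lra.
apply: le_trans dr; rewrite ler_piMr//.
by case: (_ && _); rewrite ?normr1 ?normr0.
Qed.

Definition C_bohr := iter n (fun x => c * (C_axis + x)) 0.

(** A frequency along axis [i] sees only the coordinate [i] of [v]. The conditions for all axes
    together make each axis component of [v] an almost period, and [v] is the sum of these [n]
    components. *)
Lemma bohr_aperiod (l L e : R) : 0 < l -> 0 < L -> 0 < e -> dense_aperiods p F l L e ->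
  exists (m : nat) (lam : 'I_m -> V), forall v : V,
    (forall j, cos (pi / 8) < cos (dotp (lam j) v)) -> aperiod p F l (C_bohr * e) v.
Proof.
move=> l0 L0 e0 per.
have H i : exists Iom : {I : finType & I -> R}, forall y : R,
    (forall j, cos (pi / 8) < cos (projT2 Iom j * y)) -> aperiod p F l (C_axis * e) (y *: delta_mx 0 i).
  by have [I [om omP]] := axis_bohr i l0 L0 e0 per; exists (existT _ I om).
have [Iom omP] := choice H.
pose T := {i : 'I_n & projT1 (Iom i)}.
exists #|{: T}|, (fun k => let x : T := enum_val k in projT2 (Iom (tag x)) (tagged x) *: delta_mx 0 (tag x)).
move=> v vP.
have gi i : aperiod p F l (C_axis * e) (v 0 i *: delta_mx 0 i).
  apply: omP => j; have := vP (enum_rank (Tagged (fun i => projT1 (Iom i)) j : T)).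
  rewrite enum_rankK /=; congr (_ < cos _).
  rewrite /dotp (bigD1 i)//= !mxE !eqxx mulr1 big1 ?addr0// => k ki.
  by rewrite !mxE (negbTE ki) andbF mulr0 mul0r.
have vE : v = \sum_(i <- enum 'I_n) v 0 i *: delta_mx 0 i.
  by rewrite [LHS]row_sum_delta big_enum.
rewrite vE /C_bohr -[X in iter X](size_enum_ord n).
elim: (enum 'I_n) => [|i s IH]; first by rewrite big_nil mul0r; exact: aperiod0.
rewrite big_cons /=.
have -> : c * (C_axis + iter (size s) (fun x => c * (C_axis + x)) 0) * e =
   c * (C_axis * e + iter (size s) (fun x => c * (C_axis + x)) 0 * e) by ring.
exact: (aperiodD p1 sF (gi i) IH).
Qed.

End Bohr_set.

(** * Trigonometric approximation *)

Section Steps.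
Context d (T : measurableType d) (R : realType) (mu : {measure set T -> \bar R}).

(** The left-hand side is the integral of a step function lying below [f]; this is how averages over
    grid points are bounded by integrals. *)
Lemma nnint_steps_le (I : finType) (D : set T) (C : I -> set T) (A : I -> R) (k : R) (f : T -> R) :
  measurable D -> (forall x, measurable (C x)) -> (forall x, C x `<=` D) ->
  (forall x, mu (C x) = k%:E) -> (forall x, 0 <= A x) ->
  measurable_fun [set: T] f ->
  (forall w, \sum_x A x * \1_(C x) w <= f w) ->
  ((\sum_x A x * k)%:E <= \int[mu]_(w in D) (f w)%:E)%E.
Proof.
move=> mD mC CD Ck A0 mf Af.
have mA x : measurable_fun [set: T] (fun w => A x * \1_(C x) w).
  by apply: measurable_funM => //; exact: measurable_indic.
apply: le_trans (@nnint_le _ _ _ mu D (fun w => \sum_x A x * \1_(C x) w) f mD _ mf _ _).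
- rewrite nnint_sum//; last by move=> x w; rewrite mulr_ge0// indicE.
  rewrite -sumEFin lee_sum// => x _.
  rewrite (nnint_scale mu mD (@measurable_indic _ T R setT _ (mC x)) _ (A0 x)); last by move=> w; rewrite indicE.
  by rewrite integral_indic// setIidl// Ck EFinM.
- exact: measurable_sum.
- by move=> w; apply: sumr_ge0 => x _; rewrite mulr_ge0// indicE.
- by move=> w _.
Qed.

End Steps.

Section Jensen.
Variables (R : realType) (p : R).
Hypothesis p1 : 1 <= p.
Let p0 : 0 < p. Proof. exact: lt_le_trans p1. Qed.

Lemma bernoulli_powR (y : R) : 0 <= y -> 1 + p * (y - 1) <= y `^ p.
Proof.
move=> y0; have [->|pn1] := eqVneq p 1; first by rewrite powRr1// mul1r addrC subrK.
(* Young's inequality with one factor equal to 1. *)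
have pgt1 : 1 < p by rewrite lt_neqAle eq_sym pn1.
have q0 : 0 < 1 - p^-1 by rewrite subr_gt0 invf_lt1.
have := @conjugate_powR R y 1 p (1 - p^-1)^-1 y0 ler01 p0.
rewrite invr_gt0 q0 invrK addrC subrK => /(_ isT erefl).
rewrite mulr1 powR1 mul1r -(ler_pM2l p0).
have -> : p * (y `^ p / p + (1 - p^-1)) = y `^ p + p - 1 by field; rewrite gt_eqF.
lra.
Qed.

(** Convexity through the tangent of the power function at [a]. The total weight [W] may be less
    than 1: the tangent bounds add up to [a^p (1 + (p - 1) (1 - W))], which is at least [a^p]. *)
Lemma jensen_powR (I : Type) (s : seq I) (w x : I -> R) :
  (forall i, 0 <= w i) -> (forall i, 0 <= x i) -> \sum_(i <- s) w i <= 1 ->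
  (\sum_(i <- s) w i * x i) `^ p <= \sum_(i <- s) w i * x i `^ p.
Proof.
move=> w0 x0 W1; set a := \sum_(i <- s) w i * x i; set W := \sum_(i <- s) w i in W1.
have a0 : 0 <= a by apply: sumr_ge0 => i _; rewrite mulr_ge0.
have [->|an0] := eqVneq a 0.
  by rewrite powR0 ?gt_eqF// sumr_ge0// => i _; rewrite mulr_ge0 ?powR_ge0.
have ap : 0 < a by rewrite lt_neqAle eq_sym an0.
apply: (@le_trans _ _ (\sum_(i <- s) w i * (a `^ p * (1 + p * (x i / a - 1))))); last first.
  apply: ler_sum => i _; rewrite ler_wpM2l//.
  have {2}-> : x i = a * (x i / a) by rewrite mulrC divfK.
  by rewrite powRM ?divr_ge0// ler_wpM2l ?powR_ge0// bernoulli_powR// divr_ge0.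
have -> : \sum_(i <- s) w i * (a `^ p * (1 + p * (x i / a - 1))) =
    a `^ p * ((1 - p) * W + p / a * a).
  rewrite /a /W !mulr_sumr -/a -big_split mulr_sumr; apply: eq_bigr => i _ /=; field.
  exact: an0.
have h : 0 <= (p - 1) * (1 - W) by rewrite mulr_ge0 ?subr_ge0.
rewrite divfK// ler_peMr ?powR_ge0//.
have -> : (1 - p) * W + p = 1 + (p - 1) * (1 - W) by ring.
by rewrite lerDl.
Qed.

Lemma npow_jensen (Y : completeNormedModType R[i]) (I : Type) (s : seq I) (w : I -> R) (y : I -> Y) :
  (forall i, 0 <= w i) -> \sum_(i <- s) w i <= 1 ->
  npow p (\sum_(i <- s) (w i)%:C%C *: y i) <= \sum_(i <- s) w i * npow p (y i).
Proof.
move=> w0 W1; apply: (@le_trans _ _ ((\sum_(i <- s) w i * nrmY (y i)) `^ p)).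
  apply: npow_le => //; apply: le_trans (nrmY_sum _ _ _) _.
  by apply: ler_sum => i _; rewrite nrmYZr ger0_norm.
by apply: jensen_powR => // i; exact: nrmY_ge0.
Qed.

End Jensen.

Section Trig_measurable.
Variables (R : realType) (n : nat).
Local Notation E := (Rn R n).

Lemma measurable_dotp (a : 'rV[R]_n) : measurable_fun [set: E] (fun u : E => dotp a (toRV u)).
Proof.
apply: (@measurable_sum _ (Rn R n) R setT _ _ (fun i u => a 0 i * toRV u 0 i)) => i.
exact: (@measurable_funM _ (Rn R n) R setT (fun=> a 0 i) _ (@measurable_cst _ _ (Rn R n) R setT _) (@measurable_coord R n i)).
Qed.

Lemma measurable_rtpoly (f : 'rV[R]_n -> R) : rtpoly f -> measurable_fun [set: E] (fun u : E => f (toRV u)).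
Proof.
move=> [s sP].
rewrite (_ : (fun _ => _) = fun u : E => \sum_(x <- s) (cos (dotp x.1 (toRV u)) * complex.Re x.2 +
   sin (dotp x.1 (toRV u)) * - complex.Im x.2)).
  apply: (@measurable_sum _ (Rn R n) R setT _ _ (fun x u => cos (dotp x.1 (toRV u)) * complex.Re x.2 +
     sin (dotp x.1 (toRV u)) * - complex.Im x.2)) => x.
  have mc : measurable_fun [set: E] (fun u : E => cos (dotp x.1 (toRV u))).
    exact: (@measurableT_comp _ _ _ (Rn R n) _ R _ _ _ (continuous_measurable_fun (@continuous_cos R)) (measurable_dotp _)).
  have ms : measurable_fun [set: E] (fun u : E => sin (dotp x.1 (toRV u))).
    exact: (@measurableT_comp _ _ _ (Rn R n) _ R _ _ _ (continuous_measurable_fun (@continuous_sin R)) (measurable_dotp _)).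
  exact: (@measurable_funD _ (Rn R n) R setT _ _
    (@measurable_funM _ (Rn R n) R setT _ (fun=> _) mc (@measurable_cst _ _ (Rn R n) R setT _))
    (@measurable_funM _ (Rn R n) R setT _ (fun=> _) ms (@measurable_cst _ _ (Rn R n) R setT _))).
apply/funext => u; have /(congr1 (@complex.Re R))/= -> := sP (toRV u).
elim: s {sP} => [|x s IH]; first by rewrite !big_nil.
rewrite !big_cons raddfD/= IH; congr (_ + _).
by case: x => a [z1 z2] /=; rewrite mulrN.
Qed.

End Trig_measurable.

(** * The approximating polynomial and its error *)

Section Approximation.
Variables (R : realType) (n : nat) (p : R) (Y : completeNormedModType R[i]).
Hypothesis p1 : 1 <= p.
Local Notation E := (Rn R n).
Local Notation V := 'rV[R]_n.
Local Notation J := (@Lpint R n p Y).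
Local Notation c := (cp p).
Variables (F : V -> Y) (G : V -> Y).
Hypothesis sF : strongly_measurable F.
Variables (l h : R) (q : nat) (M a b b' : R).
Hypotheses (h0 : 0 < h) (q0 : (0 < q)%N) (lE : l = h * q%:R).
Hypotheses (a0 : 0 <= a) (b0 : 0 <= b) (b'0 : 0 <= b').
Hypothesis gG : forall u, G (flr h u) = G u.
Hypothesis GM : forall u, nrmY (G u) <= M.
Hypothesis FG : forall (t : V) (T : R), l <= T ->
  (J (tcube t T) (fun u => F u - G u)%R <= (a * T ^+ n)%:E)%E.
Hypothesis small : forall v : V, (forall i, `|v 0 i| <= h) -> aperiod p F l b' v.

Let I := {ffun 'I_n -> 'I_q}.
Let l0 : 0 < l. Proof. by rewrite lE mulr_gt0// ltr0n. Qed.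
Let c0 : 0 < c. Proof. exact: cp_gt0. Qed.
Let sG : strongly_measurable G. Proof. exact: (smeas_grid h0). Qed.

Let pts (x : I) : V := \row_i (h * ((x i : nat)%:Z)%:~R).
(* Only the upper bound [k <= h ^+ n] is needed for the volume [k] of a cell: the
   other occurrences of [k] cancel out. *)
Let k : R := fine (lebn (cell h 0 : set E)).
(** Cost of going from one translate of [G] to [F], to the other translate of [F], and back to [G]:
    twice the approximation error [a], and an almost period with tolerance [c * (b + b')], where
    [b'] pays for rounding it to the grid. *)
Definition C_transl := c * (a + c * (c * (b + b') + a)).

Let C_transl_ge0 : 0 <= C_transl.
Proof. by have c0' := ltW c0; rewrite /C_transl mulr_ge0// addr_ge0// mulr_ge0// addr_ge0// mulr_ge0// addr_ge0. Qed.

Lemma lebn_cell (s : V) : lebn (cell h s : set E) = lebn (cell h 0 : set E).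
Proof.
rewrite -(lebn_trans s); congr (lebn _).
rewrite -[RHS](hobox_trans s); congr (_ @^-1` (hobox _ _)); first by rewrite addr0.
by apply/rowP => i; rewrite !mxE add0r.
Qed.

Lemma lebn_cell_le : (lebn (cell h 0 : set E) <= (h ^+ n)%:E)%E.
Proof.
apply: le_trans (lebn_tcube_le 0 (ltW h0)); apply: le_measure; rewrite ?inE.
- exact: measurable_hobox.
- exact: measurable_tcube.
- exact: cell_tcube.
Qed.

Lemma lebn_cellE (s : V) : lebn (cell h s : set E) = k%:E.
Proof.
rewrite lebn_cell /k fineK// ge0_fin_numE ?measure_ge0//.
by rewrite (le_lt_trans lebn_cell_le)// ltry.
Qed.

Lemma k_ge0 : 0 <= k. Proof. by rewrite /k fine_ge0// measure_ge0. Qed.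

Lemma k_le : k <= h ^+ n.
Proof. by have := lebn_cell_le; rewrite lebn_cellE lee_fin. Qed.

Lemma pts_inj : injective pts.
Proof.
move=> x y xy; apply/ffunP => i; apply: val_inj; apply/eqP.
have := congr1 (fun v : V => v 0 i) xy; rewrite !mxE => /(mulfI (lt0r_neq0 h0))/eqP.
by rewrite eqr_int eqz_nat.
Qed.

Lemma pts_itv (x : I) i : 0 <= h * ((x i : nat)%:Z)%:~R <= l.
Proof.
rewrite mulr_ge0 ?(ltW h0) ?ler0z//= lE ler_pM2l//.
by rewrite -[(Posz _)%:~R]/((x i : nat)%:R) ler_nat ltnW.
Qed.

Lemma cell_pts (x : I) w : cell h (pts x) w -> flr h w = pts x.
Proof. exact: cell_flr. Qed.

(** With [v] rounded to the grid, [G (pts x + v)] equals [G (flr h v + w)] for all [w] in the cell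
    of [pts x], and likewise for [s]. The sum times the cell volume is therefore at most an integral
    over a cube of side [l], in which [G] can be exchanged for [F]. *)
Lemma translates_sum_le (v s : V) : aperiod p F l (c * (b + b')) (flr h v - flr h s) ->
  (\sum_x npow p (G (pts x + v) - G (pts x + s))) * k <= C_transl * l ^+ n.
Proof.
move=> gvs; set u1 := flr h v; set u2 := flr h s.
pose f (w : E) : R := npow p (G (u1 + toRV w) - G (u2 + toRV w)).
have s1 := smeas_trans u1 sG; have s2 := smeas_trans u2 sG.
have t1 := smeas_trans u1 sF; have t2 := smeas_trans u2 sF.
have mD : measurable (tcube 0 l : set E) by exact: measurable_tcube.
have mf : measurable_fun [set: E] f by exact: (measurable_npow p (smeasB s1 s2)).
have GE x w v' : cell h (pts x) w -> G (flr h v' + w) = G (pts x + v').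
  move=> cw.
  have e1 : flr h (flr h v' + w) = flr h v' + pts x.
    by rewrite addrC [in LHS](flrE h v') flrD// (cell_pts cw) addrC.
  have e2 : flr h (pts x + v') = flr h v' + pts x by rewrite addrC /pts flrD.
  by rewrite -gG e1 -e2 gG.
have steps (w : E) : \sum_x npow p (G (pts x + v) - G (pts x + s)) * \1_(cell h (pts x) : set E) w <= f w.
  have [[x cx]|nx] := pselect (exists x, cell h (pts x) w).
    rewrite (bigD1 x)//= indicE mem_set// mulr1 big1 ?addr0; last first.
      move=> y yx; rewrite indicE memNset ?mulr0// => cy.
      by move: yx; rewrite (pts_inj (etrans (esym (cell_pts cy)) (cell_pts cx))) eqxx.
    by rewrite /f /u1 /u2 (GE x _ _ cx) (GE x _ _ cx).
  rewrite big1 ?npow_ge0// => x _; rewrite indicE memNset ?mulr0// => cx.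
  by apply: nx; exists x.
have CD x : (cell h (pts x) : set E) `<=` tcube 0 l.
  move=> w cw i; have := cw i; rewrite /toRV !mxE add0r => /andP[w1 w2].
  rewrite (le_trans _ w1)/=; last by rewrite mulr_ge0 ?(ltW h0)// ler0z.
  apply: ltW; apply: lt_le_trans w2 _; rewrite lE -[X in _ + X]mulr1 -mulrDr ler_pM2l//.
  by rewrite -[(Posz _)%:~R]/((x i : nat)%:R) natr1 ler_nat.
have := @nnint_steps_le _ (Rn R n) R (@lebn R n) I (tcube 0 l) (fun x => cell h (pts x) : set E)
  (fun x => npow p (G (pts x + v) - G (pts x + s))) k f mD (fun x => measurable_hobox _ _) CD
  (fun x => lebn_cellE _) (fun x => npow_ge0 _ _) mf steps.
rewrite -mulr_suml => h1; rewrite -lee_fin; apply: le_trans h1 _.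
have tr (g g' : V -> Y) (u : V) B : strongly_measurable g -> strongly_measurable g' ->
    (J (tcube u l) (fun w => g w - g' w)%R <= B)%E ->
    (J (tcube 0 l) (fun w => g (u + w) - g' (u + w))%R <= B)%E.
  move=> sg sg' H; rewrite (@Lpint_tcube R n p Y u 0 l (fun w => g w - g' w)); last exact: smeasB.
  by rewrite addr0.
have j1 : (J (tcube 0 l) (fun w => G (u1 + w) - F (u1 + w))%R <= (a * l ^+ n)%:E)%E.
  by apply: (tr G F u1 _ sG sF); rewrite Lpint_sym; exact: FG.
have j2 : (J (tcube 0 l) (fun w => F (u1 + w) - F (u2 + w))%R <= (c * (b + b') * l ^+ n)%:E)%E.
  have sd := smeas_trans (u1 - u2) sF.
  by apply: Lpint_congr (tr _ _ u2 _ sd sF (gvs u2)) => w; rewrite addrA subrK.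
have j3 : (J (tcube 0 l) (fun w => F (u2 + w) - G (u2 + w))%R <= (a * l ^+ n)%:E)%E.
  exact: (tr F G u2 _ sF sG (FG u2 (lexx l))).
have j4 := Lpint_tri_scaled p1 t1 t2 s2 mD j2 j3.
exact: (Lpint_tri_scaled p1 s1 t1 s2 mD j1 j4).
Qed.

Lemma npowG_le u v : npow p (G u - G v) <= (M + M) `^ p.
Proof. by apply: npow_le => //; rewrite (le_trans (nrmYB _ _))// lerD. Qed.

Variables (m : nat) (lam : 'I_m -> V).
Hypothesis bohr : forall v : V, (forall j, cos (pi / 8) < cos (dotp (lam j) v)) -> aperiod p F l b v.

(** The rounding errors of [v] and [s] differ by at most [h] in each coordinate, so their difference
    is a small vector. *)
Lemma aperiod_flr (v s : V) : aperiod p F l b (v - s) -> aperiod p F l (c * (b + b')) (flr h v - flr h s).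
Proof.
move=> gvs.
have -> : flr h v - flr h s = (v - s) + ((s - flr h s) - (v - flr h v)).
  by apply/rowP => i; rewrite !mxE; ring.
apply: (aperiodD p1 sF gvs); apply: small => i.
have := flr_cell v h0 i; have := flr_cell s h0 i; rewrite !mxE => /andP[x1 x2] /andP[y1 y2].
by rewrite ler_norml; apply/andP; split; lra.
Qed.

Section Weights.
Variables (eta : R) (K : nat) (s : 'I_K -> V) (phi : 'I_K -> V -> R).
Hypotheses (eta01 : 0 <= eta) (rphi : forall i, rtpoly (phi i)) (phi0 : forall i v, 0 <= phi i v).
Hypothesis phiP : forall v, [/\ 1 - eta <= \sum_i phi i v, \sum_i phi i v <= 1 &
    \sum_(i | ~~ [forall j, cos (pi / 8) < cos (dotp (lam j) (v - s i))]) phi i v <= eta].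

Let N : R := #|{: I}|%:R.
Let N0 : 0 < N.
Proof. by rewrite /N ltr0n card_ffun !card_ord expn_gt0 q0. Qed.

Let NE : N * h ^+ n = l ^+ n.
Proof. by rewrite /N card_ffun !card_ord natrX lE exprMn mulrC. Qed.

(* [P] averages over the [q ^ n] grid points [pts x] of a cube of side [l], because
   almost periods only control means of [G] over such cubes. *)
Let P t : Y := \sum_x (N^-1)%:C%C *: \sum_i (phi i (t - pts x))%:C%C *: G (pts x + s i).

Let e (x : I) (v : V) : R := \sum_i phi i v * npow p (G (pts x + v) - G (pts x + s i)).

Let e_ge0 x v : 0 <= e x v.
Proof. by apply: sumr_ge0 => i _; rewrite mulr_ge0 ?npow_ge0. Qed.

Let trigP : is_trigpol P.
Proof.
apply: tpoly_is_trigpol; apply: tpoly_sum => x.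
apply: tpolyZ; first exact: tpoly_cst.
apply: tpoly_sum => i; apply: tpolyZ; last exact: tpoly_cst.
exact: (rtpoly_shift (pts x) (rphi i)).
Qed.

(** The weights add up to some [S] in [[1 - eta, 1]]. Jensen's inequality over [x] reduces the claim
    to single grid points, where [G t] is compared with [S] times [G t], and Jensen's inequality
    over [i] does the rest. *)
Lemma pointwise_error t : npow p (G t - P t) <=
  c * (eta * M `^ p) + c * N^-1 * \sum_x e x (t - pts x).
Proof.
have hN : N^-1 *+ #|{: I}| = 1 by rewrite -[LHS]mulr_natr mulVf// gt_eqF.
have -> : G t - P t = \sum_x (N^-1)%:C%C *: (G t - \sum_i (phi i (t - pts x))%:C%C *: G (pts x + s i)).
  under [RHS]eq_bigr do rewrite scalerBr.
  rewrite sumrB -scaler_suml sumr_const -raddfMn/= hN; congr (_ - _).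
  by rewrite scale1r.
apply: le_trans (npow_jensen p1 _ _ _) _.
- by move=> x; rewrite invr_ge0 ltW.
- by rewrite sumr_const hN.
rewrite -mulr_sumr.
apply: (@le_trans _ _ (N^-1 * \sum_x (c * (eta * M `^ p + e x (t - pts x))))).
  rewrite ler_wpM2l ?invr_ge0 ?(ltW N0)//; apply: ler_sum => x _.
  set v := t - pts x; have [S1 S2 _] := phiP v; set S := \sum_i _ in S1 S2.
  apply: le_trans (npow_tri p1 (S%:C%C *: G t) _ _) _.
  rewrite ler_wpM2l ?(ltW c0)// lerD//.
    have -> : G t - S%:C%C *: G t = (1 - S)%:C%C *: G t by rewrite rmorphB rmorph1 scalerBl scale1r.
    (* Jensen's inequality for the single weight [1 - S] gives a factor [1 - S], at most [eta]. *)
    have := @npow_jensen R p p1 Y unit [:: tt] (fun=> 1 - S) (fun=> G t).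
    rewrite !big_seq1 => H; apply: le_trans (H _ _) _; first by move=> _; rewrite subr_ge0.
      by rewrite lerBlDr lerDl /S sumr_ge0.
    by rewrite ler_pM ?subr_ge0 ?npow_ge0//; [rewrite lerBlDr addrC -lerBlDr|exact: npow_le].
  have -> : S%:C%C *: G t - \sum_i (phi i v)%:C%C *: G (pts x + s i) =
     \sum_i (phi i v)%:C%C *: (G t - G (pts x + s i)).
    by under [RHS]eq_bigr do rewrite scalerBr; rewrite sumrB -scaler_suml -rmorph_sum.
  apply: le_trans (npow_jensen p1 _ _ _) _ => //.
  have vE : pts x + v = t by rewrite /v addrC subrK.
  by rewrite /e vE.
rewrite -mulr_sumr big_split/= sumr_const -mulr_natr -/N.
rewrite le_eqVlt; apply/orP; left; apply/eqP; field; rewrite gt_eqF//.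
Qed.

(** Indices for which [v - s i] misses the Bohr set have total weight at most [eta] and get the
    crude bound [(M + M) ^ p]; for the others [v - s i] is an almost period. *)
Lemma weighted_sum_le v : (\sum_x e x v) * k <= N * eta * (M + M) `^ p * k + C_transl * l ^+ n.
Proof.
have [S1 S2 S3] := phiP v.
pose g i := \sum_x npow p (G (pts x + v) - G (pts x + s i)).
have -> : \sum_x e x v = \sum_i phi i v * g i.
  by rewrite /e exchange_big/=; apply: eq_bigr => i _; rewrite mulr_sumr.
rewrite mulr_suml (bigID [pred i | [forall j, cos (pi / 8) < cos (dotp (lam j) (v - s i))]])/= addrC.
apply: lerD.
  apply: (@le_trans _ _ (\sum_(i | ~~ [forall j, cos (pi / 8) < cos (dotp (lam j) (v - s i))]) phi i v * (N * (M + M) `^ p * k))).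
    apply: ler_sum => i _; rewrite -mulrA ler_wpM2l// ler_wpM2r ?k_ge0//.
    rewrite /g (le_trans (ler_sum _ (fun x _ => npowG_le _ _)))// sumr_const -[leLHS]mulr_natl//.
  rewrite -mulr_suml; apply: le_trans (ler_wpM2r _ S3) _.
    by rewrite !mulr_ge0 ?powR_ge0 ?k_ge0// ltW.
  by rewrite le_eqVlt; apply/orP; left; apply/eqP; ring.
apply: (@le_trans _ _ (\sum_(i | [forall j, cos (pi / 8) < cos (dotp (lam j) (v - s i))]) phi i v * (C_transl * l ^+ n))).
  apply: ler_sum => i /forallP ii; rewrite -mulrA ler_wpM2l//.
  apply: translates_sum_le; exact: aperiod_flr (bohr ii).
rewrite -mulr_suml ler_piMl//; first by rewrite mulr_ge0 ?exprn_ge0 ?(ltW l0).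
apply: le_trans S2; rewrite [leRHS](bigID [pred i | [forall j, cos (pi / 8) < cos (dotp (lam j) (v - s i))]])/=.
by rewrite lerDl sumr_ge0.
Qed.

Let me x : measurable_fun [set: E] (fun u : E => e x (toRV u)).
Proof.
apply: (@measurable_sum _ (Rn R n) R setT _ _ (fun i u => phi i (toRV u) * npow p (G (pts x + toRV u) - G (pts x + s i)))) => i.
have sc : strongly_measurable (fun _ : V => G (pts x + s i)) by apply: (smeas_grid h0).
exact: (@measurable_funM _ (Rn R n) R setT _ _ (measurable_rtpoly (rphi i))
  (measurable_npow p (smeasB (smeas_trans (pts x) sG) sc))).
Qed.

Let Bk : R := N * eta * (M + M) `^ p * k + C_transl * l ^+ n.

Let Bk_ge0 : 0 <= Bk.
Proof.
have N0' := ltW N0; have k0 := k_ge0.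
apply: addr_ge0; last by apply: mulr_ge0 => //; apply: exprn_ge0; exact: ltW.
by apply: mulr_ge0 => //; apply: mulr_ge0; [exact: mulr_ge0|exact: powR_ge0].
Qed.

(** Only the product [C * k] enters the integral over a cell: for nonzero [k] the previous estimate
    is divided by [k], and for [k = 0] any uniform bound serves. *)
Let sum_bound : exists C : R, (forall v, \sum_x e x v <= C) /\ C * k <= Bk.
Proof.
have [k0|k0] := eqVneq k 0; last first.
  have kp : 0 < k by rewrite lt_neqAle eq_sym k0 k_ge0.
  exists (Bk / k); split=> [v|]; last by rewrite divfK.
  by rewrite ler_pdivlMr// weighted_sum_le.
exists (N * (M + M) `^ p); split=> [v|]; last by rewrite k0 mulr0.
apply: (@le_trans _ _ (\sum_(x : I) (M + M) `^ p)); last by rewrite sumr_const -[leLHS]mulr_natl.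
apply: ler_sum => x _; have [_ S2 _] := phiP v.
apply: (@le_trans _ _ (\sum_i phi i v * (M + M) `^ p)).
  by apply: ler_sum => i _; rewrite ler_wpM2l// npowG_le.
by rewrite -mulr_suml ler_piMl// powR_ge0.
Qed.

Let hl : h <= l.
Proof. by rewrite lE ler_peMr ?(ltW h0)// ler1n. Qed.

(** Undoing the shifts by [pts x] moves all integrals into one cube of side [T + l], where the sum
    over [x] is bounded pointwise. At most [(3 (T + l) / h)^n] cells cover this cube, and
    [T + l <= 2 T]. *)
Lemma weighted_int_le (t : V) (T : R) : l <= T ->
  (\sum_x \int[@lebn R n]_(u in tcube t T) (e x (toRV u - pts x))%:E <= (Bk * (6 * T / h) ^+ n)%:E)%E.
Proof.
move=> lT; have T0 : 0 < T by exact: lt_le_trans lT.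
pose t' : V := t - \row_i l; pose D : set E := tcube t' (T + l).
have mD : measurable D by exact: measurable_tcube.
have shift x : (\int[@lebn R n]_(u in tcube t T) (e x (toRV u - pts x))%:E <= \int[@lebn R n]_(u in D) (e x (toRV u))%:E)%E.
  have mt : measurable (tcube (- pts x + t) T : set E) by exact: measurable_tcube.
  have := @integral_trans R n (- pts x) (tcube (- pts x + t) T) (fun u => (e x (toRV u))%:E) mt.
  rewrite tcube_trans => H.
  have -> : (\int[@lebn R n]_(u in tcube t T) (e x (toRV u - pts x))%:E =
    \int[@lebn R n]_(u in tcube (- pts x + t) T) (e x (toRV u))%:E)%E.
    rewrite H; first by apply: eq_integral => u _; rewrite /trans /toRV addrC.
      by apply/measurable_EFinP/measurable_funTS; exact: me.
    by move=> u _; rewrite lee_fin.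
  apply: (@nnint_subset _ (Rn R n) R (@lebn R n) _ D (fun u => e x (toRV u)) mt mD (me x) (fun u => e_ge0 _ _)).
  move=> u ut i; have := ut i; rewrite !mxE => /andP[u1 u2].
  have /andP[x0 xl] := pts_itv x i.
  by apply/andP; split; lra.
apply: le_trans (lee_sum _ (fun x _ => shift x)) _.
rewrite -(@nnint_sum _ (Rn R n) R (@lebn R n) I (index_enum I) D (fun x u => e x (toRV u)) mD me (fun x u => e_ge0 _ _)).
have mS := @measurable_sum _ (Rn R n) R setT I (index_enum I) (fun x u => e x (toRV u)) me.
have S0 (u : E) : 0 <= \sum_x e x (toRV u) by apply: sumr_ge0.
have [C [eC Ck]] := sum_bound.
have cellB (z : V) : flr h z = z -> (\int[@lebn R n]_(u in (cell h z : set E)) (\sum_x e x (toRV u))%:E <= Bk%:E)%E.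
  move=> _; have mc : measurable (cell h z : set E) by exact: measurable_hobox.
  apply: le_trans (@nnint_le_cst _ (Rn R n) R (@lebn R n) _ _ C mc mS S0 (fun u _ => eC _)) _.
  by rewrite [X in (C%:E * X)%E](lebn_cellE z) -EFinM lee_fin.
have hT : h <= T + l by rewrite (le_trans hl)// lerDr ltW.
apply: le_trans (grid_cover t' h0 hT mS S0 Bk_ge0 cellB) _.
rewrite lee_fin ler_wpM2l// lerXn2r ?nnegrE ?divr_ge0 ?mulr_ge0 ?addr_ge0 ?(ltW h0) ?(ltW T0) ?(ltW l0)//.
by rewrite ler_pM2r ?invr_gt0//; lra.
Qed.

Lemma Lpint_error (t : V) (T : R) : l <= T ->
  (J (tcube t T) (fun u => G u - P u)%R <=
   ((c * (eta * M `^ p) + c * 6 ^+ n * (eta * (M + M) `^ p + C_transl)) * T ^+ n)%:E)%E.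
Proof.
move=> lT; have T0 : 0 < T by exact: lt_le_trans lT.
have mt : measurable (tcube t T : set E) by exact: measurable_tcube.
have N0' : 0 <= N^-1 by rewrite invr_ge0 ltW.
have cN0 : 0 <= c * N^-1 by rewrite mulr_ge0// ltW.
pose A := c * (eta * M `^ p); have A0 : 0 <= A by rewrite !mulr_ge0 ?powR_ge0// ltW.
have mex x : measurable_fun [set: E] (fun u : E => e x (toRV u - pts x)).
  have -> : (fun u : E => e x (toRV u - pts x)) = (fun u : E => e x (toRV u)) \o trans (- pts x).
    by apply/funext => u; rewrite /= /trans /toRV addrC.
  exact: (@measurableT_comp _ _ _ (Rn R n) (Rn R n) R _ _ _ (me x) (@measurable_trans R n (- pts x))).
have mS := @measurable_sum _ (Rn R n) R setT I (index_enum I) (fun x u => e x (toRV u - pts x)) mex.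
have S0 (u : E) : 0 <= \sum_x e x (toRV u - pts x) by apply: sumr_ge0.
have mcst := @measurable_cst _ _ (Rn R n) R setT A.
have mcS := @measurable_funM _ (Rn R n) R setT (fun=> c * N^-1) _ (@measurable_cst _ _ (Rn R n) R setT _) mS.
have mg := @measurable_funD _ (Rn R n) R setT _ _ mcst mcS.
apply: le_trans (@nnint_le _ (Rn R n) R (@lebn R n) (tcube t T) _ _ mt (measurable_npow p (smeasB sG (smeas_trigpol trigP)))
  mg (fun u => npow_ge0 _ _) (fun u _ => pointwise_error (toRV u))) _.
have cS0 (u : E) : 0 <= c * N^-1 * \sum_x e x (toRV u - pts x) by rewrite mulr_ge0.
rewrite (@nnintD _ (Rn R n) R (@lebn R n) (tcube t T) (fun=> A) _ mt mcst mcS (fun=> A0) cS0).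
rewrite (@nnint_scale _ (Rn R n) R (@lebn R n) (tcube t T) _ (c * N^-1) mt mS S0 cN0).
rewrite (@nnint_sum _ (Rn R n) R (@lebn R n) I (index_enum I) (tcube t T) (fun x u => e x (toRV u - pts x)) mt mex (fun x u => e_ge0 _ _)).
have i1 : (\int[@lebn R n]_(u in tcube t T) A%:E <= (A * T ^+ n)%:E)%E.
  apply: le_trans (@nnint_le_cst _ (Rn R n) R (@lebn R n) (tcube t T) (fun=> A) A mt mcst (fun=> A0) (fun _ _ => lexx _)) _.
  by rewrite [leRHS]EFinM lee_wpmul2l ?lee_fin// lebn_tcube_le// ltW.
have i2 : ((c * N^-1)%:E * \sum_x \int[@lebn R n]_(u in tcube t T) (e x (toRV u - pts x))%:E <=
    (c * N^-1 * (Bk * (6 * T / h) ^+ n))%:E)%E.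
  by rewrite [leRHS]EFinM lee_wpmul2l ?lee_fin// weighted_int_le.
apply: le_trans (leeD i1 i2) _.
rewrite -EFinD lee_fin [leRHS]mulrDl; apply: lerD; first exact: lexx.
have hn0 : 0 < h ^+ n by exact: exprn_gt0.
(* As [N h^n = l^n], the factor [1 / N] of the average turns the number of cells into
   [6^n T^n / l^n], and this [l^n] cancels the one in [Bk]. *)
have -> : c * N^-1 * (Bk * (6 * T / h) ^+ n) = c * 6 ^+ n * (Bk / (N * h ^+ n)) * T ^+ n.
  by rewrite !exprMn exprVn; field; rewrite !gt_eqF.
rewrite ler_wpM2r ?exprn_ge0 ?(ltW T0)// ler_wpM2l ?mulr_ge0 ?exprn_ge0 ?(ltW c0)//.
rewrite ler_pdivrMr ?mulr_gt0// /Bk -NE [leRHS]mulrDl; apply: lerD; last exact: lexx.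
have -> : eta * (M + M) `^ p * (N * h ^+ n) = N * eta * (M + M) `^ p * h ^+ n by ring.
by rewrite ler_wpM2l ?k_le// !mulr_ge0 ?powR_ge0// ltW.
Qed.

Lemma weighted_approx : exists P : V -> Y, is_trigpol P /\ forall (t : V) (T : R), l <= T ->
  (J (tcube t T) (fun u => G u - P u)%R <=
   ((c * (eta * M `^ p) + c * 6 ^+ n * (eta * (M + M) `^ p + C_transl)) * T ^+ n)%:E)%E.
Proof. by exists P; split; [exact: trigP|exact: Lpint_error]. Qed.

End Weights.
End Approximation.

Section Main.
Variables (R : realType) (n : nat) (p : R) (Y : completeNormedModType R[i]).
Hypothesis p1 : 1 <= p.
Local Notation V := 'rV[R]_n.
Local Notation J := (@Lpint R n p Y).
Local Notation c := (cp p).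

Lemma eWap_eW (F : V -> Y) : strongly_measurable F -> locLp p F -> eWap p F -> eW p F.
Proof.
move=> sF lF /(eWapP p1) H; apply/(eWP p1) => eps eps0.
have c0 : 0 < c by exact: cp_gt0.
have c1 := ltW c0; have c2 := sqr_ge0 c.
pose A := 3 ^+ n * C_step p; pose B := C_bohr n p; pose B' := C_small p.
have B'0 : 0 <= B' by rewrite /B' /C_small mulr_ge0// addr_ge0// mulr_ge0// addr_ge0// mulr_ge0.
have A0 : 0 <= A.
  apply: mulr_ge0; first exact: exprn_ge0.
  rewrite /C_step -/B'; apply: mulr_ge0 => //; apply: addr_ge0; first by apply: mulr_ge0 => //; exact: addr_ge0.
  by rewrite mulr_ge0// addr_ge0.
have B0 : 0 <= B.
  have C_net_ge0 : 0 <= C_net p by rewrite /C_net -/B' mulr_ge0// addr_ge0// mulr_ge0// addr_ge0.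
  have C_grid_ge0 : 0 <= C_grid p by rewrite /C_grid mulr_ge0// addr_ge0// mulr_ge0// addr_ge0// mulr_ge0// addr_ge0.
  have C_axis_ge0 : 0 <= C_axis p by rewrite /C_axis -/B' mulr_ge0// addr_ge0.
  by rewrite /B /C_bohr; elim: (X in iter X) => [|k IH] //=; rewrite mulr_ge0// addr_ge0.
(* The final error will be [K * e]; the 1 pays for all terms containing [eta]. *)
pose K := c * (A + (1 + c * 6 ^+ n * C_transl p A B B')).
have C_transl_ge0 : 0 <= C_transl p A B B' by rewrite /C_transl mulr_ge0// addr_ge0// mulr_ge0// addr_ge0// mulr_ge0// addr_ge0.
have K0 : 0 < K.
  rewrite mulr_gt0// ltr_wpDl// ltr_pwDl// mulr_ge0// mulr_ge0// exprn_ge0//.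
pose e := eps / K; have e0 : 0 < e by rewrite divr_gt0.
have [l [l0 [L [L0 per']]]] := H e e0.
have {per'}per : dense_aperiods p F l L e := per'.
have [d [d0 dP]] := aperiod_small p1 sF lF l0 L0 e0 per.
have [h [q [G [/andP[h0 hd] [q0 lE] gG [M GM] FGc]]]] := step_approx p1 sF lF l0 L0 e0 d0 per.
have sG : strongly_measurable G by exact: (smeas_grid h0).
have FG t T : l <= T -> (J (tcube t T) (fun u => F u - G u)%R <= (A * e * T ^+ n)%:E)%E.
  by move=> lT; exact: (step_approx_cube sF t l0 h0 e0 lT gG FGc).
have small (v : V) : (forall i, `|v 0 i| <= h) -> aperiod p F l (B' * e) v.
  by move=> vh; apply: dP => i; exact: le_trans (vh i) hd.
have [m [lam bohr]] := bohr_aperiod p1 sF lF l0 L0 e0 per.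
(* [X] collects the coefficients of [eta]; the added 1 keeps it positive. *)
pose X := c * M `^ p + c * 6 ^+ n * (M + M) `^ p + 1.
have X0 : 0 < X.
  by rewrite ltr_wpDl// addr_ge0// ?mulr_ge0 ?exprn_ge0 ?powR_ge0.
pose eta := e / X; have eta0 : 0 < eta by rewrite divr_gt0.
(* The partition of unity is parametrised by the gap between 1 and the threshold of the Bohr set,
   here [cos (pi / 8)]. *)
have k0 : 0 < 1 - cos (pi / 8) :> R.
  rewrite subr_gt0 -[ltRHS]cos0; have pp := pi_gt0 R.
  rewrite ltr_cos; first by lra.
    by rewrite in_itv/=; apply/andP; split; lra.
  by rewrite in_itv/=; apply/andP; split; lra.
have [N [s [phi [rphi phi0 phiP]]]] := @trig_partition R n m lam _ eta k0 eta0.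
have phiP' v : [/\ 1 - eta <= \sum_i phi i v, \sum_i phi i v <= 1 &
    \sum_(i | ~~ [forall j, cos (pi / 8) < cos (dotp (lam j) (v - s i))]) phi i v <= eta].
  by have [h1 h2 h3] := phiP v; split => //; move: h3; rewrite subKr.
have Ae := mulr_ge0 A0 (ltW e0); have Be := mulr_ge0 B0 (ltW e0).
have B'e := mulr_ge0 B'0 (ltW e0).
have [P [tP GP]] := weighted_approx p1 sF h0 q0 lE Ae Be B'e gG GM FG small bohr (ltW eta0) rphi phi0 phiP'.
exists l; split => //; exists P; split => // T lT t.
have T0 : 0 < T by exact: lt_le_trans lT.
have sP := smeas_trigpol tP.
rewrite (@Lpint_tcube R n p Y t 0 T (fun u => P u - F u)); last exact: smeasB.
rewrite addr0 Lpint_sym.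
have mt : measurable (tcube t T : set (Rn R n)) by exact: measurable_tcube.
apply: le_trans (Lpint_tri_scaled p1 sF sG sP mt (FG t T lT) (GP t T lT)) _.
rewrite lee_fin ler_wpM2r ?exprn_ge0 ?(ltW T0)//.
have -> : C_transl p (A * e) (B * e) (B' * e) = C_transl p A B B' * e by rewrite /C_transl; ring.
have etaX : c * (eta * M `^ p) + c * 6 ^+ n * (eta * (M + M) `^ p) <= e.
  have -> : c * (eta * M `^ p) + c * 6 ^+ n * (eta * (M + M) `^ p) = eta * (X - 1) by rewrite /X; ring.
  rewrite /eta mulrAC ler_pdivrMr// ler_pM2l// lerBlDr lerDl//.
have -> : eps = c * (A * e + (e + c * 6 ^+ n * (C_transl p A B B' * e))).
  have -> : eps = K * e by rewrite /e mulrC divfK// gt_eqF.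
  by rewrite /K; ring.
rewrite ler_pM2l// lerD2l [c * 6 ^+ n * (_ + _)]mulrDr addrA.
by rewrite lerD2r.
Qed.

End Main.

Theorem theorem3p12 (R : realType) (n : nat) (p : R)
    (Y : completeNormedModType R[i]) (F : 'rV[R]_n -> Y) :
  1 <= p ->
  @strongly_measurable R n Y F ->
  @locLp R n p Y F ->
  (@eWap R n p Y F <-> @eW R n p Y F).
Proof.
by move=> p1 sF lF; split; [exact: eWap_eW|exact: eW_eWap].
Qed.
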